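(* Let $0<\beta<1$ and let $b$ be a locally integrable function on $\mathbb{Q}_p^n$. Then the following statements are equivalent: (C.1) $b\in\Lambda_\beta(\mathbb{Q}_p^n)$ and $b\ge0$. (C.2) The commutator $[b,\mathcal{M}^p]$ is bounded from $L^{r(\cdot)}(\mathbb{Q}_p^n)$ to $L^{q(\cdot)}(\mathbb{Q}_p^n)$ for all $r(\cdot),q(\cdot)\in\mathscr{C}^{\log}(\mathbb{Q}_p^n)$ with $r(\cdot)\in\mathscr{P}(\mathbb{Q}_p^n)$, $r_+<\frac{n}{\beta}$ and $1/q(\cdot)=1/r(\cdot)-\beta/n$. (C.3) The commutator $[b,\mathcal{M}^p]$ is bounded from $L^{r(\cdot)}(\mathbb{Q}_p^n)$ to $L^{q(\cdot)}(\mathbb{Q}_p^n)$ for some $r(\cdot),q(\cdot)\in\mathscr{C}^{\log}(\mathbb{Q}_p^n)$ with $r(\cdot)\in\mathscr{P}(\mathbb{Q}_p^n)$, $r_+<\frac{n}{\beta}$ and $1/q(\cdot)=1/r(\cdot)-\beta/n$. (C.4) There exist some $r(\cdot),q(\cdot)\in\mathscr{C}^{\log}(\mathbb{Q}_p^n)$ with $r(\cdot)\in\mathscr{P}(\mathbb{Q}_p^n)$, $r_+<\frac{n}{\beta}$ and $1/q(\cdot)=1/r(\cdot)-\beta/n$ such that $$\sup_{\gamma\in\mathbb{Z},\,x\in\mathbb{Q}_p^n}\frac{1}{|B_\gamma(x)|_h^{\beta/n}}\,\frac{\big\|\big(b-\mathcal{M}_{B_\gamma(x)}^p(b)\big)\chi_{B_\gamma(x)}\big\|_{L^{q(\cdot)}(\mathbb{Q}_p^n)}}{\|\chi_{B_\gamma(x)}\|_{L^{q(\cdot)}(\mathbb{Q}_p^n)}}<\infty.$$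 (C.5) For all $r(\cdot),q(\cdot)\in\mathscr{C}^{\log}(\mathbb{Q}_p^n)$ with $r(\cdot)\in\mathscr{P}(\mathbb{Q}_p^n)$, $r_+<\frac{n}{\beta}$ and $1/q(\cdot)=1/r(\cdot)-\beta/n$, the displayed supremum in (C.4) is finite.
   Context: Let $p$ be a prime, $n\ge1$, $\mathbb{Q}_p$ the field of $p$-adic numbers with $p$-adic absolute value $|\cdot|_p$, and $\mathbb{Q}_p^n$ equipped with $|x|_p=\max_{1\le j\le n}|x_j|_p$. For $\gamma\in\mathbb{Z}$ and $a\in\mathbb{Q}_p^n$, $B_\gamma(a)=\{x\in\mathbb{Q}_p^n:|x-a|_p\le p^\gamma\}$. Haar measure on $\mathbb{Q}_p^n$ is normalized by $|B_0(0)|_h=1$, so $|B_\gamma(a)|_h=p^{n\gamma}$; $|E|_h$ is the Haar measure of $E$, $dx$ denotes integration against it, and $\chi_E$ is the characteristic function of $E$. Functions are real-valued, and as usual functions equal almost everywhere are identified in function spaces. Hardy–Littlewood maximal function: for $f$ measurable, $\mathcal{M}^p(f)(x)=\sup_{\gamma\in\mathbb{Z}}|B_\gamma(x)|_h^{-1}\int_{B_\gamma(x)}|f(y)|\,dy$. For a fixed ball $B_*$, $\mathcal{M}_{B_*}^p(f)(x)=\sup_{\gamma\in\mathbb{Z}:\,B_\gamma(x)\subset B_*}|B_\gamma(x)|_h^{-1}\int_{B_\gamma(x)}|f(y)|\,dy$ for $x\in B_*$. Nonlinear commutator: $[b,\mathcal{M}^p](f)(x)=b(x)\mathcal{M}^p(f)(x)-\mathcal{M}^p(bf)(x)$.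 An operator $T$ is bounded from a normed function space $X$ to $Y$ if there is a constant $C$ with $\|Tf\|_Y\le C\|f\|_X$ for all $f\in X$. Lipschitz space ($0<\beta<1$): $\Lambda_\beta(\mathbb{Q}_p^n)$ is the set of measurable $f$ with $\|f\|_{\Lambda_\beta(\mathbb{Q}_p^n)}=\sup_{x\ne y}\frac{|f(x)-f(y)|}{|x-y|_p^\beta}<\infty$. Variable exponents: for measurable $q(\cdot)$ on $\mathbb{Q}_p^n$ put $q_-=\operatorname{ess\,inf}_{x\in\mathbb{Q}_p^n}q(x)$, $q_+=\operatorname{ess\,sup}_{x\in\mathbb{Q}_p^n}q(x)$, and $q_\pm(B)$ for the corresponding quantities over a ball $B$. $\mathscr{P}(\mathbb{Q}_p^n)$ is the set of measurable $q(\cdot):\mathbb{Q}_p^n\to(1,\infty)$ with $1<q_-\le q(x)\le q_+<\infty$. $L^{q(\cdot)}(\mathbb{Q}_p^n)$ is the space of measurable $f$ with $\int_{\mathbb{Q}_p^n}(|f(x)|/\eta)^{q(x)}dx<\infty$ for some $\eta>0$, with norm $\|f\|_{L^{q(\cdot)}(\mathbb{Q}_p^n)}=\inf\{\eta>0:\int_{\mathbb{Q}_p^n}(|f(x)|/\eta)^{q(x)}dx\le1\}$. $\mathscr{C}^{\log}(\mathbb{Q}_p^n)$ is the set of $q(\cdot)\in\mathscr{P}(\mathbb{Q}_p^n)$ for which there is a constant $C>0$ such that (i) $\gamma\,(q_-(B_\gamma(x))-q_+(B_\gamma(x)))\le C$ for all $\gamma\in\mathbb{Z}$, $x\in\mathbb{Q}_p^n$,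 and (ii) $|q(x)-q(y)|\le\frac{C}{\log_p(p+\min\{|x|_p,|y|_p\})}$ for all $x,y\in\mathbb{Q}_p^n$. *)

(* Defs.v *)
From HB Require Import structures.
From mathcomp Require Import all_boot all_order all_algebra ring_quotient.
From mathcomp Require Import all_classical all_reals all_analysis ess_sup_inf.

Set Implicit Arguments.
Unset Strict Implicit.
Unset Printing Implicit Defensive.

Import Order.TTheory GRing.Theory Num.Theory.
Import numFieldNormedType.Exports.

Local Open Scope classical_set_scope.
Local Open Scope ring_scope.

(* When p is not prime, logn p vanishes and this is the trivial absolute value,
   so that the construction below yields a field for every p. *)
Definition padic_abs (p : nat) (x : rat) : rat :=
  if x == 0 then 0
  else p%:Q ^ ((logn p `|denq x|)%:Z - (logn p `|numq x|)%:Z).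

Section PadicAbs.
Variable p : nat.
Local Notation v := (padic_abs p).

Lemma padic_abs0 : v 0 = 0.
Proof. by rewrite /padic_abs eqxx. Qed.

Lemma padic_abs_nprime x : ~~ prime p -> v x = (x != 0)%:R.
Proof.
rewrite /padic_abs => /negPf pF; case: eqVneq => //= _.
by rewrite /logn pF subrr expr0z.
Qed.

Lemma padic_abs_frac (a b : int) : a != 0 -> b != 0 ->
  v (a%:~R / b%:~R) = p%:Q ^ ((logn p `|b|)%:Z - (logn p `|a|)%:Z).
Proof.
move=> a0 b0; set x : rat := _ / _.
have b0' : b%:~R != 0 :> rat by rewrite intr_eq0.
have x0 : x != 0 by rewrite mulf_neq0 ?invr_eq0 ?intr_eq0.
have dx0 : denq x != 0 := denq_neq0 x.
have nx0 : numq x != 0 by rewrite numq_eq0.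
have /eqP : (numq x)%:~R / (denq x)%:~R = a%:~R / b%:~R :> rat := divq_num_den x.
rewrite eqr_div ?intr_eq0 // -!intrM eqr_int => /eqP/(congr1 (logn p \o absz)).
rewrite /= !abszM !lognM ?absz_gt0 // /padic_abs (negPf x0) => e.
congr (_ ^ _); apply/eqP; rewrite subr_eq addrAC eq_sym subr_eq.
by rewrite -!PoszD eqz_nat addnC e addnC.
Qed.

Lemma padic_abs1 : v 1 = 1.
Proof. by rewrite /padic_abs oner_eq0 /= logn1 subrr. Qed.

Lemma padic_abs_ge0 x : 0 <= v x.
Proof. by rewrite /padic_abs; case: eqP => // _; rewrite exprz_ge0 ?ler0n. Qed.

Lemma padic_abs_eq0 x : (v x == 0) = (x == 0).
Proof.
have [p_pr|p_npr] := boolP (prime p).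
  have [->|x0] := eqVneq x 0; first by rewrite padic_abs0 eqxx.
  rewrite /padic_abs (negPf x0); apply/negbTE.
  by rewrite expfz_eq0 intr_eq0 eqz_nat [p == _]eqn0Ngt prime_gt0 ?andbF.
by rewrite padic_abs_nprime //; case: (x == 0).
Qed.

Lemma padic_absM x y : v (x * y) = v x * v y.
Proof.
have [p_pr|p_npr] := boolP (prime p); last first.
  by rewrite !padic_abs_nprime // mulf_eq0 negb_or -mulnb natrM.
have [->|x0] := eqVneq x 0; first by rewrite mul0r padic_abs0 mul0r.
have [->|y0] := eqVneq y 0; first by rewrite mulr0 padic_abs0 mulr0.
have exy : x * y = (numq x * numq y)%:~R / (denq x * denq y)%:~R.
  by rewrite !intrM -mulf_div !divq_num_den.
have nz := (numq_eq0 x, numq_eq0 y, denq_eq0 x, denq_eq0 y).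
rewrite exy padic_abs_frac ?mulf_neq0 ?nz //.
rewrite /padic_abs (negPf x0) (negPf y0) -expfzDr; last first.
  by rewrite intr_eq0 eqz_nat -lt0n prime_gt0.
rewrite !abszM !lognM ?absz_gt0 ?nz // !PoszD.
by congr (_ ^ _); rewrite opprD addrACA.
Qed.

Lemma padic_absN x : v (- x) = v x.
Proof. by rewrite /padic_abs oppr_eq0 denqN numqN abszN. Qed.

Lemma padic_abs_distC x y : v (x - y) = v (y - x).
Proof. by rewrite -opprB padic_absN. Qed.

Lemma padic_absV x : v x^-1 = (v x)^-1.
Proof.
have [->|x0] := eqVneq x 0; first by rewrite !(invr0, padic_abs0).
have ax0 : v x != 0 by rewrite padic_abs_eq0.
by apply: (mulfI ax0); rewrite -padic_absM !divff // padic_abs1.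
Qed.

Lemma padic_absD (x y : rat) : v (x + y) <= Num.max (v x) (v y).
Proof.
have [p_pr|p_npr] := boolP (prime p); last first.
  rewrite !padic_abs_nprime //; have [->|x0] := eqVneq x 0.
    by rewrite add0r le_max lexx orbT.
  by rewrite le_max /=; case: (x + y == 0) => //=; rewrite ?ler01 ?lexx.
have [->|x0] := eqVneq x 0; first by rewrite add0r le_max lexx orbT.
have [->|y0] := eqVneq y 0; first by rewrite addr0 le_max lexx.
have [->|xy0] := eqVneq (x + y) 0; first by rewrite padic_abs0 le_max padic_abs_ge0.
pose a : int := numq x * denq y; pose c : int := numq y * denq x; pose d : int := denq x * denq y.
have dx0 := denq_neq0 x; have dy0 := denq_neq0 y.
have dx0' : (denq x)%:~R != 0 :> rat by rewrite intr_eq0.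
have dy0' : (denq y)%:~R != 0 :> rat by rewrite intr_eq0.
have ex : x = a%:~R / d%:~R.
  by rewrite /a /d !intrM -mulf_div divff // mulr1 divq_num_den.
have ey : y = c%:~R / d%:~R.
  by rewrite /c /d !intrM (mulrC (denq x)%:~R) -mulf_div divff // mulr1 divq_num_den.
have exy : x + y = (a + c)%:~R / d%:~R by rewrite ex ey -mulrDl intrD.
have d0 : d != 0 by rewrite mulf_neq0.
have a0 : a != 0 by rewrite mulf_neq0 ?numq_eq0.
have c0 : c != 0 by rewrite mulf_neq0 ?numq_eq0.
have ac0 : a + c != 0 by apply: contra_neq xy0 => ac; rewrite exy ac mul0r.
rewrite exy ex ey !padic_abs_frac //.
have p1 : 1 <= p%:Q by rewrite ler1z lez_nat prime_gt0.
have vac : (minn (logn p (absz a)) (logn p (absz c)) <= logn p (absz (a + c)%R))%N.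
  rewrite -pfactor_dvdn ?absz_gt0 //.
  suff : ((p ^ minn (logn p (absz a)) (logn p (absz c)))%N%:Z %| a + c)%Z by [].
  by apply: rpredD; rewrite dvdzE /= pfactor_dvdn ?absz_gt0 // ?geq_minl ?geq_minr.
rewrite le_max; case: (leqP (logn p (absz a)) (logn p (absz c))) vac => _ le_v.
  by rewrite ler_weXz2l // lerD2l lerN2 lez_nat.
by rewrite orbC ler_weXz2l // lerD2l lerN2 lez_nat.
Qed.

End PadicAbs.

Definition padic_cauchy (p : nat) (u : nat -> rat) : Prop :=
  forall e : rat, 0 < e ->
    exists N, forall i j, (N <= i)%N -> (N <= j)%N -> padic_abs p (u i - u j) < e.

Definition padic_null (p : nat) (u : nat -> rat) : Prop :=
  forall e : rat, 0 < e ->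
    exists N, forall i, (N <= i)%N -> padic_abs p (u i) < e.

Lemma padic_abs_isosceles p (x y : rat) :
  padic_abs p (x - y) < padic_abs p y -> padic_abs p x = padic_abs p y.
Proof.
move=> xy; apply/eqP; rewrite eq_le; apply/andP; split.
  have := padic_absD p (x - y) y; rewrite subrK => /le_trans; apply.
  by rewrite ge_max lexx (ltW xy).
have := padic_absD p (y - x) x; rewrite subrK le_max padic_abs_distC.
by rewrite leNgt xy.
Qed.

Lemma padic_cauchy_abs p u : padic_cauchy p u -> ~ padic_null p u ->
  exists N (c : rat), 0 < c /\ forall i, (N <= i)%N -> padic_abs p (u i) = c.
Proof.
move=> cu /existsNP[e] /not_implyP[e0] /forallNP ne.
have [N uN] := cu _ e0.
have /existsNP[k /not_implyP[Nk /negP]] := ne N.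
rewrite -leNgt => ek; exists N, (padic_abs p (u k)).
split=> [|i Ni]; first exact: lt_le_trans ek.
by apply: padic_abs_isosceles; apply: lt_le_trans ek; apply: uN.
Qed.

Lemma padic_cauchy_bounded p u : padic_cauchy p u ->
  exists N (M : rat), 0 < M /\ forall i, (N <= i)%N -> padic_abs p (u i) < M.
Proof.
move=> cu; have [nu|/(padic_cauchy_abs cu)[N [c [c0 uc]]]] := pselect (padic_null p u).
  by have [N uN] := nu _ (ltr01); exists N, 1.
by exists N, (c + 1); split=> [|i /uc ->]; rewrite ?addr_gt0 ?ltrDl.
Qed.

Definition cauchy_pred (p : nat) : {pred nat -> rat} :=
  fun u => `[< padic_cauchy p u >].

Lemma cauchy_predP p u : reflect (padic_cauchy p u) (u \in cauchy_pred p).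
Proof. exact: asboolP. Qed.

Lemma padic_null_cauchy p u : padic_null p u -> padic_cauchy p u.
Proof.
move=> nu e /nu[N uN]; exists N => i j Ni Nj.
by rewrite (le_lt_trans (padic_absD _ _ _))// gt_max padic_absN !uN.
Qed.

Fact cauchy_pred_subring p : subring_closed (cauchy_pred p).
Proof.
split=> [|u v /cauchy_predP cu /cauchy_predP cv|u v /cauchy_predP cu /cauchy_predP cv].
- apply/cauchy_predP => e e0; exists 0%N => i j _ _.
  by rewrite subrr padic_abs0.
- apply/cauchy_predP => e e0.
  have [M uM] := cu _ e0; have [N vN] := cv _ e0.
  exists (maxn M N) => i j; rewrite !geq_max => /andP[Mi Ni] /andP[Mj Nj].
  have -> : (u - v) i - (u - v) j = (u i - u j) - (v i - v j).
    by rewrite !opprD !opprK addrACA.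
  by rewrite (le_lt_trans (padic_absD _ _ _))// gt_max padic_absN uM ?vN.
- apply/cauchy_predP => e e0.
  have [K1 [a [a0 ua]]] := padic_cauchy_bounded cu.
  have [K2 [b [b0 vb]]] := padic_cauchy_bounded cv.
  have [M uM] := cu _ (divr_gt0 e0 b0); have [N vN] := cv _ (divr_gt0 e0 a0).
  exists (maxn (maxn K1 K2) (maxn M N)) => i j; rewrite !geq_max.
  move=> /andP[/andP[K1i K2i] /andP[Mi Ni]] /andP[/andP[K1j K2j] /andP[Mj Nj]].
  have -> : (u * v) i - (u * v) j = (u i - u j) * v j + u i * (v i - v j).
    by rewrite mulrBl mulrBr [RHS]addrC addrA subrK.
  rewrite (le_lt_trans (padic_absD _ _ _))// gt_max !padic_absM; apply/andP; split.
    rewrite (@le_lt_trans _ _ (padic_abs p (u i - u j) * b)) //.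
      by rewrite ler_wpM2l ?padic_abs_ge0 ?ltW ?vb.
    by rewrite -ltr_pdivlMr ?uM.
  rewrite (@le_lt_trans _ _ (a * padic_abs p (v i - v j))) //.
    by rewrite ler_wpM2r ?padic_abs_ge0 ?ltW ?ua.
  by rewrite mulrC -ltr_pdivlMr ?vN.
Qed.

HB.instance Definition _ (p : nat) :=
  GRing.isSubringClosed.Build (nat -> rat) (cauchy_pred p) (cauchy_pred_subring p).

Record cauchy_seq (p : nat) := CauchySeq {
  cauchy_val :> nat -> rat;
  _ : cauchy_val \in cauchy_pred p }.

HB.instance Definition _ p := [isSub for @cauchy_val p].
HB.instance Definition _ p := [Choice of cauchy_seq p by <:].
HB.instance Definition _ p := [SubChoice_isSubComNzRing of cauchy_seq p by <:].

Definition null_ideal (p : nat) : {pred cauchy_seq p} :=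
  fun u => `[< padic_null p u >].
Arguments null_ideal : clear implicits.

Lemma null_idealP p u : reflect (padic_null p (val u)) (u \in null_ideal p).
Proof. exact: asboolP. Qed.

Lemma cauchyP p (u : cauchy_seq p) : padic_cauchy p (val u).
Proof. by apply/cauchy_predP; exact: valP. Qed.

Fact null_ideal_closed p : idealr_closed (null_ideal p).
Proof.
split=> [||a u v /null_idealP nu /null_idealP nv].
- by apply/null_idealP => e e0; exists 0%N => i _; rewrite padic_abs0.
- apply/negP => /null_idealP/(_ _ ltr01)[N /(_ _ (leqnn N))].
  by rewrite padic_abs1 ltxx.
- apply/null_idealP => e e0.
  have [K [M [M0 aM]]] := padic_cauchy_bounded (cauchyP a).
  have [N1 uN] := nu _ (divr_gt0 e0 M0); have [N2 vN] := nv _ e0.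
  exists (maxn K (maxn N1 N2)) => i; rewrite !geq_max => /and3P[Ki N1i N2i].
  rewrite (le_lt_trans (padic_absD _ _ _))// gt_max vN // andbT padic_absM.
  rewrite (@le_lt_trans _ _ (M * padic_abs p (u i))) //.
    by rewrite ler_wpM2r ?padic_abs_ge0 ?ltW ?aM.
  by rewrite mulrC -ltr_pdivlMr ?uN.
Qed.

HB.instance Definition _ p :=
  isIdealr.Build (cauchy_seq p) (null_ideal p) (null_ideal_closed p).

(* Cauchy sequences of rationals modulo p-adically null sequences. *)
Definition Qp (p : nat) : Type := {ideal_quot (null_ideal p)}.

HB.instance Definition _ p := GRing.ComNzRing.on (Qp p).

(* The sequence of absolute values tends to 0 or is eventually constant, so the
   limit already exists in rat. *)
Definition padic_abs_Qp (p : nat) (x : Qp p) : rat :=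
  lim (((fun k => padic_abs p (val (repr x) k)) : nat -> rat^o) @ \oo).

Section QpTheory.
Variable p : nat.
Local Open Scope quotient_scope.
Local Notation piQ := (\pi_(Qp p)).
Local Notation v := (@padic_abs_Qp p).

Lemma Qp_pi_eq (u w : cauchy_seq p) :
  (piQ u == piQ w) = (u - w \in null_ideal p).
Proof. by rewrite Quotient.idealrBE. Qed.

Lemma Qp_pi_eq0 (u : cauchy_seq p) : (piQ u == 0) = (u \in null_ideal p).
Proof. by rewrite -[0](rmorph0 piQ) Qp_pi_eq subr0. Qed.

Lemma Qp_repr_null (u : cauchy_seq p) :
  padic_null p (val (repr (piQ u) : cauchy_seq p) - val u).
Proof. by apply/(@null_idealP p (_ - u)); rewrite -Qp_pi_eq reprK. Qed.

Lemma padic_abs_pi_null (u : cauchy_seq p) : u \in null_ideal p -> v (piQ u) = 0.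
Proof.
move=> nu; have : padic_null p (val (repr (piQ u) : cauchy_seq p)).
  by apply/null_idealP; rewrite -Qp_pi_eq0 reprK Qp_pi_eq0.
move=> nr; apply: (@cvg_lim rat^o); first exact: norm_hausdorff.
apply/cvgrPdist_lt => e /nr[N rN]; exists N => //= i Ni.
by rewrite sub0r normrN ger0_norm ?padic_abs_ge0 ?rN.
Qed.

Lemma padic_abs_pi (u : cauchy_seq p) (c : rat) N :
  0 < c -> (forall i, (N <= i)%N -> padic_abs p (val u i) = c) -> v (piQ u) = c.
Proof.
move=> c0 uc; have [M rM] := Qp_repr_null u c0.
apply: (@lim_near_cst rat^o); first exact: norm_hausdorff.
exists (maxn M N) => // i /=; rewrite geq_max => /andP[Mi Ni].
rewrite -(uc i Ni); apply: padic_abs_isosceles; rewrite uc //.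
exact: rM.
Qed.

Variant Qp_spec : Qp p -> rat -> Prop :=
| Qp_spec0 : Qp_spec 0 0
| Qp_specN (u : cauchy_seq p) (c : rat) N of 0 < c
   & (forall i, (N <= i)%N -> padic_abs p (val u i) = c) : Qp_spec (piQ u) c.

Lemma QpP x : Qp_spec x (v x).
Proof.
rewrite -[x]reprK; set u := repr x.
have [nu|nu] := boolP (u \in null_ideal p).
  rewrite padic_abs_pi_null //; move: nu; rewrite -Qp_pi_eq0 => /eqP ->.
  exact: Qp_spec0.
have [|N [c [c0 uc]]] := padic_cauchy_abs (cauchyP u).
  by apply/null_idealP.
by rewrite (padic_abs_pi c0 uc); apply: Qp_specN uc.
Qed.

Lemma padic_abs_Qp0 : v 0 = 0.
Proof. by rewrite -(rmorph0 piQ) padic_abs_pi_null // rpred0. Qed.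

Lemma padic_abs_Qp_ge0 x : 0 <= v x.
Proof. by case: QpP => // u c N /ltW. Qed.

Lemma padic_abs_Qp_eq0 x : (v x == 0) = (x == 0).
Proof.
have [->|x0] := eqVneq x 0; first by rewrite padic_abs_Qp0 eqxx.
by case: QpP x0 => [|u c N c0 _ _]; rewrite ?eqxx ?gt_eqF.
Qed.

Lemma padic_abs_QpM x y : v (x * y) = v x * v y.
Proof.
case: (QpP x) => [|u c N c0 uc]; first by rewrite !mul0r padic_abs_Qp0.
case: (QpP y) => [|w d M d0 wd]; first by rewrite !mulr0 padic_abs_Qp0.
rewrite -rmorphM; apply: (@padic_abs_pi _ _ (maxn N M)); first exact: mulr_gt0.
by move=> i; rewrite geq_max => /andP[Ni Mi]; rewrite padic_absM uc ?wd.
Qed.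

Lemma padic_abs_QpN x : v (- x) = v x.
Proof.
case: (QpP x) => [|u c N c0 uc]; first by rewrite oppr0 padic_abs_Qp0.
rewrite -rmorphN; apply: (@padic_abs_pi _ _ N) => // i Ni.
by rewrite padic_absN uc.
Qed.

Lemma padic_abs_QpD x y : v (x + y) <= Num.max (v x) (v y).
Proof.
case: (QpP x) => [|u c N c0 uc]; first by rewrite add0r le_max lexx orbT.
case: (QpP y) => [|w d M d0 wd]; first by rewrite addr0 (padic_abs_pi c0 uc) le_max lexx.
rewrite -rmorphD; have [nuw|nuw] := boolP (u + w \in null_ideal p).
  by rewrite padic_abs_pi_null // le_max (ltW c0).
have [|K [e [e0 uwe]]] := padic_cauchy_abs (cauchyP (u + w)).
  exact/null_idealP.
rewrite (padic_abs_pi e0 uwe) -(uwe (maxn K (maxn N M))) ?leq_maxl //.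
rewrite -(uc (maxn K (maxn N M))) -?(wd (maxn K (maxn N M))) ?padic_absD //.
  by rewrite (leq_trans (leq_maxr N M)) // leq_maxr.
by rewrite (leq_trans (leq_maxl N M)) // leq_maxr.
Qed.

Fact padic_cauchy_inv (u : cauchy_seq p) :
  (if u \in null_ideal p then 0 else fun k => (val u k)^-1) \in cauchy_pred p.
Proof.
case: ifPn => [_|nu]; first exact: rpred0.
have [|N [c [c0 uc]]] := padic_cauchy_abs (cauchyP u); first exact/null_idealP.
apply/cauchy_predP => e e0.
have [M uM] := cauchyP u (mulr_gt0 e0 (mulr_gt0 c0 c0)).
exists (maxn N M) => i j; rewrite !geq_max => /andP[Ni Mi] /andP[Nj Mj].
have nz k : (N <= k)%N -> val u k != 0.
  by move=> Nk; rewrite -(padic_abs_eq0 p) uc ?gt_eqF.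
have -> : (val u i)^-1 - (val u j)^-1 = (val u j - val u i) * (val u i * val u j)^-1.
  by rewrite mulrBl invfM (mulVKf (nz i Ni)) mulrCA divff ?nz // mulr1.
rewrite padic_absM padic_absV padic_absM !uc // ltr_pdivrMr ?mulr_gt0 //.
exact: uM.
Qed.

Definition inv_Qp (x : Qp p) : Qp p := piQ (CauchySeq (padic_cauchy_inv (repr x))).

Fact Qp_mulVf (x : Qp p) : x != 0 -> inv_Qp x * x = 1.
Proof.
rewrite /inv_Qp => x0; pose u : cauchy_seq p := repr x.
have nu : u \notin null_ideal p by rewrite -Qp_pi_eq0 reprK.
rewrite -[X in _ * X](reprK x) -/u -rmorphM -[1](rmorph1 piQ); apply/eqP; rewrite Qp_pi_eq; apply/null_idealP.
have [|N [c [c0 uc]]] := padic_cauchy_abs (cauchyP u); first exact/null_idealP.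
move=> e e0; exists N => i Ni /=; rewrite (negPf nu).
have ui0 : val u i != 0 by rewrite -(padic_abs_eq0 p) uc ?gt_eqF.
have -> : ((fun k => (val u k)^-1) * val u - 1) i = (val u i)^-1 * val u i - 1 by [].
by rewrite mulVf // subrr padic_abs0.
Qed.

Fact Qp_inv0 : inv_Qp 0 = 0.
Proof.
apply/eqP; rewrite Qp_pi_eq0; apply/null_idealP => /=.
have -> : repr (0 : Qp p) \in null_ideal p by rewrite -Qp_pi_eq0 reprK.
by move=> e e0; exists 0%N => i _; rewrite padic_abs0.
Qed.

End QpTheory.

HB.instance Definition _ p := GRing.ComNzRing_isField.Build (Qp p)
  (@Qp_mulVf p) (@Qp_inv0 p).

HB.instance Definition _ p := isPointed.Build (Qp p) 0.

Section QpMetric.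
Variable p : nat.
Local Notation dist := (fun x y : Qp p => padic_abs_Qp (x - y)).

Fact Qp_distxx x : dist x x = 0.
Proof. by rewrite /= subrr padic_abs_Qp0. Qed.

Fact Qp_dist_positivity x y : dist x y = 0 -> x = y.
Proof. by move=> /= /eqP; rewrite padic_abs_Qp_eq0 subr_eq0 => /eqP. Qed.

Fact Qp_dist_sym x y : dist x y = dist y x.
Proof. by rewrite /= -padic_abs_QpN opprB. Qed.

Fact Qp_dist_triangle y x z : dist x z <= dist x y + dist y z.
Proof.
rewrite /=; have -> : x - z = (x - y) + (y - z) by rewrite addrA subrK.
apply: (le_trans (padic_abs_QpD _ _)).
by rewrite ge_max lerDl lerDr !padic_abs_Qp_ge0.
Qed.

HB.instance Definition _ := isMetric.Build rat (Qp p)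
  Qp_distxx Qp_dist_positivity Qp_dist_sym Qp_dist_triangle.

End QpMetric.

(* The measurable structure is the Borel sigma-algebra of the product topology. *)
Definition Qpn (p n : nat) : Type := 'rV[Qp p]_n.

HB.instance Definition _ p n := GRing.Zmodule.on (Qpn p n).
HB.instance Definition _ p n := Pointed.on (Qpn p n).
HB.instance Definition _ p n := PseudoMetric.copy (Qpn p n) 'rV[Qp p]_n.
HB.instance Definition _ p n := @isMeasurable.Build
  (sigma_display (@open (Qpn p n))) (Qpn p n) <<s @open (Qpn p n) >>
  (@sigma_algebra0 _ setT (@open (Qpn p n)))
  (@sigma_algebraC _ (@open (Qpn p n)))
  (@sigma_algebra_bigcup _ setT (@open (Qpn p n))).

Definition padic_norm (p n : nat) (x : Qpn p n) : rat :=
  \big[Num.max/0]_(j < n) padic_abs_Qp (x 0 j).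

Definition pball (p n : nat) (g : int) (a : Qpn p n) : set (Qpn p n) :=
  [set x | padic_norm (x - a) <= p%:Q ^ g].

Section FunctionSpaces.
Context {R : realType} {p n : nat}.
Variable mu : {measure set (Qpn p n) -> \bar R}.
Local Notation T := (Qpn p n).

(* Haar measure is characterised, not constructed: these two properties
   determine mu on the Borel sets. *)
Definition haar_measure : Prop :=
  (forall (a : T) (A : set T), measurable A ->
     mu [set a + x | x in A] = mu A) /\
  mu (pball 0 (0 : T)) = 1%E.

Definition loc_integrable (f : T -> R) : Prop :=
  measurable_fun setT f /\
  forall K : set T, compact K -> (\int[mu]_(x in K) `|f x|%:E < +oo)%E.

Definition average (f : T -> R) (B : set T) : \bar R :=
  ((mu B)^-1 * \int[mu]_(y in B) `|f y|%:E)%E.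

Definition maximal (f : T -> R) (x : T) : \bar R :=
  ereal_sup [set average f (pball g x) | g in [set: int]].

Definition local_maximal (B : set T) (f : T -> R) (x : T) : \bar R :=
  ereal_sup [set average f (pball g x) | g in [set g | pball g x `<=` B]].

(* The convention (+oo - +oo = -oo) makes the commutator infinite where the
   difference is undefined, so boundedness rules this out almost everywhere. *)
Definition commutator (b f : T -> R) (x : T) : \bar R :=
  ((b x)%:E * maximal f x - maximal (fun y => b y * f y)%R x)%E.

Definition lipschitz_norm (beta : R) (f : T -> R) : \bar R :=
  ereal_sup [set (`|f z.1 - f z.2| / ratr (padic_norm (z.1 - z.2)) `^ beta)%:E |
             z in [set z : T * T | z.1 != z.2]].

Definition lipschitz_space (beta : R) (f : T -> R) : Prop :=
  measurable_fun setT f /\ (lipschitz_norm beta f < +oo)%E.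

Definition ess_inf_on (B : set T) (q : T -> R) : \bar R :=
  ereal_sup [set y | \forall x \ae mu, B x -> (y <= (q x)%:E)%E].

Definition ess_sup_on (B : set T) (q : T -> R) : \bar R :=
  ereal_inf [set y | \forall x \ae mu, B x -> ((q x)%:E <= y)%E].

Definition exponent (q : T -> R) : Prop :=
  let q_minus := ess_inf mu (EFin \o q) in
  let q_plus := ess_sup mu (EFin \o q) in
  [/\ measurable_fun setT q,
      (1 < q_minus)%E,
      (forall x, (q_minus <= (q x)%:E <= q_plus)%E)
    & (q_plus < +oo)%E].

Definition log_holder (q : T -> R) : Prop :=
  exponent q /\
  exists C : R, [/\ 0 < C,
    (forall (g : int) (x : T),
       (g%:~R%:E * (ess_inf_on (pball g x) q - ess_sup_on (pball g x) q)
          <= C%:E)%E)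
  & (forall x y : T,
       `|q x - q y| <=
       C / (ln (p%:R + ratr (Num.min (padic_norm x) (padic_norm y))) / ln p%:R))].

(* Modular and norm are defined on extended-real functions, because maximal
   functions may take the value +oo; the norm is +oo outside the space. *)
Definition modular (q : T -> R) (f : T -> \bar R) (eta : R) : \bar R :=
  (\int[mu]_x (`|f x| / eta%:E) `^ q x)%E.

Definition var_norm (q : T -> R) (f : T -> \bar R) : \bar R :=
  ereal_inf [set eta%:E | eta in [set eta : R | 0 < eta /\ (modular q f eta <= 1)%E]].

Definition var_Lebesgue (q : T -> R) (f : T -> R) : Prop :=
  measurable_fun setT f /\
  exists eta : R, 0 < eta /\ (modular q (EFin \o f) eta < +oo)%E.

Definition bounded_op (r q : T -> R) (F : (T -> R) -> (T -> \bar R)) : Prop :=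
  exists C : R, forall f : T -> R, var_Lebesgue r f ->
    (var_norm q (F f) <= C%:E * var_norm r (EFin \o f))%E.

Definition admissible (beta : R) (r q : T -> R) : Prop :=
  [/\ log_holder r, log_holder q, exponent r,
      (ess_sup mu (EFin \o r) < (n%:R / beta)%:E)%E
    & forall x, (q x)^-1 = (r x)^-1 - beta / n%:R].

Definition oscillation (beta : R) (q b : T -> R) (B : set T) : \bar R :=
  ((mu B `^ (beta / n%:R))^-1 *
   (var_norm q (fun x => ((b x)%:E - local_maximal B b x) * (\1_B x)%:E) /
    var_norm q (fun x => (\1_B x)%:E)))%E.

Definition oscillation_sup (beta : R) (q b : T -> R) : \bar R :=
  ereal_sup [set oscillation beta q b (pball z.1 z.2) | z in [set: int * T]].

End FunctionSpaces.

(* Main.v *)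
Require Import Defs.
From HB Require Import structures.
From mathcomp Require Import all_boot all_order all_algebra ring_quotient.
From mathcomp Require Import all_classical all_reals all_analysis ess_sup_inf measurable_realfun.
From mathcomp Require Import ring lra zify.

Set Implicit Arguments.
Unset Strict Implicit.
Unset Printing Implicit Defensive.

Import Order.TTheory GRing.Theory Num.Theory.
Import numFieldNormedType.Exports.

Local Open Scope classical_set_scope.
Local Open Scope ring_scope.

(** The five statements are linked by the following facts, in which V = p^(n g)
    is the measure of a ball of radius p^g and th = beta/n.

    A Lipschitz function satisfies |b(x) - b(y)| <= L V^th on every ball of
    volume V. If moreover b >= 0, then replacing b(y) by b(x) inside an average
    of |b f| costs at most L V^th times the average of |f|. Hence |[b,M] f| is
    at most L times the fractional maximal function sup V^th avg|f|
    (commutator_le). Hedberg's pointwise argument bounds the latter: for f of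
    norm 1 in L^r, Hoelder's inequality gives
    V^th avg|f| <= 2 (M F)^(1-th) with F = |f|^(r / (q (1 - th)))
    (fractional_average_le), and the modular of (M F)^(1-th) for q is that of
    M F for the exponent q (1 - th), in which F has modular at most 1. So the
    boundedness from L^r to L^q (commutator_bounded) follows from the maximal
    theorem with a variable exponent (maximal_modular).

    The maximal theorem is reduced to constant exponents. Put t = s / (inf s).
    The log-Hoelder conditions allow a pointwise power to be exchanged with an
    average: if F^s has integral at most 1, then (avg F)^t(x) is at most a
    constant times M (F^t + decay)(x), with an integrable function decay
    that absorbs the errors at infinity (average_power_le). Raising this to the
    constant power inf s > 1 reduces the claim to the classical strong bound
    (maximal_strong_type). The latter comes from the weak (1,1) bound, which on
    an ultrametric space has constant 1: two balls are nested or disjoint, so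
    the stopping balls where the average exceeds a level are disjoint
    (maximal_weak_type).

    Conversely, on a ball B the commutator applied to the characteristic
    function of B equals b - M_B b (commutator_indic). Its boundedness for one
    pair of exponents, together with Hoelder's inequality for the norms of
    characteristic functions, gives the finiteness of the oscillation supremum
    for the same pair (bounded_oscillation). A finite oscillation supremum
    bounds the mean deviation of b from the average of |b| over each ball
    (oscillation_deviation), and Campanato's characterisation then yields a
    Lipschitz representative of b; it is nonnegative because averages of |b|
    are (campanato). Finally, a nonnegative Lipschitz function has finite
    oscillation for every admissible pair (lipschitz_oscillation), and constant
    exponents show that admissible pairs exist (admissible_exists). *)

(** * Rational approximation and residues in the p-adic numbers *)

Section PadicField.
Variable p : nat.
Hypothesis p_pr : prime p.
Local Open Scope quotient_scope.
Local Notation piQ := (\pi_(Qp p)).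
Local Notation v := (@padic_abs_Qp p).

Lemma padic_base_gt1 : 1 < p%:Q.
Proof. by rewrite ltr1z ltz_nat prime_gt1. Qed.

Lemma padic_base_gt0 : 0 < p%:Q.
Proof. exact: lt_trans ltr01 padic_base_gt1. Qed.

Lemma padic_base_neq0 : p%:Q != 0.
Proof. by rewrite gt_eqF ?padic_base_gt0. Qed.

Lemma exp_base_gt0 (g : int) : 0 < p%:Q ^ g.
Proof. by rewrite exprz_gt0 // padic_base_gt0. Qed.

Lemma exp_base_le (g h : int) : (p%:Q ^ g <= p%:Q ^ h) = (g <= h).
Proof. exact: ler_eXz2l padic_base_gt1 _ _. Qed.

Lemma exp_base_lt (g h : int) : (p%:Q ^ g < p%:Q ^ h) = (g < h).
Proof. exact: ltr_eXz2l padic_base_gt1 _ _. Qed.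

Lemma padic_absE (x : rat) : x != 0 ->
  exists k : int, padic_abs p x = p%:Q ^ k.
Proof. by move=> x0; rewrite /padic_abs (negPf x0); eexists. Qed.

Lemma padic_abs_expz (k : int) : padic_abs p (p%:Q ^ k) = p%:Q ^ (- k).
Proof.
have pk (m : nat) : padic_abs p (p%:Q ^+ m) = p%:Q ^ (- m%:Z).
  rewrite -[p%:Q ^+ m]divr1 -[_ ^+ m]rmorphXn /= -[1]/(1%:~R).
  rewrite padic_abs_frac //; last by rewrite expf_neq0 // eqz_nat -lt0n prime_gt0.
  by rewrite logn1 sub0r abszX /= pfactorK.
case: k => m; first exact: pk.
rewrite NegzE opprK -[p%:Q ^ (- _)]/((p%:Q ^+ m.+1)^-1) padic_absV pk.
by rewrite invr_expz opprK.
Qed.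

Lemma cst_cauchy_seq (r : rat) : (fun=> r) \in cauchy_pred p.
Proof.
by apply/cauchy_predP => e e0; exists 0%N => i j _ _; rewrite subrr padic_abs0.
Qed.

Definition Qp_cst (r : rat) : Qp p := piQ (CauchySeq (cst_cauchy_seq r)).

Lemma padic_abs_pi_le (u : cauchy_seq p) (c : rat) N : 0 <= c ->
  (forall i, (N <= i)%N -> padic_abs p (val u i) <= c) -> v (piQ u) <= c.
Proof.
move=> c0 uc; have [nu|nu] := boolP (u \in null_ideal p).
  by rewrite padic_abs_pi_null.
have [|M [e [e0 ue]]] := padic_cauchy_abs (Defs.cauchyP u); first exact/null_idealP.
by rewrite (padic_abs_pi e0 ue) -(ue (maxn M N)) ?leq_maxl // uc // leq_maxr.
Qed.

Lemma padic_abs_cst r : v (Qp_cst r) = padic_abs p r.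
Proof.
have [->|r0] := eqVneq r 0.
  rewrite padic_abs0; apply: padic_abs_pi_null; apply/null_idealP => e e0.
  by exists 0%N => i _; rewrite padic_abs0.
apply: (@padic_abs_pi _ _ _ 0%N) => //.
by rewrite lt_neqAle padic_abs_ge0 andbT eq_sym padic_abs_eq0.
Qed.

Lemma Qp_cstB r s : Qp_cst r - Qp_cst s = Qp_cst (r - s).
Proof.
by rewrite /Qp_cst -rmorphB; congr (\pi_(_) _); apply: val_inj.
Qed.

Lemma Qp_cst_dense (x : Qp p) (e : rat) : 0 < e ->
  exists r, v (x - Qp_cst r) <= e.
Proof.
move=> e0; rewrite -[x]reprK; set u : cauchy_seq p := repr x.
have [N uN] := Defs.cauchyP u e0; exists (val u N).
rewrite /Qp_cst -rmorphB; apply: (@padic_abs_pi_le _ _ N); first exact: ltW.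
by move=> i Ni; apply/ltW/(uN i N).
Qed.

Lemma padic_abs_QpE (x : Qp p) : x != 0 -> exists k : int, v x = p%:Q ^ k.
Proof.
move=> x0; case: QpP x0 => [|u c N c0 uc _]; first by rewrite eqxx.
rewrite -(uc N) //; apply: padic_absE.
by apply: contraTneq c0 => uN0; rewrite -(uc N) // uN0 padic_abs0 ltxx.
Qed.

Lemma padic_abs_Qp_distC (x y : Qp p) : v (x - y) = v (y - x).
Proof. by rewrite -opprB padic_abs_QpN. Qed.

Lemma padic_abs_Qp_dist_le (z x y : Qp p) c :
  v (x - z) <= c -> v (z - y) <= c -> v (x - y) <= c.
Proof.
move=> xz zy; have -> : x - y = (x - z) + (z - y) by rewrite addrA subrK.
by apply: le_trans (padic_abs_QpD _ _) _; rewrite ge_max xz.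
Qed.

(** A rational p-adic integer has a denominator prime to p; the residue is its
    numerator times an inverse of the denominator modulo p. *)
Lemma padic_residue_rat (r : rat) : padic_abs p r <= 1 ->
  exists2 a, (a < p)%N & padic_abs p (r - a%:Q) <= p%:Q^-1.
Proof.
have [->|r0] := eqVneq r 0.
  exists 0%N; first exact: prime_gt0.
  by rewrite subrr padic_abs0 invr_ge0 ltW // padic_base_gt0.
have <- := expr0z p%:Q; rewrite {1}/padic_abs (negPf r0) exp_base_le subr_le0 lez_nat => le_dn.
have dp : logn p `|denq r| = 0%N.
  apply/eqP; rewrite lognE p_pr absz_gt0 denq_neq0 /=; case: ifP => // pd.
  have : (0 < logn p `|numq r|)%N.
    by apply: leq_trans le_dn; rewrite logn_gt0 mem_primes p_pr absz_gt0 denq_neq0.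
  rewrite logn_gt0 mem_primes => /and3P[_ _ pn].
  have := coprime_num_den r; rewrite /coprime => /eqP cnd.
  have : (p %| gcdn `|numq r| `|denq r|)%N by rewrite dvdn_gcd pn.
  by rewrite cnd dvdn1 => /eqP p1; move: p_pr; rewrite p1.
have cop : coprimez p (denq r).
  rewrite coprimezE prime_coprime //; apply/negP => pd.
  have : (0 < logn p `|denq r|)%N.
    by rewrite logn_gt0 mem_primes p_pr absz_gt0 denq_neq0.
  by rewrite dp.
have p0 : (p : int) != 0 by rewrite eqz_nat -lt0n prime_gt0.
case: (Bezoutz p (denq r)) => s [t st]; rewrite (eqP cop) in st.
pose a := `|((numq r * t) %% p)%Z|%N.
have aE : (a : int) = ((numq r * t) %% p)%Z by rewrite gez0_abs // modz_ge0.
exists a; first by rewrite -ltz_nat aE ltz_pmod // ltz_nat prime_gt0.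
have -> : r - a%:Q = (numq r - a%:Z * denq r)%:~R / (denq r)%:~R.
  by rewrite intrB intrM mulrBl mulfK ?intr_eq0 ?denq_neq0 // divq_num_den.
have pa : (p%:Z %| numq r - a%:Z * denq r)%Z.
  rewrite aE -eqz_mod_dvd -modzMml modz_mod modzMml.
  rewrite -mulrA (_ : t * denq r = 1 - s * p%:Z); last by rewrite -st addrC addKr.
  by rewrite mulrBr mulr1 mulrA eqz_mod_dvd opprB addrCA subrr addr0 dvdz_mull.
set m := numq r - a%:Z * denq r in pa *.
have [m0|m0] := eqVneq m 0.
  by rewrite m0 mulr0z mul0r padic_abs0 invr_ge0 ltW // padic_base_gt0.
rewrite padic_abs_frac ?denq_neq0 // dp sub0r -[_^-1]/(p%:Q ^ (-1)) exp_base_le.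
by rewrite lerN2 lez_nat logn_gt0 mem_primes p_pr absz_gt0 m0.
Qed.

(** The residue field has p elements: by density a p-adic integer is congruent
    to a rational one. This finiteness is behind both the compactness and the
    measure of balls. *)
Lemma padic_residue (x : Qp p) : v x <= 1 ->
  exists2 a, (a < p)%N & v (x - Qp_cst a%:Q) <= p%:Q^-1.
Proof.
move=> x1; have pV0 : 0 < p%:Q^-1 by rewrite invr_gt0 padic_base_gt0.
have pV1 : p%:Q^-1 <= 1 by rewrite invf_le1 ?padic_base_gt0 // ltW // padic_base_gt1.
have [r xr] := Qp_cst_dense x pV0.
have r1 : padic_abs p r <= 1.
  rewrite -padic_abs_cst -[Qp_cst r]subr0 (padic_abs_Qp_dist_le (z := x)) ?subr0 //.
  by rewrite padic_abs_Qp_distC (le_trans xr).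
have [a ap ra] := padic_residue_rat r1; exists a => //.
by apply: padic_abs_Qp_dist_le xr _; rewrite Qp_cstB padic_abs_cst.
Qed.

Lemma padic_residue_inj (a b : nat) : (a < p)%N -> (b < p)%N ->
  v (Qp_cst a%:Q - Qp_cst b%:Q) <= p%:Q^-1 -> a = b.
Proof.
rewrite Qp_cstB padic_abs_cst => ap bp; rewrite -intrB.
have [ab _|ab] := eqVneq (a%:Z - b%:Z) 0.
  by move/eqP: ab; rewrite subr_eq0 eqz_nat => /eqP.
rewrite -[_%:~R]divr1 -[1]/(1%:~R) padic_abs_frac // logn1 sub0r.
rewrite -[p%:Q^-1]/(p%:Q ^ (-1)) exp_base_le lerN2 lez_nat.
rewrite logn_gt0 mem_primes => /and3P[_ _ /dvdn_leq].
rewrite absz_gt0 ab => /(_ isT).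
by lia.
Qed.

End PadicField.

(** * Compactness of balls of p-adic numbers *)

Section QpCompact.
Variable p : nat.
Hypothesis p_pr : prime p.
Local Notation v := (@padic_abs_Qp p).

Lemma exp_base_small (e : rat) : 0 < e -> exists k : nat, p%:Q ^ (- k%:Z) < e.
Proof.
move=> e0; exists (Num.bound e^-1).
rewrite -invr_expz invf_plt ?posrE ?exp_base_gt0 //.
apply: lt_le_trans (archi_boundP _) _; first by rewrite invr_ge0 ltW.
rewrite -exprnP -[p%:Q]/(p%:R) -natrX ler_nat.
by apply/ltnW/ltn_expl/prime_gt1.
Qed.

(** Multiplying by p^h maps a ball of radius p^h to the unit ball, whose residues
    cut it into p balls of the next smaller radius. *)
Lemma Qp_ball_cover (r : rat) (h : int) (x : Qp p) :
  v (x - Qp_cst p r) <= p%:Q ^ h ->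
  exists a : 'I_p, v (x - Qp_cst p (r + a%:Q * p%:Q ^ (- h))) <= p%:Q ^ (h - 1).
Proof.
move=> xr; pose c := Qp_cst p (p%:Q ^ h).
have vc : v c = p%:Q ^ (- h) by rewrite padic_abs_cst padic_abs_expz.
have [] := @padic_residue p p_pr (c * (x - Qp_cst p r)).
  rewrite padic_abs_QpM vc mulrC -ler_pdivlMr ?exp_base_gt0 // div1r.
  by rewrite invr_expz opprK.
move=> a ap xa; exists (Ordinal ap) => /=.
pose c' := Qp_cst p (p%:Q ^ (- h)).
have cc : c' * c = 1.
  rewrite /c /c' /Qp_cst -rmorphM -[RHS](rmorph1 (\pi_(Qp p))%qT).
  congr (\pi_(_) _)%qT; apply: val_inj; apply/funext => i /=.
  rewrite -[LHS]/(p%:Q ^ (- h) * p%:Q ^ h) -expfzDr ?padic_base_neq0 //.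
  by rewrite addNr expr0z.
have -> : x - Qp_cst p (r + a%:Q * p%:Q ^ (- h)) =
    c' * (c * (x - Qp_cst p r) - Qp_cst p a%:Q).
  rewrite mulrBr mulrA cc mul1r -addrA -opprD; congr (_ - _).
  rewrite /c' /Qp_cst -rmorphM -rmorphD; congr (\pi_(_) _)%qT.
  by apply: val_inj; apply/funext => i /=; rewrite mulrC.
rewrite padic_abs_QpM padic_abs_cst padic_abs_expz // opprK expfzDr ?padic_base_neq0 //.
by rewrite ler_wpM2l // ltW // exp_base_gt0.
Qed.

Lemma Qp_ball_ultra (F : set_system (Qp p)) (g : int) : UltraFilter F ->
  F [set x | v x <= p%:Q ^ g] -> forall k : nat,
  exists r, F [set x | v (x - Qp_cst p r) <= p%:Q ^ (g - k%:Z)].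
Proof.
move=> FU Fg; elim=> [|k [r Fr]].
  exists 0; apply: filterS Fg => x /=; rewrite subr0 => xg.
  rewrite -[Qp_cst p 0]subr0 (padic_abs_Qp_dist_le (z := 0)) ?subr0 //.
  by rewrite sub0r padic_abs_QpN padic_abs_cst padic_abs0 ltW // exp_base_gt0.
apply: contrapT => /forallNP nF.
pose U (a : 'I_p) := [set x | v (x - Qp_cst p (r + a%:Q * p%:Q ^ (- (g - k%:Z))))
  <= p%:Q ^ (g - k%:Z - 1)].
have FC a : F (~` U a).
  have [Fa|//] := in_ultra_setVsetC (U a) FU.
  case: (nF (r + a%:Q * p%:Q ^ (- (g - k%:Z)))); apply: filterS Fa => y.
  by rewrite /U /= -addrA -opprD -[k%:Z + 1]/(k%:Z + 1%:Z) -PoszD addn1.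
have FI : F [set x | forall a, (~` U a) x] by apply: filter_forall.
have [x [/Qp_ball_cover[a xa] /(_ a)]] := filter_ex (filterI Fr FI).
exact.
Qed.

(** An ultrafilter that contains a ball contains one ball of each smaller radius.
    Rational points of these balls form a Cauchy sequence, and the element of
    Q_p that it represents is the limit of the ultrafilter. *)
Lemma Qp_ball_compact (g : int) : compact [set x : Qp p | v x <= p%:Q ^ g].
Proof.
rewrite compact_ultra => F FU Fg.
have [r Fr] := choice (Qp_ball_ultra FU Fg).
have rr i j : (i <= j)%N -> padic_abs p (r i - r j) <= p%:Q ^ (g - i%:Z).
  move=> ij; have [x [xi xj]] := filter_ex (filterI (Fr i) (Fr j)).
  rewrite -padic_abs_cst -Qp_cstB; apply: (padic_abs_Qp_dist_le (z := x)).
    by rewrite padic_abs_Qp_distC.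
  by apply: le_trans xj _; rewrite exp_base_le // lerD2l lerN2.
have cr : r \in cauchy_pred p.
  apply/cauchy_predP => e e0.
  have [N Ne] := exp_base_small (divr_gt0 e0 (exp_base_gt0 p_pr g)).
  have Nge : p%:Q ^ (g - N%:Z) < e.
    by rewrite expfzDr ?padic_base_neq0 // mulrC -ltr_pdivlMr ?exp_base_gt0.
  exists N => i j Ni Nj; have [ij|/ltnW ji] := leqP i j.
    apply: le_lt_trans (rr _ _ ij) _; apply: le_lt_trans Nge.
    by rewrite exp_base_le // lerD2l lerN2.
  rewrite padic_abs_distC; apply: le_lt_trans (rr _ _ ji) _; apply: le_lt_trans Nge.
  by rewrite exp_base_le // lerD2l lerN2.
pose x : Qp p := (\pi_(Qp p) (CauchySeq cr))%qT.
have xr i : v (x - Qp_cst p (r i)) <= p%:Q ^ (g - i%:Z).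
  rewrite /x /Qp_cst -rmorphB; apply: (@padic_abs_pi_le _ _ _ i).
    by rewrite ltW // exp_base_gt0.
  by move=> j ij /=; rewrite padic_abs_distC; apply: rr.
exists x; split.
  have [y [/= yg yr]] := filter_ex (filterI Fg (Fr 0%N)).
  rewrite -[x]subr0; apply: (padic_abs_Qp_dist_le (z := y)); last by rewrite subr0.
  apply: (padic_abs_Qp_dist_le (z := Qp_cst p (r 0%N))).
    by have := xr 0%N; rewrite subr0.
  by rewrite padic_abs_Qp_distC; move: yr; rewrite subr0.
apply/cvg_ballP => e e0 /=.
have [N Ne] := exp_base_small (divr_gt0 e0 (exp_base_gt0 p_pr g)).
apply: filterS (Fr N) => y /= yr.
rewrite ballEmdist /=; apply: (@le_lt_trans _ _ (p%:Q ^ (g - N%:Z))).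
  apply: (padic_abs_Qp_dist_le (z := Qp_cst p (r N))); first exact: xr.
  by rewrite padic_abs_Qp_distC.
by rewrite expfzDr ?padic_base_neq0 // mulrC -ltr_pdivlMr ?exp_base_gt0.
Qed.

End QpCompact.

(** * Balls of p-adic vectors and their Haar measure *)

Section QpnBalls.
Variables p n : nat.
Hypothesis p_pr : prime p.
Local Notation v := (@padic_abs_Qp p).
Local Notation T := (Qpn p n).

Lemma padic_norm_leP (x : T) (c : rat) : 0 <= c ->
  reflect (forall j, v (x 0 j) <= c) (padic_norm x <= c).
Proof.
move=> c0; apply: (iffP (bigmax_leP _ _ _ _)) => [[_ xc] j|xc]; first exact: xc.
by split.
Qed.

Lemma padic_norm_ge0 (x : T) : 0 <= padic_norm x.
Proof. by rewrite /padic_norm; elim/big_ind: _ => // [a b a0 b0|i _]; rewrite ?le_max ?a0 ?padic_abs_Qp_ge0. Qed.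

Lemma pballP (g : int) (a x : T) :
  pball g a x <-> forall j, v (x 0 j - a 0 j) <= p%:Q ^ g.
Proof.
have g0 : 0 <= p%:Q ^ g by rewrite ltW // exp_base_gt0.
rewrite /pball /=; split=> [/(padic_norm_leP _ g0) xa j|xa].
  by have := xa j; rewrite !mxE.
by apply/(padic_norm_leP _ g0) => j; rewrite !mxE.
Qed.

Lemma pball_center (g : int) (x : T) : pball g x x.
Proof. by apply/pballP => j; rewrite subrr padic_abs_Qp0 ltW // exp_base_gt0. Qed.

Lemma pball_sym (g : int) (x y : T) : pball g x y -> pball g y x.
Proof. by move=> /pballP xy; apply/pballP => j; rewrite padic_abs_Qp_distC. Qed.

Lemma pball_trans (g : int) (x y z : T) : pball g x y -> pball g y z -> pball g x z.
Proof.
move=> /pballP xy /pballP yz; apply/pballP => j.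
by apply: (padic_abs_Qp_dist_le (z := y 0 j)).
Qed.

Lemma pball_eq (g : int) (x y : T) : pball g x y -> pball g y = pball g x.
Proof.
move=> xy; apply/seteqP; split=> z; first exact: pball_trans.
by apply: pball_trans; apply: pball_sym.
Qed.

Lemma pball_le (g h : int) (x : T) : g <= h -> pball g x `<=` pball h x.
Proof.
move=> gh z; rewrite /pball /= => /le_trans; apply.
by rewrite exp_base_le.
Qed.

Lemma pball_sub (g h : int) (x y : T) : g <= h -> pball h x y -> pball g y `<=` pball h x.
Proof. by move=> gh xy; rewrite -(pball_eq xy); apply: pball_le. Qed.

Lemma padic_normE (x : T) : x != 0 -> exists g : int, padic_norm x = p%:Q ^ g.
Proof.
move=> x0; have [j xj0] : exists j, x 0 j != 0.
  apply: contrapT => /forallNP xj; move/eqP: x0; apply.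
  by apply/rowP => j; rewrite mxE; apply/eqP/negPn/negP/xj.
have : padic_norm x = 0 \/ exists g : int, padic_norm x = p%:Q ^ g.
  rewrite /padic_norm; elim/big_ind: _ => [|a b Pa Pb|i _]; first by left.
    by rewrite maxEle; case: ifP.
  have [->|xi] := eqVneq (x 0 i) 0; first by left; rewrite padic_abs_Qp0.
  by right; apply: padic_abs_QpE.
case=> // nx0; have /(padic_norm_leP _ (lexx _))/(_ j) : padic_norm x <= 0 by rewrite nx0.
by rewrite le_eqVlt ltNge padic_abs_Qp_ge0 orbF padic_abs_Qp_eq0 (negPf xj0).
Qed.

Lemma distinct_pball (x y : T) : x != y ->
  exists2 g : int, padic_norm (x - y) = p%:Q ^ g & pball g y x.
Proof.
move=> xy; have [|g gE] := @padic_normE (x - y); first by rewrite subr_eq0.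
by exists g => //; rewrite /pball /= gE.
Qed.

Lemma pball_dist (g : int) (x y : T) : pball g y x -> padic_norm (x - y) <= p%:Q ^ g.
Proof. by []. Qed.

Lemma pball_exhaust (x : T) : exists k : nat, pball k%:Z 0 x.
Proof.
have [k xk] : exists k : nat, padic_norm x <= k%:R.
  by exists (Num.bound (padic_norm x)); apply/ltW/archi_boundP/padic_norm_ge0.
exists k; rewrite /pball /= subr0; apply: le_trans xk _.
rewrite -exprnP -[p%:Q]/(p%:R) -natrX ler_nat.
by apply/ltnW/ltn_expl/prime_gt1.
Qed.

Lemma pball0_normE (k : int) (x : T) : pball k 0 x <-> padic_norm x <= p%:Q ^ k.
Proof. by rewrite /pball /= subr0. Qed.

Lemma locally_pball_open (E : set T) :
  (forall x, E x -> exists g, pball g x `<=` E) -> open E.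
Proof.
move=> Eb; rewrite openE => x /Eb[g gE].
apply/nbhs_ballP; exists (p%:Q ^ g) => /=; first exact: exp_base_gt0.
move=> y [_ xy]; apply: gE; apply/pballP => j.
by have := xy 0 j; rewrite ballEmdist /= padic_abs_Qp_distC => /ltW.
Qed.

Lemma locally_pball_measurable (E : set T) :
  (forall x, E x -> exists g, pball g x `<=` E) -> measurable E.
Proof. by move=> /locally_pball_open oE; exact: (@sub_sigma_algebra _ setT (@open T) E oE). Qed.

Lemma measurable_pball (g : int) (a : T) : measurable (pball g a).
Proof.
by apply: locally_pball_measurable => x ax; exists g; rewrite (pball_eq ax).
Qed.

Lemma pball0_compact (g : int) : compact (pball g (0 : T)).
Proof.
have -> : pball g (0 : T) = [set w : 'rV[Qp p]_n | forall j, [set x | v x <= p%:Q ^ g] (w ord0 j)].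
  by apply/seteqP; split=> x; rewrite pballP /= => xg j; have := xg j; rewrite mxE subr0.
exact: (@rV_compact (Qp p) n (fun=> [set x | v x <= p%:Q ^ g]) (fun=> @Qp_ball_compact p p_pr g)).
Qed.

(** Points with rational coordinates: every ball contains one, so a single
    sequence of centres serves all radii. *)
Definition pcenter (i : nat) : T :=
  if (unpickle i : option 'rV[rat]_n) is Some r then \row_j Qp_cst p (r 0 j) else 0.

Lemma pcenter_dense (g : int) (x : T) : exists i, pball g (pcenter i) x.
Proof.
have [r xr] := choice (fun j => Qp_cst_dense (x 0 j) (exp_base_gt0 p_pr g)).
exists (pickle (\row_j r j : 'rV[rat]_n)); rewrite /pcenter pickleK.
by apply/pballP => j; rewrite !mxE.
Qed.

Section Haar.
Context {R : realType}.
Variable mu : {measure set T -> \bar R}.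
Hypothesis hmu : haar_measure mu.

Lemma pball_translate (g : int) (a : T) : pball g a = [set a + x | x in pball g 0].
Proof.
apply/seteqP; split=> [x xa|_ [x x0 <-]].
  by exists (x - a); [rewrite /pball /= subr0|rewrite addrC subrK].
by move: x0; rewrite /pball /= subr0 addrAC subrr add0r.
Qed.

Lemma haar_pball_center (g : int) (a : T) : mu (pball g a) = mu (pball g 0).
Proof. by rewrite pball_translate (hmu.1 a _ (measurable_pball g 0)). Qed.

Let shift (g : int) (a : {ffun 'I_n -> 'I_p}) : T :=
  \row_j Qp_cst p ((a j : nat)%:Q * p%:Q ^ (- (g + 1))).

(** Reducing the n coordinates modulo p splits a ball into p^n balls of the next
    smaller radius, which are disjoint by shift_trivIset. *)
Lemma pball_split (g : int) :
  pball (g + 1) 0 = \bigcup_(a : {ffun 'I_n -> 'I_p}) pball g (shift g a).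
Proof.
apply/seteqP; split=> [x /pballP x0|x [a _ /pballP xa]].
  have xg j : v (x 0 j - Qp_cst p 0) <= p%:Q ^ (g + 1).
    apply: (padic_abs_Qp_dist_le (z := 0)).
      by have := x0 j; rewrite mxE.
    by rewrite sub0r padic_abs_QpN padic_abs_cst padic_abs0 ltW // exp_base_gt0.
  have [a ax] := choice (fun j => Qp_ball_cover p_pr (xg j)).
  exists [ffun j => a j] => //.
  by apply/pballP => j; have := ax j; rewrite !mxE ffunE add0r addrK.
apply/pballP => j; rewrite mxE; apply: (padic_abs_Qp_dist_le (z := shift g a 0 j)).
  by apply: le_trans (xa j) _; rewrite exp_base_le // lerDl.
rewrite subr0 mxE padic_abs_cst padic_absM padic_abs_expz // opprK.
rewrite -[leRHS]mul1r; apply: ler_wpM2r; first by rewrite ltW // exp_base_gt0.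
have [->|a0] := eqVneq (a j : nat) 0%N; first by rewrite padic_abs0.
rewrite -[_%:Q]divr1 -[1]/(1%:~R) padic_abs_frac // logn1 sub0r.
by rewrite -[leRHS](expr0z p%:Q) exp_base_le // oppr_le0.
Qed.

Lemma shift_trivIset (g : int) :
  trivIset setT (fun a : {ffun 'I_n -> 'I_p} => pball g (shift g a)).
Proof.
apply/trivIsetP => a b _ _ /eqP ab; apply/seteqP; split=> // x [/pballP xa /pballP xb].
case: ab; apply/ffunP => j; apply/val_inj/(padic_residue_inj p_pr); rewrite ?ltn_ord //.
have : v (shift g a 0 j - shift g b 0 j) <= p%:Q ^ g.
  apply: (padic_abs_Qp_dist_le (z := x 0 j)); last exact: xb.
  by rewrite padic_abs_Qp_distC; apply: xa.
rewrite !mxE !Qp_cstB !padic_abs_cst -mulrBl padic_absM padic_abs_expz // opprK.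
rewrite expfzDr ?padic_base_neq0 // mulrCA -[leRHS]mulr1.
by rewrite ler_pM2l ?exp_base_gt0 // -ler_pdivlMr ?div1r ?padic_base_gt0.
Qed.

Lemma haar_pball_succ (g : int) :
  mu (pball (g + 1) (0 : T)) = ((p%:R ^+ n)%:E * mu (pball g (0%R : T)))%E.
Proof.
rewrite pball_split (measure_fin_bigcup mu finite_finset (@shift_trivIset g)); last first.
  by move=> a _; apply: measurable_pball.
rewrite (@fsbigE _ _ _ _ _ (enum {ffun 'I_n -> 'I_p})) ?enum_uniq //; last first.
  by move=> a; rewrite /= mem_enum.
rewrite (eq_bigr (fun=> mu (pball g (0%R : T)))); last by move=> a _; apply: haar_pball_center.
rewrite (eq_bigl xpredT); last by move=> a; rewrite ?mem_setT ?inE.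
rewrite big_const_seq count_predT -cardE card_ffun !card_ord -natrX mule_natl.
elim: (p ^ n)%N => [|k IH] //; rewrite iterS IH.
by case: k {IH} => [|k]; rewrite ?mule0n ?adde0 ?mule1n // muleS.
Qed.

(** Translation invariance and the splitting of a ball into p^n translates of a
    smaller one determine the measure of all balls from that of the unit ball. *)
Lemma haar_pball (g : int) (a : T) : mu (pball g a) = ((p%:R ^+ n) ^ g)%:E.
Proof.
have P0 : (p%:R ^+ n : R) != 0 by rewrite expf_neq0 // pnatr_eq0 -lt0n prime_gt0.
rewrite haar_pball_center; elim/int_rec: g => [|g IH|g IH].
- by rewrite expr0z hmu.2.
- by rewrite -addn1 PoszD haar_pball_succ IH -EFinM expfzDr // expr1z mulrC.
have := haar_pball_succ (- g.+1%:Z).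
rewrite (_ : - g.+1%:Z + 1 = - g%:Z) ?IH; last by rewrite -addn1 PoszD opprD subrK.
have : (0 <= mu (pball (- g.+1%:Z) (0%R : T)))%E by exact: measure_ge0.
case: (mu (pball (- g.+1%:Z) _)) => [r _|_|//].
  rewrite -EFinM => -[e]; congr (_%:E); apply: (mulfI P0); rewrite -e.
  by rewrite -addn1 PoszD opprD [in RHS]expfzDr // exprN1 mulrCA mulfV ?mulr1.
by rewrite gt0_muley // lte_fin lt_neqAle eq_sym P0 exprn_ge0.
Qed.

End Haar.
End QpnBalls.

(* Balls are used only through the lemmas above; unfolding them would let
   conversion compute with p-adic norms. *)
Local Opaque pball.

(** * Integrals of nonnegative functions *)

Section IntegralTools.
Context d (T : measurableType d) (R : realType).
Variable mu : {measure set T -> \bar R}.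

(** The integral of a nonnegative function is a supremum over the simple functions
    below it, so monotonicity holds for arbitrary functions. Commutators are
    compared with their measurable majorants in this way. *)
Lemma ge0_le_integralT (f g : T -> \bar R) :
  (forall x, 0 <= f x)%E -> (forall x, f x <= g x)%E ->
  (\int[mu]_x f x <= \int[mu]_x g x)%E.
Proof.
move=> f0 fg; have g0 x : (0 <= g x)%E := le_trans (f0 x) (fg x).
rewrite !ge0_integralTE //; apply: le_ereal_sup => _ [h hf <-]; exists h => // x.
exact: le_trans (hf x) (fg x).
Qed.

Lemma ae_le_integralT (f g : T -> \bar R) :
  (forall x, 0 <= f x)%E -> (forall x, 0 <= g x)%E -> measurable_fun setT g ->
  (\forall x \ae mu, f x <= g x)%E -> (\int[mu]_x f x <= \int[mu]_x g x)%E.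
Proof.
move=> f0 g0 mg [N [mN N0 fgN]].
pose g' x : \bar R := if x \in N then +oo%E else g x.
have -> : (\int[mu]_x g x = \int[mu]_x g' x)%E.
  apply: ge0_ae_eq_integral => //.
  - apply: measurable_fun_if => //.
    + apply: (measurable_fun_bool true); rewrite setTI [X in measurable X](_ : _ = N) //.
      by apply/seteqP; split=> x /=; [exact: set_mem|exact: mem_set].
    + exact: measurable_funTS.
  - by move=> x _; rewrite /g'; case: ifP; rewrite ?leey.
  - exists N; split=> // x /= /not_implyP[_]; rewrite /g'.
    by case: ifPn => [/set_mem|].
apply: ge0_le_integralT => // x; rewrite /g'; case: ifPn => [_|]; first exact: leey.
rewrite notin_setE => xN; apply: contrapT => fgx; apply: xN; exact: fgN.
Qed.

Lemma measurable_powR_fun (f q : T -> R) : measurable_fun setT f ->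
  measurable_fun setT q -> measurable_fun setT (fun x => f x `^ q x).
Proof.
move=> mf mq; rewrite /powR; apply: measurable_fun_if => //.
- exact: measurable_fun_eqr.
- apply: measurable_funTS; have -> : (fun x => (q x == 0)%:R : R) = (fun x => if q x == 0 then 1 else 0).
    by apply/funext => x; case: ifP.
  by apply: measurable_fun_if => //; exact: measurable_fun_eqr.
- apply: measurable_funTS; apply: measurableT_comp => //.
  by apply: measurable_funM => //; apply: measurableT_comp.
Qed.

Lemma measurable_abs_EFin (f : T -> R) (A : set T) :
  measurable_fun setT f -> measurable_fun A (fun x => `|f x|%:E).
Proof.
by move=> mf; apply/measurable_EFinP/measurable_funTS; exact: measurableT_comp.
Qed.

End IntegralTools.

(** * The weak type bound for the maximal operator *)

Section BallInvariant.
Context {R : realType} {p n : nat}.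
Hypothesis p_pr : prime p.
Variable mu : {measure set (Qpn p n) -> \bar R}.
Hypothesis hmu : haar_measure mu.
Local Notation T := (Qpn p n).

(** The Haar measure of every ball of radius p^g. *)
Definition vol (g : int) : R := (p%:R ^+ n) ^ g.

Lemma vol_gt0 g : 0 < vol g.
Proof. by rewrite exprz_gt0 // exprn_gt0 // ltr0n prime_gt0. Qed.

Lemma vol_ge0 g : 0 <= vol g.
Proof. exact/ltW/vol_gt0. Qed.

Lemma haar_pball_vol g a : mu (pball g a) = (vol g)%:E.
Proof. exact: haar_pball. Qed.

Lemma haar_pball_inv g a : ((mu (pball g a))^-1 = (vol g)^-1%:E)%E.
Proof. by rewrite haar_pball_vol inver gt_eqF ?vol_gt0. Qed.

Lemma averageE (f : T -> R) g x :
  average mu f (pball g x) = ((vol g)^-1%:E * \int[mu]_(y in pball g x) `|f y|%:E)%E.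
Proof. by rewrite /average haar_pball_inv. Qed.

Lemma average_ge0 (f : T -> R) g x : (0 <= average mu f (pball g x))%E.
Proof.
rewrite averageE mule_ge0 ?lee_fin ?invr_ge0 ?vol_ge0 //.
by apply: integral_ge0 => y _; rewrite lee_fin.
Qed.

Lemma average_le_maximal (f : T -> R) g x :
  (average mu f (pball g x) <= maximal mu f x)%E.
Proof. by apply: ereal_sup_ubound; exists g. Qed.

Lemma maximal_ge0 (f : T -> R) x : (0 <= maximal mu f x)%E.
Proof. exact: le_trans (average_ge0 f 0 x) (average_le_maximal f 0 x). Qed.

Lemma lt_maximalP (f : T -> R) x (y : \bar R) :
  (y < maximal mu f x)%E <-> exists g, (y < average mu f (pball g x))%E.
Proof.
split=> [/ereal_sup_gt[_ [g _ <-] yg]|[g yg]]; first by exists g.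
exact: lt_le_trans (average_le_maximal f g x).
Qed.

(** The average over the ball of radius p^g around x does not change when x moves
    inside the ball, so the superlevel sets of the maximal function are open. *)
Lemma measurable_maximal (f : T -> R) : measurable_fun setT (maximal mu f).
Proof.
move=> mD; apply: (measurability _ (ErealGenOInfty.measurableE R)) => //.
move=> _ [_ [y ->] <-]; rewrite setTI.
apply: (locally_pball_measurable p_pr) => x /=; rewrite in_itv /= andbT => /lt_maximalP[g yg].
exists g => z xz /=; rewrite in_itv /= andbT; apply/lt_maximalP; exists g.
by rewrite (pball_eq p_pr xz).
Qed.

(** A ball-invariant set is a countable disjoint union of balls of one radius,
    so comparing two integrals over it reduces to comparing them ball by ball. *)
Lemma ball_invariant_le_integral (E : set T) g (f1 f2 : T -> \bar R) :
  measurable_fun setT f1 -> measurable_fun setT f2 ->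
  (forall x, 0 <= f1 x)%E -> (forall x, 0 <= f2 x)%E ->
  (forall x, E x -> pball g x `<=` E) ->
  (forall x, E x -> \int[mu]_(y in pball g x) f1 y <= \int[mu]_(y in pball g x) f2 y)%E ->
  (\int[mu]_(y in E) f1 y <= \int[mu]_(y in E) f2 y)%E.
Proof.
move=> mf1 mf2 f10 f20 Einv f12.
have mE : measurable E.
  by apply: (locally_pball_measurable p_pr) => x Ex; exists g; apply: Einv.
pose F i := E `&` pball g (pcenter p n i).
have mF i : measurable (F i) by apply: measurableI => //; exact: (measurable_pball p_pr).
have EF : E = \bigcup_i seqDU F i.
  rewrite -seqDU_bigcup_eq; apply/seteqP; split=> [x Ex|x [i _ []//]].
  by have [i ix] := pcenter_dense p_pr g x; exists i.
have mS i : measurable (seqDU F i) by apply: measurableD => //; exact: bigsetU_measurable.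
have Spart i x : seqDU F i x -> seqDU F i = pball g x.
  move=> [[Ex ix] nx]; apply/seteqP; split=> [y [[_ iy] _]|y xy].
    by rewrite (pball_eq p_pr ix).
  split; first by split; [exact: Einv xy|rewrite -(pball_eq p_pr ix)].
  rewrite -bigcup_mkord => -[j /= ji [_ jy]]; apply: nx.
  rewrite -bigcup_mkord; exists j; [exact: ji|split; [exact: Ex|]].
  by rewrite -(pball_eq p_pr jy); exact: (pball_sym p_pr xy).
rewrite EF !ge0_integral_bigcup //; try by [exact: trivIset_seqDU|exact: measurable_funTS].
apply: lee_nneseries => [i _ _|i _]; first by apply: integral_ge0 => x _.
have [->|/set0P[x Six]] := eqVneq (seqDU F i) set0; first by rewrite !integral_set0.
by rewrite (Spart i x Six); apply: f12; case: Six => -[].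
Qed.

(** The weak type bound for the balls of radius at most p^N, for which there is a
    largest ball around each point of the set whose average exceeds l. *)
Lemma weak_type_level (f : T -> R) (l : R) (N : nat) : measurable_fun setT f -> 0 < l ->
  (l%:E * mu [set x | exists2 g : int, (g <= N%:Z)%R & l%:E < average mu f (pball g x)]
     <= \int[mu]_x `|f x|%:E)%E.
Proof.
move=> mf l0.
pose A (k : nat) x := average mu f (pball (N%:Z - k%:Z) x).
(* The points whose stopping ball has radius p^(N-k). *)
pose E k := [set x | (l%:E < A k x)%E /\ forall j, (j < k)%N -> (A j x <= l%:E)%E].
have Ainv k j x y : (j <= k)%N -> pball (N%:Z - k%:Z) x y -> A j y = A j x.
  move=> jk xy; have xy' : pball (N%:Z - j%:Z) x y.
    by apply: (pball_le p_pr _ xy); rewrite lerD2l lerN2 lez_nat.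
  by rewrite /A (pball_eq p_pr xy').
have Einv k x : E k x -> pball (N%:Z - k%:Z) x `<=` E k.
  move=> [lx jx] y xy; split; first by rewrite (Ainv k k x y).
  by move=> j jk; rewrite (Ainv k j x y (ltnW jk) xy); apply: jx.
have mE k : measurable (E k).
  by apply: (locally_pball_measurable p_pr) => x Ex; eexists; apply: Einv Ex.
have tE : trivIset setT E.
  apply: ltn_trivIset => i j ji; apply/seteqP; split=> // x [[lj _] [_ /(_ _ ji)]].
  by rewrite leNgt lj.
have UE : [set x | exists2 g : int, g <= N%:Z & (l%:E < average mu f (pball g x))%E] =
    \bigcup_k E k.
  apply/seteqP; split=> [x [g gN lg]|x [k _ [lx _]]]; last first.
    by exists (N%:Z - k%:Z) => //; rewrite gerBl.
  have ex : exists k, (l%:E < A k x)%E.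
    exists `|N%:Z - g|%N; rewrite /A gez0_abs ?subr_ge0 //.
    by rewrite opprB addrC subrK.
  exists (ex_minn ex) => //; case: ex_minnP => k lk kmin; split=> // j jk.
  by rewrite leNgt; apply/negP => /kmin; rewrite leqNgt jk.
have mf' : measurable_fun setT (fun x => `|f x|%:E).
  by apply/measurable_EFinP; exact: measurableT_comp.
rewrite UE -integral_cst; last exact: bigcup_measurable.
rewrite ge0_integral_bigcup // => [|x _]; last by rewrite lee_fin ltW.
apply: (@le_trans _ _ (\sum_(k <oo) \int[mu]_(x in E k) `|f x|%:E)%E).
  apply: lee_nneseries => [k _ _|k _].
    by apply: integral_ge0 => x _; rewrite lee_fin ltW.
  apply: (@ball_invariant_le_integral _ (N%:Z - k%:Z)) => //.
  - by move=> x; rewrite lee_fin ltW.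
  - exact: Einv.
  - move=> x [lx _]; rewrite integral_cst; last exact: (measurable_pball p_pr).
    move: lx; rewrite /A averageE => /ltW lx; rewrite haar_pball_vol muleC.
    rewrite -(@lee_pmul2l _ (vol (N%:Z - k%:Z))^-1%:E) ?lte_fin ?invr_gt0 ?vol_gt0 //.
    by rewrite -!EFinM mulrA mulVf ?gt_eqF ?vol_gt0 // mul1r.
rewrite -ge0_integral_bigcup //; last exact: measurable_funTS.
by apply: ge0_subset_integral => //; exact: bigcup_measurable.
Qed.

(** The weak (1,1) bound with constant 1. Balls are nested or disjoint, so the
    largest ball of radius at most p^N around x with average above l is the
    same for all of its points: these stopping balls are disjoint. *)
Lemma maximal_weak_type (f : T -> R) (l : R) : measurable_fun setT f -> 0 < l ->
  (mu [set x | l%:E < maximal mu f x] <= l^-1%:E * \int[mu]_x `|f x|%:E)%E.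
Proof.
move=> mf l0.
pose U (N : nat) := [set x | exists2 g : int, g <= N%:Z & (l%:E < average mu f (pball g x))%E].
have -> : [set x | (l%:E < maximal mu f x)%E] = \bigcup_N U N.
  apply/seteqP; split=> [x /= /lt_maximalP[g lg]|x [N _ [g _ lg]] /=]; last first.
    by apply/lt_maximalP; exists g.
  by exists `|g|%N => //; exists g => //; rewrite abszE ler_norm.
have mU N : measurable (U N).
  apply: (locally_pball_measurable p_pr) => x [g gN lg]; exists g => y xy; exists g; first exact: gN.
  by rewrite (pball_eq p_pr xy).
have ndU : nondecreasing_seq U.
  move=> i j ij; apply/subsetPset => x [g gi lg]; exists g => //.
  by apply: le_trans gi _; rewrite lez_nat.
have cvU := nondecreasing_cvg_mu (mu := mu) mU (bigcup_measurable (fun i _ => mU i)) ndU.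
rewrite -(cvg_lim _ cvU) //; apply: lime_le; first exact: (cvgP _ cvU).
apply: nearW => N /=.
have := weak_type_level N mf l0; rewrite -/(U N) => wU.
rewrite -(@lee_pmul2l _ l%:E) ?lte_fin //; apply: le_trans wU _.
by rewrite muleA -EFinM mulfV ?gt_eqF // mul1e.
Qed.

End BallInvariant.

(** * The strong type bound for constant exponents *)

Lemma nneseries_term_le {R : realType} (u : nat -> \bar R) (k : nat) :
  (forall i, 0 <= u i)%E -> (u k <= \sum_(i <oo) u i)%E.
Proof.
move=> u0; apply: le_trans (nneseries_lim_ge k.+1 _); last by move=> i _ _; exact: u0.
by rewrite big_mkord big_ord_recr /= leeDr // sume_ge0.
Qed.

(** The terms with index in P are at most b and the sequence grows geometrically,
    so their sum is comparable to the last of them. *)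
Lemma geometric_sum_le {R : realFieldType} (c b : R) (u : nat -> R) (P : pred nat) (m : nat) :
  1 < c -> 0 <= b -> (forall k, 0 <= u k) -> (forall k, u k.+1 = c * u k) ->
  (forall k, P k -> u k <= b) ->
  \sum_(k < m | P k) u k <= c / (c - 1) * b.
Proof.
move=> c1 b0 u0 uS uP; have c10 : 0 < c - 1 by rewrite subr_gt0.
have cc0 : 0 <= c / (c - 1) by apply/ltW/divr_gt0 => //; exact: lt_trans ltr01 c1.
have geo j : \sum_(k < j | P k) u k <= u j / (c - 1).
  elim: j => [|j IH]; first by rewrite big_ord0 divr_ge0 ?u0 // ltW.
  rewrite big_mkcond big_ord_recr -big_mkcond /= uS.
  have -> : c * u j / (c - 1) = u j / (c - 1) + u j by field; rewrite gt_eqF.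
  by apply: lerD => //; case: ifP.
elim: m => [|m IH]; first by rewrite big_ord0 mulr_ge0.
rewrite big_mkcond big_ord_recr -big_mkcond /=; case: ifPn => [Pm|_]; last by rewrite addr0.
apply: (@le_trans _ _ (u m / (c - 1) + u m)); first by apply: lerD; [exact: geo|].
have -> : u m / (c - 1) + u m = c / (c - 1) * u m by field; rewrite gt_eqF.
by rewrite ler_wpM2l ?uP.
Qed.

Lemma powR_gt1 {R : realType} (a r : R) : 1 < a -> 0 < r -> 1 < a `^ r.
Proof.
move=> a1 r0; rewrite -[ltLHS](_ : 1 `^ r = 1); last by rewrite powR1.
by apply: gt0_ltr_powR; rewrite ?nnegrE // (le_trans ler01) // ltW.
Qed.

Lemma powR_le {R : realType} (a b r : R) : 0 <= r -> 0 <= a -> a <= b -> a `^ r <= b `^ r.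
Proof.
by move=> r0 a0 ab; apply: ge0_ler_powR => //; rewrite nnegrE // (le_trans a0).
Qed.


Section StrongType.
Context {R : realType} {p n : nat}.
Hypothesis p_pr : prime p.
Variable mu : {measure set (Qpn p n) -> \bar R}.
Hypothesis hmu : haar_measure mu.
Local Notation T := (Qpn p n).

Let level (K k : nat) : R := 2 ^ (k%:Z - K%:Z).

Let level_gt0 K k : 0 < level K k.
Proof. by rewrite exprz_gt0. Qed.

Let levelS K k : level K k.+1 = 2 * level K k.
Proof. by rewrite /level (_ : k.+1%:Z = k%:Z + 1) -1?addn1 // addrAC expfzDr ?pnatr_eq0 // expr1z mulrC. Qed.

Let level_sup K (r : R) : exists k, r <= level K k.
Proof.
pose j := Num.bound `|r|; exists (j + K)%N.
rewrite /level PoszD addrK -exprnP; apply: le_trans (ler_norm _) _.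
apply: le_trans (ltW (archi_boundP (normr_ge0 r))) _.
by rewrite -natrX ler_nat ltnW // ltn_expl.
Qed.

Let above (f : T -> R) (l : R) x : R := if l < 2 * `|f x| then f x else 0.

Let measurable_above f l : measurable_fun setT f -> measurable_fun setT (above f l).
Proof.
move=> mf; apply: measurable_fun_if => //; last exact: measurable_funTS.
by apply: measurable_fun_ltr => //; apply: measurable_funM => //; exact: measurableT_comp.
Qed.

(** The part of f where 2|f| <= l contributes at most l/2 to an average, so an
    average above l forces one above l/2 for the remaining part. *)
Lemma maximal_level_le (f : T -> R) (l : R) : measurable_fun setT f -> 0 < l ->
  (mu [set x | l%:E < maximal mu f x] <= (2 / l)%:E * \int[mu]_x `|above f l x|%:E)%E.
Proof.
move=> mf l0; have l20 : 0 < l / 2 by rewrite divr_gt0.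
have -> : 2 / l = (l / 2)^-1 by rewrite invf_div.
apply: le_trans (maximal_weak_type p_pr hmu (measurable_above l mf) l20).
apply: le_measure; rewrite ?inE.
- by rewrite -[X in measurable X]setTI; apply: emeasurable_fun_o_infty => //; exact: measurable_maximal.
- by rewrite -[X in measurable X]setTI; apply: emeasurable_fun_o_infty => //; exact: measurable_maximal.
move=> x /= /lt_maximalP[g lg]; apply/lt_maximalP; exists g.
rewrite ltNge; apply/negP => al; move: lg; rewrite ltNge => /negP; apply.
move: al; rewrite !(averageE p_pr hmu) => al.
have := vol_gt0 (R := R) (n := n) p_pr g; set V := vol g => V0.
apply: (@le_trans _ _ (V^-1%:E * (\int[mu]_(y in pball g x) `|above f l y|%:E + (l / 2 * V)%:E))%E).
  rewrite lee_pmul2l ?lte_fin ?invr_gt0 //.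
  have mB := measurable_pball p_pr g x.
  have -> : ((l / 2 * V)%:E = \int[mu]_(y in pball g x) (cst (l / 2)%:E y))%E.
    by rewrite integral_cst // haar_pball_vol.
  rewrite -ge0_integralD //; last 2 first.
  - by apply: measurable_funTS; apply: measurable_abs_EFin; exact: measurable_above.
  - by move=> y _; rewrite /= lee_fin; exact: ltW.
  apply: ge0_le_integral => //.
  - by apply: measurable_funTS; apply: measurable_abs_EFin.
  - by apply: emeasurable_funD => //; apply: measurable_funTS; apply: measurable_abs_EFin; exact: measurable_above.
  move=> y _; rewrite -EFinD lee_fin /above; case: ltP => [_|fl].
    by rewrite lerDl ltW.
  by rewrite normr0 add0r ler_pdivlMr // mulrC.
rewrite ge0_muleDr; last 2 first.
- by apply: integral_ge0 => y _; rewrite lee_fin.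
- by rewrite lee_fin ltW // mulr_gt0.
rewrite -EFinM mulrCA mulVf ?gt_eqF // mulr1 [leRHS](_ : _ = ((l / 2)%:E + (l / 2)%:E)%E).
  exact: leeD.
by rewrite -EFinD -splitr.
Qed.

Let D (f : T -> R) K k := [set x | ((level K k)%:E < maximal mu f x)%E].

Let measurable_D f K k : measurable (D f K k).
Proof.
rewrite -[X in measurable X]setTI; apply: emeasurable_fun_o_infty => //.
exact: measurable_maximal.
Qed.

(** A staircase majorant of (M f)^s on the set where M f exceeds the first
    level: if k is the last level exceeded at x, then M f(x) is at most the level
    k + 1, whose power s is the k-th step. *)
Let psi (s : R) (f : T -> R) K x : \bar R :=
  (\sum_(k <oo) (level K k.+1 `^ s * \1_(D f K k) x)%:E)%E.

Let psi_term_ge0 s f K k x : (0 <= (level K k.+1 `^ s * \1_(D f K k) x)%:E)%E.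
Proof. by rewrite lee_fin mulr_ge0 ?powR_ge0 // indicE. Qed.

Let maximal_le_psi s f K x : 0 < s -> D f K 0 x -> (maximal mu f x `^ s <= psi s f K x)%E.
Proof.
move=> s0; rewrite /D /=.
have psi_ge k : D f K k x -> ((level K k.+1 `^ s)%:E <= psi s f K x)%E.
  move=> Dk; apply: le_trans (nneseries_term_le k (psi_term_ge0 s f K ^~ x)).
  by rewrite indicE mem_set // mulr1.
case E : (maximal mu f x) => [r| |//]; last first.
  move=> _; rewrite (_ : psi s f K x = +oo%E) ?leey //; apply/eqyP => A A0.
  have [k Ak] := level_sup K (A `^ s^-1).
  apply: le_trans (psi_ge k _); last by rewrite /D /= E ltry.
  rewrite lee_fin levelS -[leLHS](_ : (A `^ s^-1) `^ s = A); last first.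
    by rewrite -powRrM mulVf ?gt_eqF // powRr1 // ltW.
  apply: ge0_ler_powR; rewrite ?nnegrE ?powR_ge0 ?mulr_ge0 ?(ltW (level_gt0 _ _)) ?(ltW s0) //.
  by apply: le_trans Ak _; rewrite ler_peMl ?(ltW (level_gt0 _ _)) // ler1n.
rewrite lte_fin => Kr.
have ex : exists k, r <= level K k := level_sup K r.
case: (ex_minnP ex) => -[|k] rk kmin; first by rewrite leNgt Kr in rk.
have Dk : D f K k x.
  by rewrite /D /= E lte_fin ltNge; apply/negP => /kmin; rewrite ltnn.
apply: le_trans (psi_ge k Dk); rewrite poweR_EFin lee_fin.
have r0 : 0 <= r by rewrite ltW // (lt_trans (level_gt0 K 0)).
by apply: ge0_ler_powR; rewrite ?nnegrE ?(ltW (level_gt0 _ _)) ?(ltW s0).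
Qed.

Let strong_const (s : R) : R :=
  2 `^ s * 2 * (2 `^ (s - 1) / (2 `^ (s - 1) - 1) * 2 `^ (s - 1)).

Let integral_psi s f K : 1 < s -> measurable_fun setT f ->
  (\int[mu]_x psi s f K x <= (strong_const s)%:E * \int[mu]_x (`|f x| `^ s)%:E)%E.
Proof.
move=> s1 mf; have s0 : 0 < s := lt_trans ltr01 s1.
have mfs : measurable_fun setT (fun x => (`|f x| `^ s)%:E).
  apply/measurable_EFinP; apply: (measurable_powR_fun (q := cst s)) => //.
  exact: measurableT_comp.
have mabove k : measurable_fun setT (fun x => `|above f (level K k) x|%:E).
  by apply/measurable_EFinP; apply: measurableT_comp => //; exact: measurable_above.
have c1 : 1 < 2 `^ (s - 1) :> R.
  by rewrite powR_gt1 ?subr_gt0 // ltr1n.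
have C0 : 0 <= strong_const s.
  by rewrite !mulr_ge0 ?powR_ge0 // invr_ge0 subr_ge0 ltW.
have lS k : level K k.+1 `^ s * (2 / level K k) = 2 `^ s * 2 * level K k `^ (s - 1).
  rewrite levelS powRM ?(ltW (level_gt0 _ _)) //.
  rewrite -(mulr_powRB1 (ltW (level_gt0 K k)) s0).
  by field; rewrite gt_eqF.
rewrite /psi integral_nneseries //; last first.
  by move=> k; apply/measurable_EFinP/measurable_funM => //; exact: measurable_indic.
rewrite -ge0_integralZl //.
apply: (@le_trans _ _ (\sum_(k <oo) \int[mu]_x
   ((2 `^ s * 2 * level K k `^ (s - 1))%:E * `|above f (level K k) x|%:E))%E).
  apply: lee_nneseries => [k _ _|k _]; first by apply: integral_ge0 => x _.
  under eq_integral do rewrite EFinM.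
  rewrite ge0_integralZl_EFin ?powR_ge0 //; last by apply/measurable_EFinP; exact: measurable_indic.
  rewrite integral_indic // setIT ge0_integralZl_EFin //; last first.
    by rewrite !mulr_ge0 ?powR_ge0.
  rewrite -lS EFinM -muleA lee_wpmul2l ?lee_fin ?powR_ge0 //.
  exact: maximal_level_le.
rewrite -integral_nneseries //; last 2 first.
- by move=> k; apply: measurable_funeM.
- by move=> k x _; rewrite -EFinM lee_fin !mulr_ge0 ?powR_ge0.
apply: ge0_le_integralT => x.
  by apply: nneseries_ge0 => k _ _; rewrite -EFinM lee_fin !mulr_ge0 ?powR_ge0.
apply: lime_le.
  by apply: is_cvg_nneseries => k _ _; rewrite -EFinM lee_fin !mulr_ge0 ?powR_ge0.
apply: nearW => m; rewrite -EFinM.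
under eq_bigr do rewrite -EFinM.
rewrite sumEFin lee_fin big_mkord.
have -> : \sum_(k < m) 2 `^ s * 2 * level K k `^ (s - 1) * `|above f (level K k) x| =
   2 `^ s * 2 * `|f x| * \sum_(k < m | level K k < 2 * `|f x|) level K k `^ (s - 1).
  rewrite [in RHS]big_mkcond mulr_sumr; apply: eq_bigr => k _; rewrite /above.
  by case: ifP => _; [rewrite mulrAC|rewrite normr0 !mulr0].
have lX k : level K k.+1 `^ (s - 1) = 2 `^ (s - 1) * level K k `^ (s - 1).
  by rewrite levelS powRM // ltW.
have ub k : level K k < 2 * `|f x| -> level K k `^ (s - 1) <= (2 * `|f x|) `^ (s - 1).
  move=> lf; apply: powR_le; rewrite ?subr_ge0 1?ltW //.
have := geometric_sum_le (P := fun k => level K k < 2 * `|f x|) m c1 (powR_ge0 _ _)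
  (fun k => powR_ge0 (level K k) (s - 1)) lX ub.
move=> /(ler_wpM2l (x := 2 `^ s * 2 * `|f x|)); rewrite !mulr_ge0 ?powR_ge0 // => /(_ isT).
move=> /le_trans; apply; rewrite powRM // -(mulr_powRB1 (normr_ge0 (f x)) s0) /strong_const.
by rewrite le_eqVlt; apply/orP; left; apply/eqP; field; rewrite gt_eqF // subr_gt0.
Qed.

(** The maximal operator is bounded on L^s for constant s > 1. Summing the weak
    bound for the part of f above half the level over dyadic levels 2^(k-K),
    the geometric series turns level^(s-1) into |f|^(s-1); the cut-off 2^-K
    makes the levels start at a first one and is removed by monotone
    convergence. *)
Lemma maximal_strong_type (s : R) : 1 < s ->
  exists2 C : R, 0 < C & forall f : T -> R, measurable_fun setT f ->
    (\int[mu]_x (maximal mu f x `^ s) <= C%:E * \int[mu]_x (`|f x| `^ s)%:E)%E.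
Proof.
move=> s1; have s0 : 0 < s := lt_trans ltr01 s1.
have C0 : 0 < strong_const s.
  have c1 : 1 < 2 `^ (s - 1) :> R.
    by rewrite powR_gt1 ?subr_gt0 // ltr1n.
  by rewrite !mulr_gt0 ?powR_gt0 // invr_gt0 subr_gt0.
exists (strong_const s) => // f mf.
have mM : measurable_fun setT (fun x => (maximal mu f x `^ s)%E).
  by apply: (measurableT_comp (measurable_poweR s)); exact: measurable_maximal.
pose F K := D f K 0.
have ndF : nondecreasing_seq F.
  move=> i j ij; apply/subsetPset => x; rewrite /F /D /=; apply: le_lt_trans.
  by rewrite lee_fin /level ler_eXz2l ?ltr1n // lerD2l lerN2.
have cvF := ge0_nondecreasing_set_cvg_integral (mu := mu) ndF (fun K => measurable_D f K 0)
  (fun K => measurable_funTS mM) (fun _ x _ => poweR_ge0 (maximal mu f x) s).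
have -> : (\int[mu]_x (maximal mu f x `^ s) = \int[mu]_(x in \bigcup_K F K) (maximal mu f x `^ s))%E.
  rewrite [RHS]integral_mkcond; apply: eq_integral => x _; rewrite patchE.
  case: ifPn => // /negP; rewrite inE => nF.
  suff -> : maximal mu f x = 0%E by rewrite poweR0r ?gt_eqF.
  apply/eqP; rewrite eq_le maximal_ge0 // andbT leNgt; apply/negP => M0.
  apply: nF; have [r r0 rM] : exists2 r : R, 0 < r & (r%:E < maximal mu f x)%E.
    move: M0; case: (maximal mu f x) => [r| |//].
      by rewrite lte_fin => r0; exists (r / 2); rewrite ?divr_gt0 // lte_fin ltr_pdivrMr // ltr_pMr // ltr1n.
    by move=> _; exists 1; rewrite ?ltry.
  have [K Kr] := level_sup 0 r^-1.
  exists K => //; rewrite /F /D /=; apply: le_lt_trans rM; rewrite lee_fin.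
  rewrite /level sub0r -invr_expz invf_ple ?posrE ?exprz_gt0 //.
  by move: Kr; rewrite /level subr0.
rewrite -(cvg_lim _ cvF) //; apply: lime_le; first exact: (cvgP _ cvF).
apply: nearW => K; apply: le_trans (integral_psi K s1 mf).
rewrite integral_mkcond; apply: ge0_le_integralT => x; rewrite patchE; case: ifPn => // xF.
- exact: poweR_ge0.
- by apply: maximal_le_psi => //; move: xF; rewrite inE.
- by apply: nneseries_ge0 => k _ _; exact: psi_term_ge0.
Qed.

End StrongType.

(** * Inequalities for real powers *)

Section RealInequalities.
Context {R : realType}.
Implicit Types a b f l t u K : R.

Lemma powR_le_neg a b t : 0 < a -> a <= b -> t <= 0 -> b `^ t <= a `^ t.
Proof.
move=> a0 ab t0; have b0 := lt_le_trans a0 ab.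
rewrite -[t]opprK !(powRN _ (- t)) lef_pV2 ?posrE ?powR_gt0 //.
by apply: powR_le; rewrite ?oppr_ge0 // ltW.
Qed.

(** A lossy Young inequality; unlike the sharp one it needs no relation between
    the exponents of different terms, so it survives when t depends on the
    point. *)
Lemma crude_young f l t : 0 <= f -> 0 < l -> 1 <= t -> f <= l + l `^ (1 - t) * f `^ t.
Proof.
move=> f0 l0 t1; have [fl|lf] := leP f l.
  by apply: le_trans fl _; rewrite lerDl mulr_ge0 // powR_ge0.
have f1 : 0 < f := lt_trans l0 lf.
apply: (@le_trans _ _ (f `^ (1 - t) * f `^ t)).
  by rewrite -powRD ?subrK ?powRr1 // gt_eqF ?implybT.
rewrite -[leLHS]add0r lerD ?(ltW l0) // ler_wpM2r ?powR_ge0 // powR_le_neg ?(ltW lf) //.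
by rewrite subr_le0.
Qed.

Lemma powR_le_expR b u K : 0 < b -> u * ln b <= K -> b `^ u <= expR K.
Proof. by move=> b0 uK; rewrite /powR gt_eqF // ler_expR. Qed.

(** For 1 <= l <= b, changing the exponent of l by tx - ty costs at most
    b^|tx - ty|; exponent_change_le1 is the same for m^-1 <= l <= 1. *)
Lemma exponent_change_ge1 l b tx ty K : 1 <= l -> l <= b -> `|tx - ty| * ln b <= K ->
  l `^ (1 - ty) <= expR K * l `^ (1 - tx).
Proof.
move=> l1 lb tK; have l0 : 0 < l := lt_le_trans ltr01 l1.
have -> : 1 - ty = (tx - ty) + (1 - tx) by ring.
rewrite powRD ?(lt0r_neq0 l0) ?implybT // ler_wpM2r ?powR_ge0 //.
apply: (@le_trans _ _ (l `^ `|tx - ty|)); first by rewrite ler_powR // ler_norm.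
apply: powR_le_expR => //; apply: le_trans tK; rewrite ler_wpM2l //.
by rewrite ler_ln ?posrE // (lt_le_trans l0).
Qed.

Lemma exponent_change_le1 l m tx ty K : 0 < l -> l <= 1 -> 1 <= m -> m^-1 <= l ->
  `|tx - ty| * ln m <= K -> l `^ (1 - ty) <= expR K * l `^ (1 - tx).
Proof.
move=> l0 l1 m1 ml tK; have m0 : 0 < m := lt_le_trans ltr01 m1.
have -> : 1 - ty = (tx - ty) + (1 - tx) by ring.
rewrite powRD ?(lt0r_neq0 l0) ?implybT // ler_wpM2r ?powR_ge0 //.
apply: (@le_trans _ _ (l `^ - `|tx - ty|)).
  by rewrite ger_powR ?l0 // lerNl -normrN ler_norm.
apply: powR_le_expR => //; rewrite mulNr -mulrN; apply: le_trans tK; rewrite ler_wpM2l //.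
by rewrite -lnV ?posrE // ler_ln ?posrE ?invr_gt0 // -[m]invrK lef_pV2 ?posrE ?invr_gt0.
Qed.

Lemma powRD_le a b t : 0 <= a -> 0 <= b -> 0 <= t ->
  (a + b) `^ t <= 2 `^ t * (a `^ t + b `^ t).
Proof.
move=> a0 b0 t0.
wlog ab : a b a0 b0 / a <= b.
  by move=> H; have [/H|/ltW/H] := leP a b; rewrite ?[b + a]addrC ?[b `^ _ + _]addrC; apply.
apply: (@le_trans _ _ ((2 * b) `^ t)); first by apply: powR_le => //; [exact: addr_ge0|lra].
by rewrite powRM // ler_wpM2l ?powR_ge0 // lerDr powR_ge0.
Qed.

End RealInequalities.


(** * An integrable weight *)

Section Decay.
Context {R : realType} {p n : nat}.
Hypothesis p_pr : prime p.
Hypothesis n_gt0 : (0 < n)%N.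
Variable mu : {measure set (Qpn p n) -> \bar R}.
Hypothesis hmu : haar_measure mu.
Local Notation T := (Qpn p n).

(** The norm cut off below at 1: its values are powers of p with natural
    exponents, and it is constant on balls of radius 1. *)
Definition gauge (x : T) : R := Num.max 1 (ratr (padic_norm x)).

(** The exponent 2n makes the weight integrable, while its logarithm stays
    comparable to that of the gauge, as the log-Hoelder condition at infinity
    requires. *)
Definition decay (x : T) : R := (gauge x ^+ (2 * n))^-1.

Lemma gauge_ge1 x : 1 <= gauge x.
Proof. by rewrite /gauge le_max lexx. Qed.

Lemma gauge_gt0 x : 0 < gauge x.
Proof. exact: lt_le_trans ltr01 (gauge_ge1 x). Qed.

Lemma decay_gt0 x : 0 < decay x.
Proof. by rewrite invr_gt0 exprn_gt0 // gauge_gt0. Qed.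

Lemma decay_le1 x : decay x <= 1.
Proof. by rewrite invf_le1 ?exprn_gt0 ?gauge_gt0 // exprn_ege1 // gauge_ge1. Qed.

Lemma ratr_expn (k : nat) : ratr (p%:Q ^ k%:Z) = p%:R ^+ k :> R.
Proof. by rewrite -exprnP rmorphXn /= ratr_int. Qed.

Lemma gauge_le (k : nat) x : (gauge x <= p%:R ^+ k) <-> pball k%:Z 0 x.
Proof.
rewrite pball0_normE /gauge ge_max -ratr_expn ler_rat.
split=> [/andP[]//|->]; rewrite andbT ratr_expn exprn_ege1 //.
by rewrite ler1n prime_gt0.
Qed.

Lemma gauge_exp x : exists k : nat, gauge x = p%:R ^+ k.
Proof.
have [x1|x1] := leP (padic_norm x) 1.
  exists 0%N; rewrite expr0 /gauge; apply/max_idPl.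
  by rewrite -[leRHS](@ratr_nat R 1) ler_rat.
have [|g gx] := @padic_normE p n x.
  apply: contraTneq x1 => ->; rewrite -leNgt; apply/padic_norm_leP => // j.
  by rewrite mxE padic_abs_Qp0.
case: g gx => [k kx|k kx]; last first.
  move: x1; rewrite kx -[ltLHS](expr0z p%:Q) exp_base_lt //.
exists k; rewrite /gauge kx ratr_expn; apply/max_idPr.
by rewrite exprn_ege1 // ler1n prime_gt0.
Qed.

Lemma gauge_unit_ball x y : pball 0 x y -> gauge y = gauge x.
Proof.
suff H a b : pball 0 a b -> gauge b <= gauge a.
  by move=> xy; apply/eqP; rewrite eq_le (H _ _ xy) (H _ _ (pball_sym p_pr xy)).
move=> ab; have [k ka] := gauge_exp a.
have /gauge_le a0 : gauge a <= p%:R ^+ k by rewrite ka.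
rewrite ka; apply/gauge_le; apply: (pball_trans p_pr a0).
exact: (pball_le p_pr _ ab).
Qed.

Lemma decay_unit_ball x y : pball 0 x y -> decay y = decay x.
Proof. by rewrite /decay => /gauge_unit_ball ->. Qed.

Lemma measurable_decay : measurable_fun setT decay.
Proof.
move=> mD Y mY; rewrite setTI; apply: (locally_pball_measurable p_pr) => x /= Yx.
by exists 0 => y xy /=; rewrite (decay_unit_ball xy).
Qed.

(** The sphere where the gauge is p^k has measure at most p^(nk), so it
    contributes at most p^(-nk) <= 2^(-k). *)
Lemma integral_decay : (\int[mu]_x (decay x)%:E <= 2%:E)%E.
Proof.
pose u (k : nat) (x : T) : \bar R := ((p%:R ^+ (2 * n * k))^-1 * \1_(pball k%:Z (0 : T)) x)%:E.
have u0 k x : (0 <= u k x)%E by rewrite lee_fin mulr_ge0 ?invr_ge0 ?exprn_ge0.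
apply: (@le_trans _ _ (\int[mu]_x \sum_(k <oo) u k x)%E).
  apply: ge0_le_integralT => x; first by rewrite lee_fin ltW // decay_gt0.
  have [k kx] := gauge_exp x; apply: le_trans (nneseries_term_le k (u0 ^~ x)).
  have xk : pball k%:Z 0 x by apply/gauge_le; rewrite kx.
  by rewrite /u indicE mem_set // mulr1 /decay kx -exprM mulnC.
rewrite integral_nneseries //; last first.
  move=> k; apply/measurable_EFinP/measurable_funM => //.
  by apply: measurable_indic; exact: measurable_pball.
apply: lime_le.
  by apply: is_cvg_nneseries => k _ _; apply: integral_ge0 => x _.
apply: nearW => m.
apply: (@le_trans _ _ (\sum_(0 <= k < m) ((2^-1 : R) ^+ k))%:E).
  rewrite -sumEFin.
  apply: lee_sum => k _; rewrite /u.
  under eq_integral do rewrite EFinM.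
  have mB := measurable_pball p_pr k%:Z (0 : T).
  rewrite ge0_integralZl_EFin ?invr_ge0 ?exprn_ge0 //; last first.
    by apply/measurable_EFinP; exact: measurable_indic.
  rewrite integral_indic // setIT haar_pball // -EFinM lee_fin.
  have P0 : 0 < (p%:R ^+ n : R) by rewrite exprn_gt0 // ltr0n prime_gt0.
  have P2 : 2 <= (p%:R ^+ n : R).
    rewrite -natrX ler_nat (leq_trans (prime_gt1 p_pr)) //.
    by rewrite -[leqLHS]expn1 leq_pexp2l // prime_gt0.
  have -> : p%:R ^+ (2 * n * k) = (p%:R ^+ n) ^+ k * (p%:R ^+ n) ^+ k :> R.
    by rewrite -!exprM -exprD; congr (_ ^+ _); lia.
  rewrite -exprnP; set P := _ ^+ n in P0 P2 *.
  have -> : (P ^+ k * P ^+ k)^-1 * P ^+ k = (P ^+ k)^-1.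
    by field; rewrite expf_neq0 // gt_eqF.
  rewrite exprVn lef_pV2 ?posrE ?(exprn_gt0 k P0) ?exprn_gt0 //.
  by rewrite lerXn2r // nnegrE ltW.
have -> : \sum_(0 <= k < m) (2^-1 : R) ^+ k = 2 - 2 * 2^-1 ^+ m.
  elim: m => [|m IH].
    by rewrite big_geq // expr0 mulr1 subrr.
  by rewrite big_nat_recr //= IH exprS; field.
by rewrite lee_fin gerBl mulr_ge0 // exprn_ge0 // invr_ge0.
Qed.

End Decay.

(** * Exchanging averages and variable powers *)

Section AveragedPower.
Context {R : realType} {p n : nat}.
Hypothesis p_pr : prime p.
Variable mu : {measure set (Qpn p n) -> \bar R}.
Hypothesis hmu : haar_measure mu.
Local Notation T := (Qpn p n).
Local Notation vol := (@vol R p n).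
Local Notation gauge := (@gauge R p n).
Local Notation decay := (@decay R p n).

Lemma ln_vol (g : int) : ln (vol g) = g%:~R * (n%:R * ln p%:R).
Proof.
rewrite /vol -powR_intmul ?exprn_ge0 // ln_powR lnXn ?ltr0n ?prime_gt0 //.
by rewrite mulr_natl.
Qed.

(** The log-Hoelder condition at infinity, in terms of the gauge. *)
Definition far_regular (t : T -> R) (K : R) : Prop :=
  forall x y, `|t x - t y| * ln (Num.min (gauge x) (gauge y)) <= K.

(** The log-Hoelder condition at small scales. The essential bounds of an
    exponent on a ball control its values only almost everywhere, hence the
    quantifier on y. *)
Definition near_regular_at (t : T -> R) (K : R) (x : T) : Prop :=
  forall g : int, \forall y \ae mu, pball g x y -> (- g)%:~R * `|t x - t y| <= K.

Variables (t F : T -> R) (tau K : R).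
Hypothesis mt : measurable_fun setT t.
Hypothesis mF : measurable_fun setT F.
Hypothesis F0 : forall x, 0 <= F x.
Hypothesis t1 : forall x, 1 <= t x <= tau.
Hypothesis K0 : 0 <= K.
Hypothesis t_far : far_regular t K.

Let Kball : R := tau * ln 3 + n%:R * ln p%:R * K.
Let Kdecay : R := (2 * n)%:R * K.

Definition power_const : R := expR Kball + expR Kdecay.

Let G y := F y `^ t y.

Let diff_le x y : `|t x - t y| <= tau.
Proof.
have /andP[x1 xt] := t1 x; have /andP[y1 yt] := t1 y.
by rewrite ler_norml; apply/andP; split; lra.
Qed.

Let pointwise_split (g : int) (x y : T) (L : R) :
  decay x <= L -> L <= 3 * Num.max 1 (vol g)^-1 ->
  (- g)%:~R * `|t x - t y| <= K ->
  forall lam, lam = L `^ (t x)^-1 ->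
  F y <= lam + decay y + power_const * lam `^ (1 - t x) * G y.
Proof.
move=> hL LV gK lam lamE; have L0 : 0 < L := lt_le_trans (decay_gt0 x) hL.
have lam0 : 0 < lam by rewrite lamE powR_gt0.
have /andP[x1 _] := t1 x; have /andP[y1 _] := t1 y.
have lamL : lam `^ t x = L.
  by rewrite lamE -powRrM mulVf ?powRr1 ?(ltW L0) // gt_eqF // (lt_le_trans ltr01).
have G0 : 0 <= G y by exact: powR_ge0.
have hy0 := decay_gt0 (R := R) y.
have Eb0 := expR_gt0 Kball; have Ed0 := expR_gt0 Kdecay.
have lx0 := powR_ge0 lam (1 - t x).
have [l1|l1] := leP 1 lam.
  apply: le_trans (crude_young (F0 y) lam0 y1) _.
  have ll : lam `^ (1 - t y) <= expR Kball * lam `^ (1 - t x).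
    apply: (@exponent_change_ge1 _ _ (3 * Num.max 1 (vol g)^-1)) => //.
      by apply: le_trans LV; rewrite -lamL le1r_powR.
    have m0 : 0 < Num.max 1 (vol g)^-1.
      by rewrite lt_max ltr01.
    rewrite lnM ?posrE // mulrDr /Kball lerD //.
      by rewrite ler_wpM2r ?diff_le // ln_ge0 // ler1n.
    rewrite maxEle; case: ifPn => [V1|_]; last first.
      by rewrite ln1 mulr0 !mulr_ge0 // ln_ge0 // ler1n prime_gt0.
    rewrite lnV ?posrE ?vol_gt0 // ln_vol.
    have -> : `|t x - t y| * - (g%:~R * (n%:R * ln p%:R)) =
       (n%:R * ln p%:R) * ((- g)%:~R * `|t x - t y|) :> R by rewrite mulrNz; ring.
    by rewrite ler_wpM2l // mulr_ge0 // ln_ge0 // ler1n prime_gt0.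
  have := ler_wpM2r G0 ll; rewrite -/(G y) /power_const => H.
  have H2 : 0 <= expR Kdecay * (lam `^ (1 - t x) * G y) by rewrite !mulr_ge0 // ltW.
  by rewrite !mulrDl -!mulrA in H *; lra.
have Lle : L <= lam by rewrite -{1}lamL ge1r_powR // lam0 ltW.
pose l := Num.max lam (decay y).
have l0 : 0 < l by rewrite lt_max lam0.
have l1' : l <= 1 by rewrite ge_max ltW //= decay_le1.
apply: le_trans (crude_young (F0 y) l0 y1) _.
have ll : l `^ (1 - t y) <= expR Kdecay * l `^ (1 - t x).
  pose N := Num.min (gauge x) (gauge y).
  have N1 : 1 <= N by rewrite le_min !gauge_ge1.
  apply: (@exponent_change_le1 _ _ (N ^+ (2 * n))) => //.
  - by rewrite exprn_ege1.
  - rewrite /l le_max /N minEle; case: ifP => _; apply/orP; [left|by right].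
    exact: le_trans hL Lle.
  - by rewrite lnXn ?(lt_le_trans ltr01) // -mulr_natl mulrCA /Kdecay ler_wpM2l // t_far.
have lx : l `^ (1 - t x) <= lam `^ (1 - t x).
  by apply: powR_le_neg; rewrite ?le_max ?lexx // subr_le0.
have := ler_wpM2r G0 (le_trans ll (ler_wpM2l (ltW Ed0) lx)).
rewrite -/(G y) /power_const => H.
have H2 : 0 <= expR Kball * (lam `^ (1 - t x) * G y) by rewrite !mulr_ge0 // ltW.
have H3 : l <= lam + decay y by rewrite ge_max lerDl lerDr !ltW.
by rewrite !mulrDl -!mulrA in H *; lra.
Qed.

(** Averaging commutes with the variable power up to a constant. With
    L = max(avg(G + decay), decay x) the right threshold at x is
    lam = L^(1/t(x)), and Young's inequality at height lam is applied at every
    y. Replacing t(y) by t(x) in lam^(1-t(y)) costs a bounded factor: if lam >= 1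
    then lam is at most 3 max(1, 1/V), with V the measure of the ball, and near
    regularity applies; if lam < 1 the height is first raised to max(lam, decay y), which is at least a
    power of min(gauge x, gauge y), and far regularity applies. *)
Lemma average_power_le (x : T) (g : int) : near_regular_at t K x ->
  (\int[mu]_(y in pball g x) (F y `^ t y)%:E <= (vol g + 1)%:E)%E ->
  (average mu F (pball g x) `^ t x <=
   (2 * (2 + power_const) `^ tau)%:E * maximal mu (fun y => G y + decay y)%R x)%E.
Proof.
move=> /(_ g) x_near IG; set V := vol g; have V0 : 0 < V by exact: vol_gt0.
pose B := pball g x; have mB : measurable B by exact: measurable_pball.
have mG : measurable_fun setT G by exact: measurable_powR_fun.
have mh := measurable_decay (R := R) (n := n) p_pr.
have G0 y : 0 <= G y by exact: powR_ge0.
have h0 y : 0 <= decay y by exact/ltW/decay_gt0.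
have /andP[x1 xt] := t1 x.
have [a aE [a0 aV]] : exists2 a : R, (\int[mu]_(y in B) (G y)%:E = a%:E)%E & 0 <= a /\ a <= V + 1.
  have I0 : (0 <= \int[mu]_(y in B) (G y)%:E)%E.
    by apply: integral_ge0 => y _; rewrite lee_fin.
  move: IG I0; rewrite -/B -/V; case: (\int[mu]_(y in B) _)%E => [r|//|//].
  by rewrite !lee_fin => rV r0; exists r.
have [c cE [c0 cV]] : exists2 c : R, (\int[mu]_(y in B) (decay y)%:E = c%:E)%E & 0 <= c /\ c <= V.
  have I0 : (0 <= \int[mu]_(y in B) (decay y)%:E)%E.
    by apply: integral_ge0 => y _; rewrite lee_fin.
  have : (\int[mu]_(y in B) (decay y)%:E <= V%:E)%E.
    rewrite -[leRHS]mul1e -(haar_pball_vol p_pr hmu g x) -integral_cst //.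
    apply: ge0_le_integral => //.
    - by move=> y _; rewrite lee_fin.
    - by apply/measurable_EFinP; exact: measurable_funTS.
    - by move=> y _; rewrite lee_fin decay_le1.
  move: I0; case: (\int[mu]_(y in B) _)%E => [r|//|//].
  by rewrite !lee_fin => r0 rV; exists r.
have avgE : average mu (fun y => G y + decay y) B = (V^-1 * (a + c))%:E.
  rewrite (averageE p_pr hmu) EFinM; congr (_ * _)%E.
  rewrite EFinD -aE -cE -ge0_integralD //; last 4 first.
  - by move=> y _; rewrite lee_fin.
  - by apply/measurable_EFinP; exact: measurable_funTS.
  - by move=> y _; rewrite lee_fin.
  - by apply/measurable_EFinP; exact: measurable_funTS.
  by apply: eq_integral => y _; rewrite ger0_norm // addr_ge0.
pose L := Num.max (V^-1 * (a + c)) (decay x).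
have hL : decay x <= L by rewrite le_max lexx orbT.
have L0 : 0 < L := lt_le_trans (decay_gt0 x) hL.
have LV : L <= 3 * Num.max 1 V^-1.
  have V1 : 1 <= Num.max 1 V^-1 by rewrite le_max lexx.
  have V2 : V^-1 <= Num.max 1 V^-1 by rewrite le_max lexx orbT.
  rewrite ge_max; apply/andP; split; last first.
    apply: (le_trans (decay_le1 x)); apply: (le_trans V1).
    by rewrite ler_peMl ?ler1n // (le_trans ler01).
  apply: (@le_trans _ _ (V^-1 * (V + 1 + V))).
    by rewrite ler_wpM2l ?invr_ge0 ?(ltW V0) // lerD.
  have -> : V^-1 * (V + 1 + V) = 2 + V^-1 by field; rewrite gt_eqF.
  have -> : 3 = 2 + 1 :> R by ring.
  by rewrite mulrDl mul1r; apply: lerD => //; rewrite ler_peMr.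
pose lam := L `^ (t x)^-1.
have lam0 : 0 < lam by exact: powR_gt0.
have lamL : lam `^ t x = L.
  by rewrite /lam -powRrM mulVf ?powRr1 ?(ltW L0) // gt_eqF // (lt_le_trans ltr01).
have D0 : 0 < power_const by rewrite addr_gt0 ?expR_gt0.
have Dl0 : 0 <= power_const * lam `^ (1 - t x) by rewrite mulr_ge0 ?(ltW D0) ?powR_ge0.
have avgF : (average mu F B <= ((2 + power_const) * lam)%:E)%E.
  have intF : (\int[mu]_(y in B) `|F y|%:E <=
      (lam * V + c + power_const * lam `^ (1 - t x) * a)%:E)%E.
    apply: (@le_trans _ _ (\int[mu]_(y in B)
        ((lam + decay y)%:E + (power_const * lam `^ (1 - t x))%:E * (G y)%:E))%E).
      apply: ae_ge0_le_integral => //.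
      - apply/measurable_EFinP/measurable_funTS; exact: measurableT_comp.
      - move=> y _; rewrite -EFinM -EFinD lee_fin.
        exact: addr_ge0 (addr_ge0 (ltW lam0) (h0 y)) (mulr_ge0 Dl0 (G0 y)).
      - apply: measurable_funTS; apply: emeasurable_funD.
          by apply/measurable_EFinP; exact: measurable_funD.
        by apply: measurable_funeM; exact/measurable_EFinP.
      - apply: filterS x_near => y xy By; rewrite -EFinM -EFinD lee_fin ger0_norm //.
        by apply: (pointwise_split hL LV (xy By) erefl).
    rewrite ge0_integralD //; last 4 first.
    - by move=> y _; rewrite lee_fin; exact: addr_ge0 (ltW lam0) (h0 y).
    - by apply/measurable_EFinP/measurable_funTS; exact: measurable_funD.
    - by move=> y _; rewrite -EFinM lee_fin; exact: mulr_ge0 Dl0 (G0 y).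
    - by apply: measurable_funTS; apply: measurable_funeM; exact/measurable_EFinP.
    rewrite ge0_integralZl_EFin //; last 2 first.
    - by move=> y _; rewrite lee_fin.
    - by apply/measurable_EFinP; exact: measurable_funTS.
    under eq_integral do rewrite EFinD.
    rewrite ge0_integralD //; last 3 first.
    - by move=> y _; rewrite lee_fin ltW.
    - by move=> y _; rewrite lee_fin.
    - by apply/measurable_EFinP; exact: measurable_funTS.
    by rewrite integral_cst // aE cE (haar_pball_vol p_pr hmu) -!EFinM -!EFinD.
  rewrite (averageE p_pr hmu); apply: le_trans (lee_wpmul2l _ intF) _.
    by rewrite lee_fin invr_ge0 ltW.
  rewrite -EFinM lee_fin -/V.
  have -> : V^-1 * (lam * V + c + power_const * lam `^ (1 - t x) * a) =
     lam + V^-1 * c + power_const * (lam `^ (1 - t x) * (V^-1 * a)).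
    by field; rewrite gt_eqF.
  have VL : V^-1 * a + V^-1 * c <= L by rewrite -mulrDr le_max lexx.
  have Va : 0 <= V^-1 * a by rewrite mulr_ge0 // invr_ge0 ltW.
  have Vc : 0 <= V^-1 * c by rewrite mulr_ge0 // invr_ge0 ltW.
  have VcL : V^-1 * c <= L by apply: le_trans VL; rewrite lerDr.
  have VaL : V^-1 * a <= L by apply: le_trans VL; rewrite lerDl.
  have cl : V^-1 * c <= lam.
    have [L1|L1] := leP L 1.
      apply: (le_trans VcL).
      rewrite /lam ger1_powR // ?L0 // invf_le1 //.
      exact: lt_le_trans ltr01 x1.
    apply: (@le_trans _ _ 1).
      by rewrite mulrC ler_pdivrMr // mul1r.
    have <- : 1 `^ (t x)^-1 = 1 :> R by rewrite powR1.
    by apply: powR_le => //; rewrite ?invr_ge0 ?(le_trans ler01 x1) // ltW.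
  have al : lam `^ (1 - t x) * (V^-1 * a) <= lam.
    apply: (@le_trans _ _ (lam `^ (1 - t x) * L)).
      by rewrite ler_wpM2l ?powR_ge0.
    rewrite -lamL -powRD ?subrK ?powRr1 ?(ltW lam0) //.
    by rewrite (lt0r_neq0 lam0) implybT.
  rewrite [leRHS](_ : _ = lam + lam + power_const * lam); last by ring.
  by apply: lerD; [apply: lerD|rewrite ler_wpM2l // ltW].
have M0 := maximal_ge0 p_pr hmu (fun y => G y + decay y) x.
apply: (@le_trans _ _ (((2 + power_const) `^ tau)%:E * L%:E)%E).
  apply: (@le_trans _ _ (((2 + power_const) * lam)%:E `^ t x)%E).
    apply: gt0_ler_poweR => //.
    - by rewrite (le_trans ler01).
    - by rewrite in_itv /= leey andbT; exact: average_ge0.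
    - by rewrite in_itv /= leey andbT lee_fin mulr_ge0 ?(ltW lam0) // addr_ge0 // ltW.
  rewrite poweR_EFin -EFinM lee_fin powRM ?(ltW lam0) ?addr_ge0 ?(ltW D0) //.
  rewrite lamL ler_wpM2r ?(ltW L0) // ler_powR // -[leLHS]addr0 lerD ?(ltW D0) //.
  by rewrite ler1n.
rewrite [in leRHS]mulrC EFinM -muleA lee_wpmul2l ?lee_fin ?powR_ge0 //.
have HM : (L%:E <= maximal mu (fun y => (G y + decay y)%R) x)%E.
  rewrite /L maxEle; case: ifP => _.
    have <- : average mu decay (pball 0 x) = (decay x)%:E.
      rewrite (averageE p_pr hmu) /vol expr0z invr1 mul1e.
      rewrite (eq_integral (cst (decay x)%:E)); last first.
        move=> y; rewrite inE => xy; rewrite ger0_norm //.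
        by rewrite (decay_unit_ball p_pr xy).
      by rewrite integral_cst ?(haar_pball_vol p_pr hmu) ?mule1 //; exact: measurable_pball.
    apply: le_trans (average_le_maximal _ _ 0 x).
    rewrite !(averageE p_pr hmu) lee_wpmul2l ?lee_fin ?invr_ge0 ?vol_ge0 //.
    apply: ge0_le_integral; first exact: measurable_pball.
    - by move=> y _; rewrite lee_fin.
    - by apply/measurable_EFinP/measurable_funTS; exact: measurableT_comp.
    - by apply/measurable_EFinP/measurable_funTS; apply: measurableT_comp => //; exact: measurable_funD.
    - by move=> y _; rewrite lee_fin !ger0_norm ?addr_ge0 // lerDr.
  by rewrite -avgE; exact: average_le_maximal.
apply: le_trans HM _.
by rewrite -[leLHS]mul1e lee_wpmul2r // lee_fin ler1n.
Qed.

End AveragedPower.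

(** * The maximal operator with a variable exponent *)

Lemma poweR_le {R : realType} (a b : \bar R) (r : R) :
  0 <= r -> (0 <= a)%E -> (a <= b)%E -> (a `^ r <= b `^ r)%E.
Proof.
move=> r0 a0 ab; apply: gt0_ler_poweR => //; rewrite in_itv /= leey andbT //.
exact: le_trans ab.
Qed.

Section MaximalModular.
Context {R : realType} {p n : nat}.
Hypothesis p_pr : prime p.
Hypothesis n_gt0 : (0 < n)%N.
Variable mu : {measure set (Qpn p n) -> \bar R}.
Hypothesis hmu : haar_measure mu.
Local Notation T := (Qpn p n).
Local Notation vol := (@vol R p n).
Local Notation decay := (@decay R p n).

Definition log_regular (s : T -> R) (K : R) : Prop :=
  far_regular s K /\ \forall x \ae mu, near_regular_at mu s K x.

Lemma log_regular_le (s t : T -> R) (K : R) : 0 <= K ->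
  (forall x y, `|t x - t y| <= `|s x - s y|) -> log_regular s K -> log_regular t K.
Proof.
move=> K0 ts [far near]; split=> [x y|].
  apply: le_trans (far x y); rewrite ler_wpM2r ?ts // ln_ge0 //.
  by rewrite le_min !gauge_ge1.
apply: filterS near => x nx g; have [g0|g0] := leP 0 g.
  apply: nearW => y _; apply: le_trans K0; rewrite mulr_le0_ge0 //.
  by rewrite lerz0 oppr_le0.
apply: filterS (nx g) => y H xy; apply: le_trans (H xy); rewrite ler_wpM2l ?ts //.
by rewrite ler0z oppr_ge0 ltW.
Qed.

Lemma maximal_power_le (t F : T -> R) (tau K : R) (x : T) :
  measurable_fun setT t -> measurable_fun setT F -> (forall y, 0 <= F y) ->
  (forall y, 1 <= t y <= tau) -> 0 <= K -> far_regular t K -> near_regular_at mu t K x ->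
  (forall g : int, \int[mu]_(y in pball g x) (F y `^ t y)%:E <= (vol g + 1)%:E)%E ->
  (maximal mu F x `^ t x <= (2 * (2 + power_const (p := p) (n := n) tau K) `^ tau)%:E *
     maximal mu (fun y => F y `^ t y + decay y)%R x)%E.
Proof.
move=> mt mF F0 t1 K0 far near IG; set C := (_ * _)%R.
have tx0 : 0 < t x by have /andP[tx _] := t1 x; exact: lt_le_trans ltr01 tx.
set Y := (C%:E * maximal mu (fun y => (F y `^ t y + decay y)%R) x)%E.
have Y0 : (0 <= Y)%E.
  rewrite mule_ge0 // ?lee_fin ?mulr_ge0 ?powR_ge0 //; exact: (maximal_ge0 p_pr hmu).
have MY : (maximal mu F x <= Y `^ (t x)^-1)%E.
  apply: ge_ereal_sup => _ [g _ <-].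
  have A0 := average_ge0 p_pr hmu F g x.
  have := average_power_le p_pr hmu mt mF F0 t1 K0 far near (IG g).
  rewrite -/C -/Y => /(poweR_le (r := (t x)^-1)).
  rewrite invr_ge0 (ltW tx0) poweR_ge0 => /(_ isT isT).
  by rewrite -poweRrM mulfV ?gt_eqF // poweRe1.
apply: le_trans (poweR_le (ltW tx0) (maximal_ge0 p_pr hmu F x) MY) _.
by rewrite -poweRrM mulVf ?gt_eqF // poweRe1.
Qed.

(** Boundedness of the maximal operator on the variable Lebesgue space, in
    modular form: with t = s / sigma, the variable power (M F)^t is dominated by
    the maximal function of F^t + decay, whose power sigma is integrable by the
    strong bound for a constant exponent. The majorant H, instead of (M F)^s
    itself, keeps all later comparisons with measurable functions. *)
Theorem maximal_modular (s : T -> R) (sigma S K : R) :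
  measurable_fun setT s -> 1 < sigma -> (forall x, sigma <= s x <= S) ->
  0 <= K -> log_regular s K ->
  exists2 C : R, 0 < C & forall F : T -> R, measurable_fun setT F ->
    (forall x, 0 <= F x) -> (\int[mu]_x (F x `^ s x)%:E <= 1)%E ->
    exists H : T -> \bar R, [/\ measurable_fun setT H, (forall x, 0 <= H x)%E,
      (\int[mu]_x H x <= C%:E)%E & \forall x \ae mu, (maximal mu F x `^ s x <= H x)%E].
Proof.
move=> ms sig1 sS K0 reg.
have sig0 : 0 < sigma := lt_trans ltr01 sig1.
pose t x := s x / sigma.
have mt : measurable_fun setT t by exact: measurable_funM.
have s1 x : 1 < s x by have /andP[sx _] := sS x; exact: lt_le_trans sx.
have t1 x : 1 <= t x <= S.
  have /andP[sx xS] := sS x; rewrite ler_pdivlMr // mul1r sx /=.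
  apply: le_trans xS; rewrite ler_pdivrMr // ler_peMr //; last exact: ltW.
  exact: ltW (lt_trans ltr01 (s1 x)).
have ts x : s x = t x * sigma by rewrite /t divfK // gt_eqF.
have tB x y : `|t x - t y| <= `|s x - s y|.
  rewrite /t -mulrBl normrM normfV (gtr0_norm sig0) ler_pdivrMr // ler_peMr //.
  exact: ltW.
have [t_far t_near] := log_regular_le K0 tB reg.
have [Cs Cs0 strong] := maximal_strong_type p_pr hmu sig1.
pose D := (2 * (2 + power_const (p := p) (n := n) S K) `^ S)%R : R.
have D0 : 0 < D.
  by rewrite mulr_gt0 // powR_gt0 // addr_gt0 // addr_gt0 // expR_gt0.
exists (D `^ sigma * (Cs * (2 `^ sigma * 3))).
  by rewrite !mulr_gt0 ?powR_gt0.
move=> F mF F0 IF.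
pose G y := F y `^ t y.
have G0 y : 0 <= G y by exact: powR_ge0.
have mG : measurable_fun setT G by exact: measurable_powR_fun.
have mh := measurable_decay (R := R) (n := n) p_pr.
have h0 y : 0 <= decay y by exact/ltW/decay_gt0.
have mFs : measurable_fun setT (fun x => F x `^ s x) by exact: measurable_powR_fun.
pose M := maximal mu (fun y => (G y + decay y)%R).
have mM : measurable_fun setT M by exact: (measurable_maximal p_pr).
have mMs : measurable_fun setT (fun x => (M x `^ sigma)%E).
  exact: (measurableT_comp (measurable_poweR sigma)).
exists (fun x => ((D `^ sigma)%:E * (M x `^ sigma))%E); split.
- exact: measurable_funeM.
- by move=> x; rewrite mule_ge0 ?poweR_ge0 // lee_fin powR_ge0.
- rewrite ge0_integralZl_EFin ?powR_ge0 //; last by move=> x _; exact: poweR_ge0.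
  rewrite EFinM lee_wpmul2l ?lee_fin ?powR_ge0 //.
  apply: le_trans (strong _ _) _; first exact: measurable_funD.
  rewrite EFinM lee_wpmul2l ?lee_fin ?(ltW Cs0) //.
  apply: (@le_trans _ _ (\int[mu]_x ((2 `^ sigma)%:E * ((F x `^ s x)%:E + (decay x)%:E)))%E).
    apply: ge0_le_integralT => x; first by rewrite lee_fin powR_ge0.
    rewrite -EFinD -EFinM lee_fin ger0_norm ?addr_ge0 //.
    apply: le_trans (powRD_le (G0 x) (h0 x) (ltW sig0)) _.
    rewrite ler_wpM2l ?powR_ge0 // lerD //; first by rewrite /G -powRrM -ts.
    by rewrite ge1r_powR ?decay_le1 ?decay_gt0 // ltW.
  rewrite ge0_integralZl_EFin ?powR_ge0 //; last 2 first.
  - by move=> x _; rewrite -EFinD lee_fin addr_ge0 ?powR_ge0.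
  - by apply: emeasurable_funD; exact/measurable_EFinP.
  rewrite EFinM lee_wpmul2l ?lee_fin ?powR_ge0 //.
  rewrite ge0_integralD //; last 4 first.
  - by move=> x _; rewrite lee_fin powR_ge0.
  - exact/measurable_EFinP.
  - by move=> x _; rewrite lee_fin.
  - exact/measurable_EFinP.
  have -> : 3%:E = (1 + 2%:E)%E :> \bar R by rewrite -EFinD; congr (_%:E); ring.
  by rewrite leeD // integral_decay.
apply: filterS t_near => x nx.
have IG g : (\int[mu]_(y in pball g x) (F y `^ t y)%:E <= (vol g + 1)%:E)%E.
  have mB := measurable_pball p_pr g x.
  apply: (@le_trans _ _ (\int[mu]_(y in pball g x) (cst 1%E y + (F y `^ s y)%:E))%E).
    apply: ge0_le_integral => //.
    - by move=> y _; rewrite lee_fin powR_ge0.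
    - by apply/measurable_EFinP; exact: measurable_funTS.
    - by apply: measurable_funTS; apply: emeasurable_funD => //; exact/measurable_EFinP.
    move=> y _; rewrite -EFinD lee_fin.
    have /andP[t1y _] := t1 y.
    have ty : t y <= s y by rewrite ts ler_peMr ?(le_trans ler01 t1y) // ltW.
    have [Fy|Fy] := leP (F y) 1.
      apply: (@le_trans _ _ 1); last by rewrite lerDl powR_ge0.
      rewrite -[leRHS](_ : 1 `^ t y = 1); last by rewrite powR1.
      by apply: powR_le => //; exact: le_trans t1y.
    by apply: (@le_trans _ _ (F y `^ s y)); [rewrite ler_powR // ltW|rewrite lerDr].
  rewrite ge0_integralD //; last 2 first.
  - by move=> y _; rewrite lee_fin powR_ge0.
  - by apply/measurable_EFinP; exact: measurable_funTS.
  rewrite integral_cst // mul1e (haar_pball_vol p_pr hmu) EFinD leeD //.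
  apply: le_trans IF; apply: ge0_subset_integral => //.
  - exact/measurable_EFinP.
  - by move=> y _; rewrite lee_fin powR_ge0.
rewrite ts poweRrM.
have := maximal_power_le mt mF F0 t1 K0 t_far nx IG; rewrite -/D -/G => H.
apply: le_trans (poweR_le (ltW sig0) (poweR_ge0 _ _) H) _.
by rewrite poweRM ?lee_fin ?(ltW D0) ?maximal_ge0 // poweR_EFin.
Qed.

End MaximalModular.

(** * Log-Hoelder continuous exponents *)

Section LogHolder.
Context {R : realType} {p n : nat}.
Hypothesis p_pr : prime p.
Variable mu : {measure set (Qpn p n) -> \bar R}.
Hypothesis hmu : haar_measure mu.
Local Notation T := (Qpn p n).
Local Notation gauge := (@gauge R p n).

Lemma ess_inf_on_le (B : set T) (q : T -> R) :
  \forall x \ae mu, B x -> (ess_inf_on mu B q <= (q x)%:E)%E.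
Proof.
pose q' x : \bar R := if `[< B x >] then (q x)%:E else +oo%E.
have -> : ess_inf_on mu B q = ess_inf mu q'.
  congr (ereal_sup _); apply/seteqP; split=> y; apply: filterS => x; rewrite /q'.
    by move=> H; case: asboolP => [/H|_] //; rewrite leey.
  by move=> + Bx; rewrite asboolT.
by apply: filterS (ess_inf_le mu q') => x + Bx; rewrite /q' asboolT.
Qed.

Lemma ess_sup_on_ge (B : set T) (q : T -> R) :
  \forall x \ae mu, B x -> ((q x)%:E <= ess_sup_on mu B q)%E.
Proof.
pose q' x : \bar R := if `[< B x >] then (q x)%:E else -oo%E.
have -> : ess_sup_on mu B q = ess_sup mu q'.
  congr (ereal_inf _); apply/seteqP; split=> y; apply: filterS => x; rewrite /q'.
    by move=> H; case: asboolP => [/H|_] //; rewrite leNye.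
  by move=> + Bx; rewrite asboolT.
by apply: filterS (ess_sup_ge mu q') => x + Bx; rewrite /q' asboolT.
Qed.

(** A property of almost every point of each ball holds, at almost every point
    x, for all balls around x: there are countably many balls. *)
Lemma ae_all_balls (P : set T -> T -> Prop) :
  (forall g a, \forall x \ae mu, pball g a x -> P (pball g a) x) ->
  \forall x \ae mu, forall g : int, P (pball g x) x.
Proof.
move=> aeP.
pose Q m x := if (unpickle m : option (int * nat)) is Some gi
  then pball gi.1 (pcenter p n gi.2) x -> P (pball gi.1 (pcenter p n gi.2)) x else True.
have : \forall x \ae mu, forall m, Q m x.
  apply/ae_foralln => m; rewrite /Q; case: unpickle => [[g i]|]; first exact: aeP.
  exact: nearW.
apply: filterS => x Qx g; have [i ix] := pcenter_dense p_pr g x.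
have := Qx (pickle (g, i)); rewrite /Q pickleK /= => /(_ ix).
by rewrite (pball_eq p_pr ix).
Qed.

Lemma exponent_bounds (q : T -> R) : exponent mu q ->
  exists sigma S : R, 1 < sigma /\ forall x, sigma <= q x <= S.
Proof.
move=> [_ q1 qB qoo]; move: q1 qB qoo.
case: (ess_inf mu _) => [s| |]; last by [].
  case: (ess_sup mu _) => [S| |] //.
    by rewrite lte_fin => s1 qB _; exists s, S; split=> // x; have := qB x; rewrite !lee_fin.
  by move=> _ /(_ 0); rewrite leeNy_eq andbF.
by move=> _ /(_ 0); rewrite leye_eq.
Qed.

(** By countability of the balls, almost every x has q(x) between the essential
    bounds of every ball around it; comparing it with almost every y of the ball
    gives the local condition. *)
Lemma log_holder_regular (q : T -> R) : log_holder mu q ->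
  exists2 K : R, 0 <= K & log_regular mu q K.
Proof.
move=> [eq_ [C [C0 near far]]].
have [s [S [s1 qB]]] := exponent_bounds eq_.
have p1 : 1 < p%:R :> R by rewrite ltr1n prime_gt1.
have lnp0 : 0 < ln (p%:R : R) by rewrite ln_gt0.
exists (C * ln p%:R + C); first by rewrite addr_ge0 ?mulr_ge0 // ltW.
split=> [x y|].
  set N := Num.min _ _; set r : R := ratr (Num.min (padic_norm x) (padic_norm y)).
  have r0 : 0 <= r by rewrite ler0q le_min !padic_norm_ge0.
  have pr1 : 1 < p%:R + r by rewrite ltr_wpDr.
  have N0 : 0 < N by rewrite lt_min !gauge_gt0.
  have Nle : N <= p%:R + r.
    have aux z : gauge z <= p%:R + ratr (padic_norm z).
      have z0 : 0 <= ratr (padic_norm z) :> R by rewrite ler0q padic_norm_ge0.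
      by rewrite ge_max lerDr ler0n andbT (le_trans (ltW p1)) // lerDl.
    rewrite /r minEle; case: ifP => _.
      by apply: le_trans (aux x); rewrite ge_min lexx.
    by apply: le_trans (aux y); rewrite ge_min lexx orbT.
  apply: (@le_trans _ _ (`|q x - q y| * ln (p%:R + r))).
    by rewrite ler_wpM2l // ler_ln ?posrE // (lt_trans ltr01).
  have lpr : 0 < ln (p%:R + r) by rewrite ln_gt0.
  rewrite -ler_pdivlMr //; apply: le_trans (far x y) _.
  rewrite -/r invf_div mulrA ler_wpM2r ?invr_ge0 ?(ltW lpr) //.
  by rewrite lerDl ltW.
have ae1 : \forall x \ae mu, forall g : int,
    (ess_inf_on mu (pball g x) q <= (q x)%:E <= ess_sup_on mu (pball g x) q)%E.
  apply: (@ae_all_balls (fun B x => (ess_inf_on mu B q <= (q x)%:E <= ess_sup_on mu B q)%E)) => g a.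
  by apply: filterS2 (ess_inf_on_le (pball g a) q) (ess_sup_on_ge (pball g a) q) => x H1 H2 Bx; rewrite H1 ?H2.
apply: filterS ae1 => x x1 g.
apply: filterS2 (ess_inf_on_le (pball g x) q) (ess_sup_on_ge (pball g x) q) => y y1 y2 xy.
have [g0|g0] := leP 0 g.
  apply: (@le_trans _ _ 0); last by rewrite addr_ge0 ?mulr_ge0 // ltW.
  by rewrite mulr_le0_ge0 // lerz0 oppr_le0.
have := near g x; have /andP[] := x1 g; have := y1 xy; have := y2 xy.
have : (s%:E <= ess_inf_on mu (pball g x) q)%E.
  apply: ereal_sup_ubound; apply: nearW => z _ /=.
  by rewrite lee_fin; have /andP[] := qB z.
have : (ess_sup_on mu (pball g x) q <= S%:E)%E.
  apply: ereal_inf_lbound; apply: nearW => z _ /=.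
  by rewrite lee_fin; have /andP[] := qB z.
case: (ess_inf_on _ _ _) => [i| |//]; last by rewrite leye_eq.
case: (ess_sup_on _ _ _) => [u|//|]; last by rewrite !leeNy_eq.
rewrite -EFinB -EFinM !lee_fin => _ _ yu iy ix xu gC.
apply: (@le_trans _ _ C); last by rewrite lerDr mulr_ge0 // ltW.
apply: le_trans gC.
have -> : g%:~R * (i - u) = (- g)%:~R * (u - i) :> R by rewrite mulrNz; ring.
rewrite ler_wpM2l ?ler0z ?oppr_ge0 ?(ltW g0) // ler_norml.
by apply/andP; split; [rewrite opprB|]; apply: lerB.
Qed.

End LogHolder.

(** * Norms of variable Lebesgue spaces *)

(** As r/q + th r = 1, the left side is (u^q)^(r/q) v^(th r), a weighted geometric
    mean of u^q and v, hence at most the larger of the two. *)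
Lemma young_conjugate {R : realType} (u v r q th : R) : 0 < u -> 0 < v -> 0 < r -> 0 < q ->
  q^-1 = r^-1 - th -> 0 < th -> (u * v `^ th) `^ r <= u `^ q + v.
Proof.
move=> u0 v0 r0 q0 qr th0; have thE : th = r^-1 - q^-1 by rewrite qr opprB addrC subrK.
rewrite powRM ?powR_ge0 ?(ltW u0) // -powRrM.
have [vu|uv] := leP v (u `^ q).
  apply: (@le_trans _ _ (u `^ q)); last by rewrite lerDl ltW.
  apply: (@le_trans _ _ (u `^ r * (u `^ q) `^ (th * r))).
    by rewrite ler_wpM2l ?powR_ge0 // powR_le ?mulr_ge0 // ltW.
  rewrite -powRrM -powRD ?(lt0r_neq0 u0) ?implybT //.
  rewrite le_eqVlt; apply/orP; left; apply/eqP; congr (_ `^ _).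
  by rewrite thE; field; rewrite !gt_eqF.
apply: (@le_trans _ _ v); last by rewrite lerDr powR_ge0.
have uE : u `^ r = (u `^ q) `^ (r / q) by rewrite -powRrM mulrC divfK ?gt_eqF.
apply: (@le_trans _ _ (v `^ (r / q) * v `^ (th * r))).
  by rewrite uE ler_wpM2r ?powR_ge0 // powR_le ?powR_ge0 ?divr_ge0 // ltW.
rewrite -powRD ?(lt0r_neq0 v0) ?implybT // (_ : r / q + th * r = 1) ?powRr1 // ?ltW //.
by rewrite thE; field; rewrite !gt_eqF.
Qed.

Section VarNorm.
Context {R : realType} {p n : nat}.
Hypothesis p_pr : prime p.
Variable mu : {measure set (Qpn p n) -> \bar R}.
Hypothesis hmu : haar_measure mu.
Local Notation T := (Qpn p n).
Local Notation vol := (@vol R p n).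

Lemma modular_real (q f : T -> R) (eta : R) : 0 < eta ->
  modular mu q (EFin \o f) eta = (\int[mu]_x ((`|f x| / eta) `^ q x)%:E)%E.
Proof.
move=> eta0; apply: eq_integral => x _ /=.
by rewrite inver gt_eqF // -EFinM poweR_EFin.
Qed.

Lemma var_norm_le (q : T -> R) (f : T -> \bar R) (eta : R) :
  0 < eta -> (modular mu q f eta <= 1)%E -> (var_norm mu q f <= eta%:E)%E.
Proof. by move=> eta0 m1; apply: ereal_inf_lbound; exists eta. Qed.

Lemma var_norm_ge (q : T -> R) (f : T -> \bar R) (y : \bar R) :
  (forall eta, 0 < eta -> (modular mu q f eta <= 1)%E -> (y <= eta%:E)%E) ->
  (y <= var_norm mu q f)%E.
Proof. by move=> H; apply: le_ereal_inf_tmp => _ [eta [eta0 m1] <-]; exact: H. Qed.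

Lemma le_mul_var_norm (q : T -> R) (f : T -> \bar R) (y : \bar R) (c : R) : 0 < c ->
  (forall eta, 0 < eta -> (modular mu q f eta <= 1)%E -> (y <= (c * eta)%:E)%E) ->
  (y <= c%:E * var_norm mu q f)%E.
Proof.
move=> c0 H; rewrite -lee_pdivrMl //; apply: var_norm_ge => eta eta0 m1.
by rewrite lee_pdivrMl // -EFinM; exact: H.
Qed.

Lemma var_norm_ge0 (q : T -> R) (f : T -> \bar R) : (0 <= var_norm mu q f)%E.
Proof. by apply: var_norm_ge => eta eta0 _; rewrite lee_fin ltW. Qed.

Lemma le_var_norm (q : T -> R) (f g : T -> \bar R) : (forall x, 0 <= q x) ->
  (forall x, `|f x| <= `|g x|)%E -> (var_norm mu q f <= var_norm mu q g)%E.
Proof.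
move=> q0 fg; apply: var_norm_ge => eta eta0 m1; apply: var_norm_le => //.
apply: le_trans m1; apply: ge0_le_integralT => x; first exact: poweR_ge0.
have e0 : (0 <= eta%:E^-1)%E by rewrite inve_ge0 lee_fin ltW.
by apply: poweR_le => //; [rewrite mule_ge0|rewrite lee_wpmul2r].
Qed.

Lemma ae_le_var_norm (q g : T -> R) (f : T -> \bar R) (c : R) : 0 < c ->
  measurable_fun setT q -> measurable_fun setT g -> (forall x, 0 <= q x) ->
  (\forall x \ae mu, `|f x| <= (c * `|g x|)%:E)%E ->
  (var_norm mu q f <= c%:E * var_norm mu q (EFin \o g))%E.
Proof.
move=> c0 mq mg q0 fg; apply: le_mul_var_norm => // eta eta0 m1.
have ce0 : 0 < c * eta by exact: mulr_gt0.
apply: var_norm_le => //; apply: le_trans m1; rewrite modular_real //.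
apply: ae_le_integralT.
- by move=> x; exact: poweR_ge0.
- by move=> x; rewrite lee_fin powR_ge0.
- apply/measurable_EFinP; apply: measurable_powR_fun => //; apply: measurable_funM => //.
  exact: measurableT_comp.
apply: filterS fg => x fgx; rewrite -poweR_EFin inver gt_eqF //.
apply: poweR_le => //; first by rewrite mule_ge0 // lee_fin invr_ge0 ltW.
apply: le_trans (lee_wpmul2r _ fgx) _; first by rewrite lee_fin invr_ge0 ltW.
rewrite -EFinM lee_fin le_eqVlt; apply/orP; left; apply/eqP; field.
by rewrite !gt_eqF.
Qed.

Lemma measurable_indic_pball g a : measurable_fun setT (\1_(pball g a) : T -> R).
Proof. by apply: measurable_indic; exact: measurable_pball. Qed.

Lemma modular_indic (q : T -> R) g a (eta : R) : (forall x, 0 < q x) -> 0 < eta ->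
  modular mu q (EFin \o (\1_(pball g a) : T -> R)) eta =
  (\int[mu]_(x in pball g a) ((eta^-1) `^ q x)%:E)%E.
Proof.
move=> q0 eta0; rewrite (modular_real _ _ eta0) [RHS]integral_mkcond.
apply: eq_integral => x _; rewrite patchE indicE; case: ifPn => _.
  by rewrite normr1 div1r.
by rewrite normr0 mul0r powR0 // gt_eqF.
Qed.

(** For eta below min(1, V) the modular exceeds 1, and at eta = max(1, V) it is
    at most 1, V being the measure of the ball. *)
Lemma var_norm_indic_ball (q : T -> R) g a : measurable_fun setT q -> (forall x, 1 <= q x) ->
  exists2 N : R, 0 < N & var_norm mu q (EFin \o (\1_(pball g a) : T -> R)) = N%:E.
Proof.
move=> mq q1; have q0 x : 0 < q x := lt_le_trans ltr01 (q1 x).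
set B := pball g a; have mB : measurable B by exact: measurable_pball.
have V0 := vol_gt0 (R := R) (n := n) p_pr g.
have mc (c : R) : measurable_fun B (fun x => (c `^ q x)%:E).
  by apply/measurable_EFinP/measurable_funTS; apply: measurable_powR_fun.
have lb : ((Num.min 1 (vol g))%:E <= var_norm mu q (EFin \o (\1_B : T -> R)))%E.
  apply: var_norm_ge => eta eta0; rewrite (modular_indic _ _ q0 eta0) => m1; rewrite lee_fin ge_min.
  have [//|eta1 /=] := leP 1 eta.
  rewrite -lee_fin -(@lee_pmul2l _ eta^-1%:E) ?lte_fin ?invr_gt0 // -[leRHS]EFinM mulVf ?gt_eqF //.
  apply: le_trans m1; rewrite -(haar_pball_vol p_pr hmu g a) -integral_cst //.
  apply: ge0_le_integral => //.
  - by move=> x _; rewrite /= lee_fin invr_ge0 ltW.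
  - by move=> x _; rewrite lee_fin le1r_powR // invf_ge1 // ltW.
have ub : (var_norm mu q (EFin \o (\1_B : T -> R)) <= (Num.max 1 (vol g))%:E)%E.
  have m0 : 0 < Num.max 1 (vol g) by rewrite lt_max ltr01.
  apply: (var_norm_le m0); rewrite (modular_indic _ _ q0 m0).
  apply: (@le_trans _ _ (\int[mu]_(x in B) cst ((Num.max 1 (vol g))^-1)%:E x)%E).
    apply: ge0_le_integral => //.
    - by move=> x _; rewrite lee_fin powR_ge0.
    - by move=> x _; rewrite lee_fin ge1r_powR // invr_gt0 m0 invf_le1 // le_max lexx.
  rewrite integral_cst // (haar_pball_vol p_pr hmu) -EFinM lee_fin.
  by rewrite mulrC ler_pdivrMr // mul1r le_max lexx orbT.
move: lb ub; case: (var_norm _ _ _) => [N|//|//]; rewrite !lee_fin => lb _.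
by exists N => //; apply: lt_le_trans lb; rewrite lt_min ltr01.
Qed.

(** Hoelder's inequality for the characteristic function of a ball, with the
    constant exponent 1/th for the second factor, the same characteristic
    function. Young's inequality is applied pointwise to 1/eta and 1/V. *)
Lemma var_norm_indic_holder (r q : T -> R) (th : R) g a :
  measurable_fun setT r -> measurable_fun setT q ->
  (forall x, 1 <= r x) -> (forall x, 1 <= q x) -> 0 < th ->
  (forall x, (q x)^-1 = (r x)^-1 - th) ->
  (var_norm mu r (EFin \o (\1_(pball g a) : T -> R)) <=
   (2 * vol g `^ th)%:E * var_norm mu q (EFin \o (\1_(pball g a) : T -> R)))%E.
Proof.
move=> mr mq r1 q1 th0 qr; have V0 := vol_gt0 (R := R) (n := n) p_pr g.
have r0 x : 0 < r x := lt_le_trans ltr01 (r1 x).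
have q0 x : 0 < q x := lt_le_trans ltr01 (q1 x).
have Vt0 : 0 < vol g `^ th by exact: powR_gt0.
apply: le_mul_var_norm; first exact: mulr_gt0.
move=> eta eta0; rewrite (modular_indic _ _ q0 eta0) => m1.
have e0 : 0 < 2 * vol g `^ th * eta by rewrite !mulr_gt0.
apply: (var_norm_le e0); rewrite (modular_indic _ _ r0 e0).
set B := pball g a in m1 *; have mB : measurable B by exact: measurable_pball.
have mE (e : R) : measurable_fun B (fun x => (e `^ q x)%:E).
  by apply/measurable_EFinP/measurable_funTS; apply: measurable_powR_fun.
apply: (@le_trans _ _ (\int[mu]_(x in B) (2^-1%:E * ((eta^-1 `^ q x)%:E + cst (vol g)^-1%:E x)))%E).
  apply: ge0_le_integral => //.
  - by move=> x _; rewrite lee_fin powR_ge0.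
  - by apply/measurable_EFinP/measurable_funTS; apply: measurable_powR_fun.
  - by apply: measurable_funeM; apply: emeasurable_funD.
  move=> x _; rewrite -EFinD -EFinM lee_fin.
  have rx := r0 x; have qx := q0 x.
  rewrite !invfM -mulrA powRM ?mulr_ge0 ?invr_ge0 ?(ltW Vt0) ?(ltW eta0) //.
  apply: ler_pM; rewrite ?powR_ge0 //.
    by rewrite ge1r_powR // invr_gt0 ltr0n invf_le1 // ler1n.
  have -> : (vol g `^ th)^-1 = (vol g)^-1 `^ th by rewrite -powRN -powR_inv1 ?(ltW V0) // -powRrM mulN1r.
  by rewrite mulrC; apply: young_conjugate (qr x) th0; rewrite ?invr_gt0.
rewrite ge0_integralZl_EFin //; last 2 first.
- by move=> x _; rewrite -EFinD lee_fin addr_ge0 ?powR_ge0 // invr_ge0 ltW.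
- by apply: emeasurable_funD.
rewrite ge0_integralD //; last 2 first.
- by move=> x _; rewrite lee_fin powR_ge0.
- by move=> x _; rewrite lee_fin invr_ge0 ltW.
rewrite integral_cst // (haar_pball_vol p_pr hmu) -EFinM mulVf ?gt_eqF //.
apply: (@le_trans _ _ (2^-1%:E * (1 + 1))%E).
  by rewrite lee_wpmul2l ?lee_fin ?invr_ge0 // leeD.
by rewrite -EFinD -EFinM mulVf // pnatr_eq0.
Qed.

End VarNorm.

(** * Fractional averages *)

(** A weighted mean inequality with a free parameter; v <= k u decides which term
    dominates. With k at the balance point it yields Hoelder's inequality after
    integration. *)
Lemma weighted_split {R : realType} (u v k th : R) : 0 <= u -> 0 <= v -> 0 < k ->
  0 <= th -> th <= 1 -> u `^ (1 - th) * v `^ th <= k `^ th * u + k `^ (th - 1) * v.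
Proof.
move=> u0 v0 k0 th0 th1; have [vu|uv] := leP v (k * u).
  apply: (@le_trans _ _ (k `^ th * u)); last by rewrite lerDl mulr_ge0 // powR_ge0.
  apply: (@le_trans _ _ (u `^ (1 - th) * (k * u) `^ th)).
    by rewrite ler_wpM2l ?powR_ge0 // powR_le.
  rewrite powRM ?(ltW k0) // mulrCA ler_wpM2l ?powR_ge0 //.
  by rewrite -powRD ?subrK ?powRr1 // oner_eq0.
apply: (@le_trans _ _ (k `^ (th - 1) * v)); last by rewrite lerDr mulr_ge0 // powR_ge0.
apply: (@le_trans _ _ ((k^-1 * v) `^ (1 - th) * v `^ th)).
  rewrite ler_wpM2r ?powR_ge0 // powR_le ?subr_ge0 //.
  by rewrite mulrC ler_pdivlMr // mulrC ltW.
rewrite powRM ?invr_ge0 ?(ltW k0) // -mulrA -powRD ?subrK ?oner_eq0 // powRr1 //.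
by rewrite -powR_inv1 ?(ltW k0) // -powRrM mulN1r opprB.
Qed.

Section Consequences.
Context {R : realType} {p n : nat}.
Hypothesis p_pr : prime p.
Variable mu : {measure set (Qpn p n) -> \bar R}.
Hypothesis hmu : haar_measure mu.
Local Notation T := (Qpn p n).
Local Notation vol := (@vol R p n).

(** In particular, maximal functions of elements of a variable Lebesgue space are
    finite almost everywhere. *)
Lemma ae_finite_of_majorant (M : T -> \bar R) (s : T -> R) (H : T -> \bar R) (C : R) :
  (forall x, s x != 0) -> measurable_fun setT H -> (forall x, 0 <= H x)%E ->
  (\int[mu]_x H x <= C%:E)%E -> (\forall x \ae mu, (M x `^ s x <= H x)%E) ->
  \forall x \ae mu, (M x < +oo)%E.
Proof.
move=> s0 mH H0 HC MH.
have iH : mu.-integrable setT H.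
  apply/integrableP; split=> //; apply: le_lt_trans (ltry C).
  by under eq_integral do rewrite gee0_abs //.
have : \forall x \ae mu, setT x -> H x \is a fin_num by exact: integrable_ae iH.
apply: filterS2 MH => x MHx /(_ Logic.I) Hx; apply: (lty_poweRy (s0 x)).
by apply: le_lt_trans MHx _; rewrite ltey_eq Hx.
Qed.

Lemma average_scale (f : T -> R) (c : R) g x : measurable_fun setT f -> 0 <= c ->
  average mu (fun y => c * f y)%R (pball g x) = (c%:E * average mu f (pball g x))%E.
Proof.
move=> mf c0; rewrite !(averageE p_pr hmu) muleCA; congr (_ * _)%E.
have mB := measurable_pball p_pr g x.
under eq_integral do rewrite normrM (ger0_norm c0) EFinM.
rewrite ge0_integralZl_EFin //.
by apply/measurable_EFinP/measurable_funTS; exact: measurableT_comp.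
Qed.

Lemma maximal_scale_le (f : T -> R) (c : R) x : measurable_fun setT f -> 0 <= c ->
  (maximal mu (fun y => c * f y)%R x <= c%:E * maximal mu f x)%E.
Proof.
move=> mf c0; apply: ge_ereal_sup => _ [g _ <-]; rewrite average_scale //.
by rewrite lee_wpmul2l ?lee_fin //; exact: average_le_maximal.
Qed.

(** Hedberg's idea with variable exponents: since r/q + r th = 1, the function
    factors as F = (F^(r/(q(1-th))))^(1-th) (F^r)^th with constant outer
    exponents, so that Hoelder's inequality on the ball reduces the fractional
    average to an ordinary one. *)
Lemma fractional_average_le (r q F : T -> R) (th : R) g x :
  0 < th < 1 -> measurable_fun setT r -> measurable_fun setT q ->
  measurable_fun setT F ->
  (forall y, 0 <= F y) -> (forall y, 0 < r y) -> (forall y, 0 < q y) ->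
  (forall y, (q y)^-1 = (r y)^-1 - th) ->
  (\int[mu]_y (F y `^ r y)%:E <= 1)%E ->
  ((vol g `^ th)%:E * average mu F (pball g x) <=
   2%:E * (average mu (fun y => (F y `^ (r y / (q y * (1 - th))))%R) (pball g x)) `^ (1 - th))%E.
Proof.
move=> /andP[th0 th1] mr mq mF F0 r0 q0 qr IF.
set B := pball g x; have mB : measurable B by exact: measurable_pball.
have V0 := vol_gt0 (R := R) (n := n) p_pr g.
have th10 : 0 < 1 - th by rewrite subr_gt0.
pose E y := F y `^ (r y / (q y * (1 - th))).
have E0 y : 0 <= E y by exact: powR_ge0.
have mE : measurable_fun setT E.
  apply: measurable_powR_fun => //; rewrite /=.
  have -> : (fun y => r y / (q y * (1 - th))) = (fun y => (1 - r y * th) / (1 - th)).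
    apply/funext => y; have -> : 1 - r y * th = r y / q y.
      by rewrite qr mulrBr mulfV // gt_eqF.
    by field; rewrite !gt_eqF.
  apply: measurable_funM => //; apply: measurable_funB => //.
  exact: measurable_funM.
have mFr : measurable_fun setT (fun y => F y `^ r y) by exact: measurable_powR_fun.
have alE y : r y / (q y * (1 - th)) * (1 - th) = 1 - r y * th.
  have -> : 1 - r y * th = r y / q y by rewrite qr mulrBr mulfV // gt_eqF.
  by field; rewrite !gt_eqF.
have fact y : F y = E y `^ (1 - th) * (F y `^ r y) `^ th.
  rewrite /E -!powRrM alE -powRD subrK ?powRr1 ?oner_eq0 //.
(* The average of E being a, the optimal k is 1/(a V) if a > 0; if a = 0, a large
   k makes the bound arbitrarily small. *)
have avgF k : 0 < k -> forall a, average mu E B = a%:E ->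
    (average mu F B <= (k `^ th * a + k `^ (th - 1) / vol g)%:E)%E.
  move=> k0 a; rewrite !(averageE p_pr hmu) => aE.
  have IE : (\int[mu]_(y in B) (E y)%:E = (vol g * a)%:E)%E.
    rewrite EFinM -aE muleA -EFinM mulfV ?gt_eqF // mul1e.
    by apply: eq_integral => y _; rewrite ger0_norm.
  have mEF (f : T -> R) : measurable_fun setT f -> measurable_fun B (EFin \o f).
    by move=> mf; apply/measurable_EFinP/measurable_funTS.
  have IFB : (\int[mu]_(y in B) `|F y|%:E <=
      (k `^ th)%:E * (vol g * a)%:E + (k `^ (th - 1))%:E * 1)%E.
    apply: (@le_trans _ _ (\int[mu]_(y in B)
        ((k `^ th)%:E * (E y)%:E + (k `^ (th - 1))%:E * (F y `^ r y)%:E))%E).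
      apply: ge0_le_integral => //.
      - by apply: mEF; exact: measurableT_comp.
      - by apply: emeasurable_funD; apply: measurable_funeM; exact: mEF.
      move=> y _; rewrite -!EFinM -EFinD lee_fin ger0_norm // {1}fact.
      by apply: weighted_split => //; rewrite ?powR_ge0 // ltW.
    rewrite ge0_integralD //; last 4 first.
    - by move=> y _; rewrite -EFinM lee_fin mulr_ge0 ?powR_ge0.
    - by apply: measurable_funeM; exact: mEF.
    - by move=> y _; rewrite -EFinM lee_fin mulr_ge0 ?powR_ge0.
    - by apply: measurable_funeM; exact: mEF.
    have mEE := mEF _ mE; have mFF := mEF _ mFr.
    rewrite !ge0_integralZl_EFin ?powR_ge0 //; last 2 first.
    - by move=> y _; rewrite lee_fin powR_ge0.
    - by move=> y _; rewrite lee_fin powR_ge0.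
    rewrite IE leeD // lee_wpmul2l ?lee_fin ?powR_ge0 //.
    apply: le_trans IF; apply: ge0_subset_integral => //; first exact/measurable_EFinP.
    by move=> y _; rewrite lee_fin powR_ge0.
  apply: le_trans (lee_wpmul2l _ IFB) _; first by rewrite lee_fin invr_ge0 ltW.
  rewrite mule1 le_eqVlt; apply/orP; left; apply/eqP; congr (_%:E).
  by field; rewrite gt_eqF.
have Vt0 : 0 < vol g `^ th by exact: powR_gt0.
case aE : (average mu E B) => [a| |]; last first.
- by have := average_ge0 p_pr hmu E g x; rewrite -/B aE leeNy_eq.
- by rewrite (eqy_poweR th10) // gt0_muley ?lte_fin // leey.
have a0 : 0 <= a by rewrite -lee_fin -aE; exact: average_ge0.
rewrite poweR_EFin -EFinM; have [a_gt0|] := ltP 0 a; last first.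
  move=> a_le0; have {}a0 : a = 0 by apply/eqP; rewrite eq_le a_le0 a0.
  rewrite a0 powR0 ?gt_eqF // mulr0; apply/lee_addgt0Pr => e e0; rewrite add0e.
  pose k := (e / vol g `^ th * vol g) `^ ((th - 1)^-1).
  have ev0 : 0 < e / vol g `^ th * vol g by rewrite mulr_gt0 // divr_gt0.
  have k0 : 0 < k by exact: powR_gt0.
  have := avgF k k0 _ aE; rewrite a0 mulr0 add0r.
  have -> : k `^ (th - 1) = e / vol g `^ th * vol g.
    by rewrite /k -powRrM mulVf ?powRr1 ?(ltW ev0) // subr_eq0 lt_eqF.
  move=> /(lee_wpmul2l (x := (vol g `^ th)%:E)); rewrite lee_fin (ltW Vt0) => /(_ isT).
  move=> /le_trans; apply; rewrite -EFinM lee_fin le_eqVlt; apply/orP; left; apply/eqP.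
  by field; rewrite !gt_eqF.
have aV0 : 0 < a * vol g by exact: mulr_gt0.
have := avgF (a * vol g)^-1 _ _ aE; rewrite invr_gt0 aV0 => /(_ isT).
move=> /(lee_wpmul2l (x := (vol g `^ th)%:E)); rewrite lee_fin (ltW Vt0) => /(_ isT).
move=> /le_trans; apply; rewrite -EFinM lee_fin.
have inv_pow (z e : R) : 0 < z -> (z^-1) `^ e = z `^ (- e).
  by move=> z0; rewrite -powR_inv1 ?(ltW z0) // -powRrM mulN1r.
rewrite !inv_pow // !powRM ?(ltW a_gt0) ?(ltW V0) // opprB.
rewrite [X in X * a](_ : _ = a `^ (- th) * (vol g `^ th)^-1); last by rewrite -powRN.
rewrite (_ : a `^ (- th) * _ * a = a `^ (1 - th) * (vol g `^ th)^-1); last first.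
  rewrite mulrAC powRD ?(lt0r_neq0 a_gt0) ?implybT // powRr1 ?(ltW a_gt0) //.
  by rewrite [a * _]mulrC.
rewrite (_ : vol g `^ (1 - th) = vol g / vol g `^ th); last first.
  by rewrite powRD ?(lt0r_neq0 V0) ?implybT // powRr1 ?(ltW V0) // powRN.
rewrite le_eqVlt; apply/orP; left; apply/eqP.
by field; rewrite !gt_eqF.
Qed.

End Consequences.

(** * Lipschitz functions and the measure of balls *)

Section Lipschitz.
Context {R : realType} {p n : nat}.
Hypothesis p_pr : prime p.
Hypothesis n_gt0 : (0 < n)%N.
Local Notation T := (Qpn p n).
Local Notation vol := (@vol R p n).

(** A ball of radius p^g has volume p^(n g), which turns the Lipschitz exponent
    beta into beta/n. *)
Lemma ratr_exp_pow (g : int) (beta : R) :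
  (ratr (p%:Q ^ g)) `^ beta = vol g `^ (beta / n%:R).
Proof.
have p0 : 0 <= p%:R :> R by [].
rewrite fmorphXz /= ratr_int /vol -(powR_intmul g p0) -(powR_mulrn n p0).
rewrite -(powR_intmul g (powR_ge0 _ _)) -!powRrM; congr (_ `^ _).
by field; rewrite pnatr_eq0 -lt0n.
Qed.

(** The powers of vol(-1)^th < 1 tend to 0, by Bernoulli's inequality for their
    inverses. *)
Lemma vol_small (th e : R) : 0 < th -> 0 < e -> exists k : nat, vol (- k%:Z) `^ th < e.
Proof.
move=> th0 e0; have V1 : 1 < (p%:R ^+ n) `^ th :> R.
  by rewrite powR_gt1 // exprn_egt1 -?lt0n // ltr1n prime_gt1.
set c := _ `^ th in V1; have c0 : 0 < c := lt_trans ltr01 V1.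
have volE k : vol (- k%:Z) `^ th = (c ^+ k)^-1.
  rewrite /vol /c; have : 0 <= p%:R ^+ n :> R by exact: exprn_ge0.
  move: (_ ^+ n) => P P0; rewrite -invr_expz -exprnP.
  rewrite -powR_inv1 ?exprn_ge0 // -powRrM mulN1r powRN; congr (_^-1).
  by rewrite -(powR_mulrn _ P0) -(powR_mulrn _ (powR_ge0 _ _)) -!powRrM mulrC.
have [k ck] : exists k : nat, e^-1 < c ^+ k.
  have c10 : 0 < c - 1 by rewrite subr_gt0.
  exists (Num.bound (e^-1 / (c - 1))); set k := Num.bound _.
  have := archi_boundP (ltW (divr_gt0 (_ : 0 < e^-1) c10)); rewrite invr_gt0 => /(_ e0).
  rewrite -/k ltr_pdivrMr // => /lt_le_trans; apply.
  apply: (@le_trans _ _ (1 + k%:R * (c - 1))); first by rewrite lerDr.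
  elim: k => [|k IH]; first by rewrite mul0r addr0 expr0.
  have := ler_wpM2l (ltW c0) IH; rewrite -exprS => /(le_trans _); apply.
  have k0 : 0 <= k%:R * (c - 1) * (c - 1) by rewrite !mulr_ge0 // ltW.
  rewrite -natr1; move: k0; set z := k%:R; nra.
by exists k; rewrite volE invf_plt ?posrE ?exprn_gt0.
Qed.

Definition ball_lipschitz (th L : R) (b : T -> R) : Prop :=
  forall g x y, pball g x y -> `|b x - b y| <= L * vol g `^ th.

Lemma lipschitz_ball_lipschitz (beta : R) (b : T -> R) : 0 < beta ->
  lipschitz_space beta b -> exists2 L : R, 0 < L & ball_lipschitz (beta / n%:R) L b.
Proof.
move=> beta0 [_]; rewrite /lipschitz_norm; set S := [set _ | _ in _] => Soo.
have [L L0 SL] : exists2 L : R, 0 < L & (ereal_sup S <= L%:E)%E.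
  move: Soo; case: (ereal_sup S) => [L _| //|_]; last by exists 1; rewrite ?leNye.
  by exists (Num.max 1 L); rewrite ?lt_max ?ltr01 // lee_fin le_max lexx orbT.
exists L => // g x y gxy; have [->|xy] := eqVneq x y.
  by rewrite subrr normr0 mulr_ge0 ?powR_ge0 // ltW.
have [h hE _] := distinct_pball xy.
have : ((`|b x - b y| / ratr (padic_norm (x - y)) `^ beta)%:E <= L%:E)%E.
  by apply: le_trans SL; apply: ereal_sup_ubound; exists (x, y).
have hg : p%:Q ^ h <= p%:Q ^ g by rewrite -hE; apply: pball_dist; exact: (pball_sym p_pr).
rewrite hE lee_fin ler_pdivrMr; last first.
  by rewrite powR_gt0 // ltr0q exp_base_gt0.
move=> /le_trans; apply; rewrite ler_wpM2l ?(ltW L0) // -ratr_exp_pow.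
by rewrite powR_le ?(ltW beta0) ?ler_rat // ler0q ltW // exp_base_gt0.
Qed.

Lemma ball_lipschitz_measurable (th L : R) (b : T -> R) : 0 < th -> 0 < L ->
  ball_lipschitz th L b -> measurable_fun setT b.
Proof.
move=> th0 L0 bL mD; apply: (measurability _ (RGenOInfty.measurableE R)) => //.
move=> _ [_ [y ->] <-]; rewrite setTI.
apply: (locally_pball_measurable p_pr) => x /=; rewrite in_itv /= andbT => yb.
have byx : 0 < b x - y by rewrite subr_gt0.
have [k ke] := vol_small th0 (divr_gt0 byx L0).
exists (- k%:Z) => z xz /=; rewrite in_itv /= andbT.
have := bL _ _ _ xz.
have : L * vol (- k%:Z) `^ th < b x - y.
  by rewrite mulrC -ltr_pdivlMr.
move=> /[swap] /le_lt_trans/[apply]; rewrite ltr_norml => /andP[_].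
by rewrite ltrD2l ltrN2.
Qed.

Lemma ball_lipschitz_lipschitz (beta L : R) (b : T -> R) : 0 < beta -> 0 < L ->
  ball_lipschitz (beta / n%:R) L b -> lipschitz_space beta b.
Proof.
move=> beta0 L0 bL; split.
  by apply: ball_lipschitz_measurable bL => //; rewrite divr_gt0 // ltr0n.
apply: (@le_lt_trans _ _ L%:E); last exact: ltry.
apply: ge_ereal_sup => _ [[x y] /= xy <-].
have [h hE yx] := distinct_pball xy.
rewrite lee_fin hE ler_pdivrMr; last by rewrite powR_gt0 // ltr0q exp_base_gt0.
by rewrite ratr_exp_pow; apply: bL; exact: (pball_sym p_pr).
Qed.

End Lipschitz.

(** * Bounds for the commutator *)

Section Commutator.
Context {R : realType} {p n : nat}.
Hypothesis p_pr : prime p.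
Variable mu : {measure set (Qpn p n) -> \bar R}.
Hypothesis hmu : haar_measure mu.
Local Notation T := (Qpn p n).
Local Notation vol := (@vol R p n).

(** On the ball of volume V around x, multiplying f by b before averaging and
    multiplying the average by b(x) differ by at most L V^th times the average,
    which is a fractional average. *)
Lemma commutator_le (b b' f : T -> R) (th L : R) (W : \bar R) x :
  0 < L -> measurable_fun setT b -> measurable_fun setT b' -> measurable_fun setT f ->
  ball_lipschitz th L b' -> (forall y, 0 <= b' y) -> (\forall y \ae mu, b y = b' y) ->
  b x = b' x -> (maximal mu f x < +oo)%E ->
  (forall g, (vol g `^ th)%:E * average mu f (pball g x) <= W)%E ->
  (`|commutator mu b f x| <= L%:E * W)%E.
Proof.
move=> L0 mb mb' mf bL b'0 bb' bx Mfoo fW.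
have W0 : (0 <= W)%E.
  apply: le_trans (fW 0); apply: mule_ge0; first by rewrite lee_fin powR_ge0.
  exact: average_ge0.
have L0e : (0 <= L%:E)%E by rewrite lee_fin ltW.
have LW0 : (0 <= L%:E * W)%E := mule_ge0 L0e W0.
have Mf0 := maximal_ge0 p_pr hmu f x.
have [m mE m0] : exists2 m : R, maximal mu f x = m%:E & 0 <= m.
  by move: Mfoo Mf0; case: (maximal mu f x) => [m _|//|//]; rewrite lee_fin; exists m.
pose bf y := b y * f y.
have avg_bf g : average mu bf (pball g x) = average mu (fun y => b' y * f y)%R (pball g x).
  rewrite !(averageE p_pr hmu); congr (_ * _)%E; have mB := measurable_pball p_pr g x.
  apply: ge0_ae_eq_integral => //.
  - by apply: measurable_abs_EFin; exact: measurable_funM.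
  - by apply: measurable_abs_EFin; exact: measurable_funM.
  by apply: filterS bb' => y + _; rewrite /bf => ->.
have compare (h1 h2 : T -> R) (c d : R) g : measurable_fun setT h1 -> measurable_fun setT h2 ->
    0 <= c -> 0 <= d -> (forall y, pball g x y -> `|h1 y| <= c * `|h2 y| + d * `|f y|) ->
    (average mu h1 (pball g x) <= c%:E * average mu h2 (pball g x) + d%:E * average mu f (pball g x))%E.
  move=> mh1 mh2 c0 d0 h12; have mB := measurable_pball p_pr g x.
  rewrite -(average_scale p_pr hmu) // -(average_scale p_pr hmu) // !(averageE p_pr hmu).
  rewrite -ge0_muleDr; try by apply: integral_ge0 => y _; rewrite lee_fin.
  rewrite lee_wpmul2l ?lee_fin ?invr_ge0 ?vol_ge0 // -ge0_integralD //; last 2 first.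
  - by apply: measurable_abs_EFin; exact: measurable_funM.
  - by apply: measurable_abs_EFin; exact: measurable_funM.
  apply: ge0_le_integral => //.
  - exact: measurable_abs_EFin.
  - by apply: emeasurable_funD; apply: measurable_abs_EFin; exact: measurable_funM.
  by move=> y xy; rewrite -EFinD lee_fin !normrM (ger0_norm c0) (ger0_norm d0); exact: h12.
have Lv0 g : 0 <= L * vol g `^ th by rewrite mulr_ge0 ?powR_ge0 // ltW.
have upper : (maximal mu bf x <= (b' x * m)%:E + L%:E * W)%E.
  apply: ge_ereal_sup => _ [g _ <-]; rewrite avg_bf.
  apply: le_trans (compare _ f (b' x) (L * vol g `^ th) g _ _ _ _ _) _ => //.
  - exact: measurable_funM.
  - move=> y xy; rewrite normrM -mulrDl ler_wpM2r // (ger0_norm (b'0 y)).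
    have := bL _ _ _ xy; rewrite ler_norml => /andP[+ _]; lra.
  rewrite (EFinM (b' x) m) -mE leeD //.
    by rewrite lee_wpmul2l ?lee_fin //; exact: average_le_maximal.
  by rewrite EFinM -muleA lee_wpmul2l.
have lower : ((b' x * m)%:E <= maximal mu bf x + L%:E * W)%E.
  have Y0 : (0 <= maximal mu bf x + L%:E * W)%E by exact: adde_ge0 (maximal_ge0 p_pr hmu bf x) LW0.
  have avg_le g : ((b' x)%:E * average mu f (pball g x) <= maximal mu bf x + L%:E * W)%E.
    apply: (@le_trans _ _ (average mu bf (pball g x) + L%:E * W)%E); last first.
      by apply: leeD2r; exact: average_le_maximal.
    rewrite -(average_scale p_pr hmu) // avg_bf.
    apply: le_trans (compare _ (fun y => b' y * f y) 1 (L * vol g `^ th) g _ _ _ _ _) _ => //.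
    - exact: measurable_funM.
    - exact: measurable_funM.
    - move=> y xy; rewrite mul1r !normrM -mulrDl ler_wpM2r // (ger0_norm (b'0 x)) (ger0_norm (b'0 y)).
      have := bL _ _ _ xy; rewrite ler_norml => /andP[_]; lra.
    by rewrite mul1e leeD // EFinM -muleA lee_wpmul2l.
  have [bx0|bx0] := eqVneq (b' x) 0; first by rewrite bx0 mul0r.
  have bx_gt0 : 0 < b' x by rewrite lt_neqAle eq_sym bx0 b'0.
  rewrite (EFinM (b' x) m) -mE -lee_pdivlMl //; apply: ge_ereal_sup => _ [g _ <-].
  by rewrite lee_pdivlMl.
rewrite /commutator -/bf mE bx -EFinM.
move: upper lower LW0; case: (L%:E * W)%E => [w| |//]; last by move=> *; rewrite leey.
have := maximal_ge0 p_pr hmu bf x.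
case: (maximal mu bf x) => [k| |//]; last by move=> _; rewrite leye_eq.
rewrite -!EFinD abse_EFin !lee_fin => _ k1 k2 _.
by rewrite ler_norml; apply/andP; split; lra.
Qed.

End Commutator.

Section Boundedness.
Context {R : realType} {p n : nat}.
Hypothesis p_pr : prime p.
Hypothesis n_gt0 : (0 < n)%N.
Variable mu : {measure set (Qpn p n) -> \bar R}.
Hypothesis hmu : haar_measure mu.
Local Notation T := (Qpn p n).
Local Notation vol := (@vol R p n).

Lemma average_norm (f : T -> R) B : average mu (fun y => `|f y|) B = average mu f B.
Proof. by congr (_ * _)%E; apply: eq_integral => y _; rewrite normr_id. Qed.

Lemma maximal_norm (f : T -> R) x : maximal mu (fun y => `|f y|) x = maximal mu f x.
Proof.
by congr (ereal_sup _); apply/seteqP; split=> _ [g _ <-]; exists g => //; rewrite average_norm.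
Qed.

Lemma log_holder_measurable (q : T -> R) : log_holder mu q -> measurable_fun setT q.
Proof. by case=> -[]. Qed.

(** If F = |f|/eta has modular at most 1 for r, the fractional averages of f are
    at most 2 eta (M F2)^(1-th) with F2 = F^(r/(q(1-th))), so commutator_le bounds
    the commutator by a multiple of the same function. Its power q is a multiple of
    (M F2)^s with s = q (1-th), while F2^s = F^r has integral at most 1. The
    maximal theorem applies to s: it inherits the regularity of q, and s >= r
    is bounded away from 1. *)
Theorem commutator_bounded (b b' r q : T -> R) (th L : R) :
  0 < th < 1 -> 0 < L -> measurable_fun setT b -> ball_lipschitz th L b' ->
  (forall y, 0 <= b' y) -> (\forall y \ae mu, b y = b' y) ->
  log_holder mu r -> log_holder mu q -> (forall x, (q x)^-1 = (r x)^-1 - th) ->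
  bounded_op mu r q (commutator mu b).
Proof.
move=> /andP[th0 th1] L0 mb bL b'0 bb' lr lq qr.
have th10 : 0 < 1 - th by rewrite subr_gt0.
have mb' := ball_lipschitz_measurable p_pr n_gt0 th0 L0 bL.
have mr := log_holder_measurable lr; have mq := log_holder_measurable lq.
have [sr [Sr [sr1 rB]]] := exponent_bounds lr.1.
have [sq [Sq [sq1 qB]]] := exponent_bounds lq.1.
have [Kr Kr0 rr] := log_holder_regular p_pr lr.
have [Kq Kq0 rq] := log_holder_regular p_pr lq.
have r1 x : 1 < r x by have /andP[rx _] := rB x; exact: lt_le_trans rx.
have q1 x : 1 < q x by have /andP[qx _] := qB x; exact: lt_le_trans qx.
have r0 x : 0 < r x := lt_trans ltr01 (r1 x).
have q0 x : 0 < q x := lt_trans ltr01 (q1 x).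
pose s x := q x * (1 - th).
have s0 x : 0 < s x by exact: mulr_gt0.
have ms : measurable_fun setT s by exact: measurable_funM.
have sB x : sr <= s x <= Sq.
  have /andP[rx _] := rB x; have /andP[_ qx] := qB x; apply/andP; split.
    apply: (le_trans rx); rewrite /s mulrC -ler_pdivrMr //.
    have -> : r x / q x = 1 - r x * th by rewrite qr mulrBr mulfV // gt_eqF.
    by rewrite lerD2l lerN2 ler_peMl // ltW.
  apply: le_trans qx; rewrite /s ger_pMr // gerBl; exact: ltW.
have rs : log_regular mu s Kq.
  apply: log_regular_le rq => // x y; rewrite /s -mulrBl normrM (gtr0_norm th10).
  by rewrite -[leRHS]mulr1 ler_wpM2l // gerBl ltW.
have [C1 C10 max_s] := maximal_modular p_pr n_gt0 hmu ms sr1 sB Kq0 rs.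
have [C2 C20 max_r] := maximal_modular p_pr n_gt0 hmu mr sr1 rB Kr0 rr.
pose C0 := Num.max 1 C1; have C01 : 1 <= C0 by rewrite le_max lexx.
have C0_gt0 : 0 < C0 := lt_le_trans ltr01 C01.
have LC0 : 0 < L * 2 * C0 by rewrite !mulr_gt0.
exists (L * 2 * C0) => f [mf _]; apply: le_mul_var_norm => // eta eta0 m1.
pose F x := `|f x| / eta.
have F0 x : 0 <= F x by rewrite divr_ge0 // ltW.
have mF : measurable_fun setT F.
  by apply: measurable_funM => //; exact: measurableT_comp.
have IF : (\int[mu]_x (F x `^ r x)%:E <= 1)%E by rewrite -modular_real.
pose F2 y := F y `^ (r y / (q y * (1 - th))).
have F20 y : 0 <= F2 y by exact: powR_ge0.
have mF2 : measurable_fun setT F2.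
  apply: measurable_powR_fun => //.
  rewrite [X in measurable_fun _ X](_ : _ = (fun y => (1 - r y * th) / (1 - th))).
    apply: measurable_funM => //; apply: measurable_funB => //.
    exact: measurable_funM.
  apply/funext => y; have -> : 1 - r y * th = r y / q y.
    by rewrite qr mulrBr mulfV // gt_eqF.
  by field; rewrite !gt_eqF.
have IF2 : (\int[mu]_x (F2 x `^ s x)%:E <= 1)%E.
  apply: le_trans IF; under eq_integral => y _.
    rewrite /F2 /s -powRrM (_ : _ / _ * _ = r y); last by field; rewrite !gt_eqF.
    over.
  exact: lexx.
have [H1 [mH1 H10 IH1 MH1]] := max_s _ mF2 F20 IF2.
have [H2 [mH2 H20 IH2 MH2]] := max_r _ mF F0 IF.
have MF_fin := ae_finite_of_majorant (fun x => lt0r_neq0 (r0 x)) mH2 H20 IH2 MH2.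
have fF : (fun y => `|f y|) = (fun y => eta * F y).
  by apply/funext => y; rewrite /F mulrC divfK // gt_eqF.
have eta0' := ltW eta0.
have e'0 : 0 < L * 2 * C0 * eta by exact: mulr_gt0.
apply: var_norm_le => //.
apply: (@le_trans _ _ (\int[mu]_x ((C0^-1)%:E * H1 x))%E); last first.
  rewrite ge0_integralZl_EFin ?invr_ge0 ?(ltW C0_gt0) //.
  apply: le_trans (lee_wpmul2l _ IH1) _; first by rewrite lee_fin invr_ge0 ltW.
  by rewrite -EFinM lee_fin mulrC ler_pdivrMr // mul1r le_max lexx orbT.
apply: ae_le_integralT.
- by move=> x; exact: poweR_ge0.
- by move=> x; rewrite mule_ge0 // lee_fin invr_ge0 ltW.
- exact: measurable_funeM.
apply: filterS3 (bb') MF_fin MH1 => x bx MFx MH.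
pose X := (maximal mu F2 x `^ (1 - th))%E.
have X0 : (0 <= X)%E by exact: poweR_ge0.
have fW g : ((vol g `^ th)%:E * average mu f (pball g x) <= (2 * eta)%:E * X)%E.
  rewrite -average_norm fF (average_scale p_pr hmu) // muleCA EFinM [(2%:E * _)%E]muleC -muleA.
  rewrite lee_wpmul2l ?lee_fin //.
  have th01 : 0 < th < 1 by rewrite th0.
  apply: le_trans (fractional_average_le p_pr hmu g x th01 mr mq mF F0 r0 q0 qr IF) _.
  rewrite lee_wpmul2l ?lee_fin //; apply: poweR_le; first exact: ltW.
    exact: average_ge0.
  exact: average_le_maximal.
have Mfoo : (maximal mu f x < +oo)%E.
  rewrite -maximal_norm fF; apply: le_lt_trans (maximal_scale_le p_pr hmu x mF eta0') _.
  have := maximal_ge0 p_pr hmu F x; move: MFx; case: (maximal mu F x) => [z _ _|//|//].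
  by rewrite -EFinM ltry.
have := commutator_le p_pr hmu L0 mb mb' mf bL b'0 bb' bx Mfoo fW.
rewrite muleA -EFinM => cX.
have e'e : (0 <= (L * 2 * C0 * eta)%:E^-1)%E by rewrite inve_ge0 lee_fin ltW.
apply: (@le_trans _ _ ((X * C0^-1%:E) `^ q x)%E).
  apply: poweR_le; first exact: ltW.
    by rewrite mule_ge0.
  apply: le_trans (lee_wpmul2r e'e cX) _.
  rewrite inver gt_eqF // [X in (X <= _)%E]muleAC -EFinM [X in (_ <= X)%E]muleC.
  rewrite (_ : L * (2 * eta) * (L * 2 * C0 * eta)^-1 = C0^-1) //.
  by field; rewrite !gt_eqF.
rewrite poweRM ?lee_fin ?invr_ge0 ?(ltW C0_gt0) // /X -poweRrM.
have -> : (1 - th) * q x = s x by rewrite mulrC.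
rewrite muleC poweR_EFin; apply: lee_pmul => //.
- by rewrite lee_fin powR_ge0.
- exact: poweR_ge0.
by rewrite lee_fin ge1r_powR ?(ltW (q1 x)) // invr_gt0 C0_gt0 invf_le1.
Qed.

(** The operator averaging over one ball is bounded on the variable Lebesgue
    space, uniformly in the ball, since the average is below the maximal
    function on that ball. *)
Lemma average_var_norm_le (q : T -> R) : log_holder mu q ->
  exists2 C : R, 0 < C & forall (w : T -> R) g x (a : R), measurable_fun setT w ->
    (forall y, 0 <= w y) -> average mu w (pball g x) = a%:E ->
    (a%:E * var_norm mu q (EFin \o (\1_(pball g x) : T -> R)) <=
     C%:E * var_norm mu q (EFin \o w))%E.
Proof.
move=> lq; have mq := log_holder_measurable lq.
have [sq [Sq [sq1 qB]]] := exponent_bounds lq.1.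
have [Kq Kq0 rq] := log_holder_regular p_pr lq.
have q1 x : 1 < q x by have /andP[qx _] := qB x; exact: lt_le_trans qx.
have q0 x : 0 < q x := lt_trans ltr01 (q1 x).
have [C C_gt0 max_q] := maximal_modular p_pr n_gt0 hmu mq sq1 qB Kq0 rq.
pose C0 := Num.max 1 C; have C01 : 1 <= C0 by rewrite le_max lexx.
have C0_gt0 : 0 < C0 := lt_le_trans ltr01 C01.
exists C0; [exact: C0_gt0|move=> w g x a mw w0 aE].
apply: le_mul_var_norm; [exact: C0_gt0|move=> eta eta0 m1].
have a0 : 0 <= a by rewrite -lee_fin -aE; exact: average_ge0.
have [->|a_neq0] := eqVneq a 0; first by rewrite mul0e lee_fin mulr_ge0 // ltW.
have a_gt0 : 0 < a by rewrite lt_neqAle eq_sym a_neq0.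
pose F y := eta^-1 * w y.
have F0 y : 0 <= F y by rewrite mulr_ge0 // invr_ge0 ltW.
have mF : measurable_fun setT F by exact: measurable_funM.
have IF : (\int[mu]_y (F y `^ q y)%:E <= 1)%E.
  move: m1; rewrite (modular_real mu q w eta0); apply: le_trans.
  by apply: ge0_le_integralT => y; rewrite lee_fin ?powR_ge0 // ger0_norm // mulrC.
have [H [mH H0 IH MH]] := max_q _ mF F0 IF.
have e0 : 0 < C0 * eta / a by rewrite divr_gt0 // mulr_gt0.
rewrite -lee_pdivlMl // -EFinM mulrC; apply: (var_norm_le e0).
rewrite (modular_indic mu _ _ q0 e0) [leLHS]integral_mkcond.
apply: (@le_trans _ _ (\int[mu]_x ((C0^-1)%:E * H x))%E); last first.
  rewrite ge0_integralZl_EFin ?invr_ge0 ?(ltW C0_gt0) //.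
  apply: le_trans (lee_wpmul2l _ IH) _; first by rewrite lee_fin invr_ge0 ltW.
  by rewrite -EFinM lee_fin mulrC ler_pdivrMr // mul1r le_max lexx orbT.
have CH0 y : (0 <= C0^-1%:E * H y)%E by rewrite mule_ge0 // lee_fin invr_ge0 ltW.
apply: ae_le_integralT => //.
- by move=> y; rewrite patchE; case: ifP => // _; rewrite lee_fin powR_ge0.
- exact: measurable_funeM.
apply: filterS MH => y My; rewrite patchE; case: ifPn => // /set_mem xy.
have avgF : ((eta^-1 * a)%:E <= maximal mu F y)%E.
  apply: le_trans (average_le_maximal _ _ g y).
  by rewrite (pball_eq p_pr xy) (average_scale p_pr hmu) ?invr_ge0 ?(ltW eta0) // aE.
have ea0 : 0 <= eta^-1 * a by rewrite mulr_ge0 // invr_ge0 ltW.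
apply: (@le_trans _ _ ((C0^-1 `^ q y)%:E * ((eta^-1 * a)%:E `^ q y))%E).
  rewrite poweR_EFin -EFinM -powRM ?invr_ge0 ?(ltW C0_gt0) // lee_fin.
  rewrite le_eqVlt; apply/orP; left; apply/eqP; congr (_ `^ _).
  by field; rewrite !gt_eqF.
apply: lee_pmul; rewrite ?lee_fin ?powR_ge0 ?poweR_ge0 //.
  by rewrite ge1r_powR ?(ltW (q1 y)) // invr_gt0 C0_gt0 invf_le1.
by apply: le_trans My; apply: poweR_le => //; exact: ltW.
Qed.

End Boundedness.

(** * From finite oscillation to Lipschitz continuity *)

Section Campanato.
Context {R : realType} {p n : nat}.
Hypothesis p_pr : prime p.
Hypothesis n_gt0 : (0 < n)%N.
Variable mu : {measure set (Qpn p n) -> \bar R}.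
Hypothesis hmu : haar_measure mu.
Local Notation T := (Qpn p n).
Local Notation vol := (@vol R p n).

Lemma loc_integrable_average (b : T -> R) : loc_integrable mu b ->
  forall g x, exists2 m : R, 0 <= m & average mu b (pball g x) = m%:E.
Proof.
move=> [mb bK] g x; have [k xk] := pball_exhaust p_pr x.
pose h := `|g|%N%:Z + k%:Z.
have gB : pball g x `<=` pball h 0.
  apply: (pball_sub p_pr); last first.
    by apply: (pball_le p_pr _ xk); rewrite lerDr.
  by apply: (@le_trans _ _ `|g|%N%:Z); [rewrite abszE ler_norm|rewrite lerDl].
have : (average mu b (pball g x) < +oo)%E.
  rewrite (averageE p_pr hmu) lte_mul_pinfty ?lee_fin ?invr_ge0 ?vol_ge0 //.
  apply: le_lt_trans (bK (pball h 0) (@pball0_compact p n p_pr h)).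
  by apply: ge0_subset_integral => //; [exact: measurable_pball|exact: measurable_pball|exact: measurable_abs_EFin].
have := average_ge0 p_pr hmu b g x.
by case: (average _ _ _) => [m|//|//]; rewrite lee_fin => m0 _; exists m.
Qed.

Lemma integral_abs_average (b : T -> R) g x m : average mu b (pball g x) = m%:E ->
  (\int[mu]_(y in pball g x) `|b y|%:E = (m * vol g)%:E)%E.
Proof.
rewrite (averageE p_pr hmu) => bm; rewrite mulrC EFinM -bm muleA -EFinM.
by rewrite mulfV ?mul1e // gt_eqF // vol_gt0.
Qed.

(** Finite oscillation controls the mean deviation of b from m, the average of
    |b| over the ball, rather than from the average of b: since the local
    maximal function is at least m, the hypothesis bounds the deficit
    w = max(m - b, 0), and |b - m| + m <= 2 w + |b| turns this into a bound
    for |b - m| because the averages of m and |b| coincide. *)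
Lemma oscillation_deviation (b q : T -> R) (beta : R) : loc_integrable mu b ->
  log_holder mu q -> (oscillation_sup mu beta q b < +oo)%E ->
  exists2 C : R, 0 < C & forall g x m, average mu b (pball g x) = m%:E ->
    (\int[mu]_(y in pball g x) `|b y - m|%:E <= (C * vol g `^ (beta / n%:R) * vol g)%:E)%E.
Proof.
move=> lb lq; rewrite /oscillation_sup; set S := [set _ | _ in _] => Soo.
have [D D0 SD] : exists2 D : R, 0 < D & (ereal_sup S <= D%:E)%E.
  move: Soo; case: (ereal_sup S) => [L _| //|_]; last by exists 1; rewrite ?leNye.
  by exists (Num.max 1 L); rewrite ?lt_max ?ltr01 // lee_fin le_max lexx orbT.
have mq := log_holder_measurable lq; have mb := lb.1.
have [sq [Sq [sq1 qB]]] := exponent_bounds lq.1.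
have q1 x : 1 <= q x by have /andP[qx _] := qB x; exact: le_trans (ltW sq1) qx.
have q0 x : 0 <= q x := le_trans ler01 (q1 x).
have [C C0 avgC] := average_var_norm_le p_pr n_gt0 hmu lq.
exists (2 * (C * D)); first by rewrite !mulr_gt0.
move=> g x m mE; set B := pball g x; have mB : measurable B by exact: measurable_pball.
have V0 := vol_gt0 (R := R) (n := n) p_pr g.
set th := beta / n%:R; have Vt0 : 0 < vol g `^ th by exact: powR_gt0.
have m0 : 0 <= m by rewrite -lee_fin -mE; exact: average_ge0.
have [N N0 NE] := var_norm_indic_ball p_pr hmu g x mq q1.
pose u y : \bar R := (((b y)%:E - local_maximal mu B b y) * (\1_B y)%:E)%E.
have uD : (var_norm mu q u <= (D * vol g `^ th * N)%:E)%E.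
  have : (oscillation mu beta q b B <= D%:E)%E.
    by apply: le_trans SD; apply: ereal_sup_ubound; exists (g, x).
  rewrite /oscillation (haar_pball_vol p_pr hmu) poweR_EFin inver gt_eqF //.
  rewrite (_ : var_norm mu q (fun y => (\1_B y)%:E) = N%:E) ?inver ?gt_eqF //.
  rewrite -/th -/u lee_pdivrMl // lee_pdivrMr //.
  by rewrite -!EFinM [vol g `^ th * D]mulrC.
pose w y := Num.max (m - b y) 0 * \1_B y.
have w0 y : 0 <= w y by rewrite mulr_ge0 ?le_max ?lexx ?orbT // indicE.
have mw : measurable_fun setT w.
  apply: measurable_funM; last by apply: measurable_indic.
  by apply: measurable_maxr => //; apply: measurable_funB.
have wu : (var_norm mu q (EFin \o w) <= var_norm mu q u)%E.
  apply: le_var_norm => // y; rewrite /w /u /= indicE.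
  case: (boolP (y \in B)) => [/set_mem yB|_] /=; last by rewrite mulr0 mule0.
  rewrite mulr1 mule1.
  have mM : (m%:E <= local_maximal mu B b y)%E.
    rewrite -mE -(pball_eq p_pr yB); apply: ereal_sup_ubound.
    by exists g; [rewrite /= (pball_eq p_pr yB)|reflexivity].
  move: mM; case: (local_maximal mu B b y) => [r| |]; last by rewrite leeNy_eq.
    rewrite lee_fin => mr; rewrite -EFinB !abse_EFin lee_fin.
    have mx0 : 0 <= Num.max (m - b y) 0 by rewrite le_max lexx orbT.
    rewrite (ger0_norm mx0) ge_max normr_ge0 andbT.
    by rewrite -normrN opprB; apply: le_trans (ler_norm _); rewrite lerB.
  by move=> _; rewrite /= leey.
have Ib := integral_abs_average mE.
have [a aE] : exists a : R, average mu w B = a%:E.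
  have : (average mu w B <= (2 * m)%:E)%E.
    rewrite (averageE p_pr hmu).
    apply: (@le_trans _ _ ((vol g)^-1%:E * (m * vol g + m * vol g)%:E)%E); last first.
      by rewrite -EFinM lee_fin le_eqVlt; apply/orP; left; apply/eqP; field; rewrite gt_eqF.
    rewrite lee_wpmul2l ?lee_fin ?invr_ge0 ?(ltW V0) // EFinD -{2}Ib.
    rewrite (_ : (m * vol g)%:E = \int[mu]_(y in B) (cst m%:E y))%E; last first.
      by rewrite integral_cst // (haar_pball_vol p_pr hmu).
    rewrite -ge0_integralD //; last by apply: measurable_abs_EFin.
    apply: ge0_le_integral => //; first exact: measurable_abs_EFin.
      by apply: emeasurable_funD => //; exact: measurable_abs_EFin.
    move=> y yB; rewrite -EFinD lee_fin ger0_norm // /w indicE mem_set // mulr1.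
    rewrite ge_max addr_ge0 // andbT lerD2l -normrN; exact: ler_norm.
  have := average_ge0 p_pr hmu w g x; rewrite -/B.
  by case: (average mu w B) => [a|//|//]; exists a.
have aD : a <= C * D * vol g `^ th.
  have := le_trans (avgC w g x a mw w0 aE) (lee_wpmul2l _ (le_trans wu uD)).
  rewrite lee_fin (ltW C0) => /(_ isT).
  rewrite (_ : var_norm mu q (EFin \o _) = N%:E) // -!EFinM lee_fin !mulrA.
  by rewrite ler_pM2r.
have Iw : (\int[mu]_(y in B) (w y)%:E = (a * vol g)%:E)%E.
  rewrite -(integral_abs_average aE); apply: eq_integral => y _.
  by rewrite ger0_norm.
have mwB : measurable_fun B (fun y => (w y)%:E) by apply/measurable_EFinP/measurable_funTS.
have sum_le : (\int[mu]_(y in B) `|b y - m|%:E + (m * vol g)%:E <=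
    (2 * (a * vol g))%:E + (m * vol g)%:E)%E.
  rewrite -[in leRHS]Ib (EFinM 2) -Iw -ge0_integralZl_EFin //; last by move=> y _; rewrite lee_fin.
  rewrite (_ : (m * vol g)%:E = \int[mu]_(y in B) (cst m%:E y))%E; last first.
    by rewrite integral_cst // (haar_pball_vol p_pr hmu).
  have mbm : measurable_fun B (fun y => `|b y - m|%:E) by apply: measurable_abs_EFin; exact: measurable_funB.
  rewrite -ge0_integralD // -ge0_integralD //; last 3 first.
  - by move=> y _; rewrite -EFinM lee_fin mulr_ge0.
  - exact: measurable_funeM.
  - exact: measurable_abs_EFin.
  apply: ge0_le_integral => //.
  - by move=> y _; rewrite -EFinD lee_fin addr_ge0.
  - by apply: emeasurable_funD.
  - by apply: emeasurable_funD; [exact: measurable_funeM|exact: measurable_abs_EFin].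
  move=> y yB; rewrite -EFinM -!EFinD lee_fin /w indicE mem_set // mulr1 maxEle.
  have b1 := ler_norm (b y).
  case: ifP => [mb_le|/negbT]; last rewrite -ltNge => /ltW mb_ge.
    by rewrite [`|b y - m|]ger0_norm; lra.
  by rewrite [`|b y - m|]ler0_norm; lra.
rewrite leeD2rE // in sum_le.
apply: le_trans sum_le _; rewrite lee_fin -!mulrA ler_wpM2l // !mulrA.
by rewrite ler_wpM2r // ltW.
Qed.

(** Campanato's characterisation of Lipschitz functions. With m(g,x) the average
    of |b| over the ball of radius p^g at x, the intervals of centre m(g,x) and
    half-width C vol(g)^th shrink as g decreases, and b'(x) is chosen in all of
    them. It is nonnegative because m is. *)
Theorem campanato (b : T -> R) (th C1 : R) : loc_integrable mu b -> 0 < th -> 0 < C1 ->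
  (forall g x m, average mu b (pball g x) = m%:E ->
    (\int[mu]_(y in pball g x) `|b y - m|%:E <= (C1 * vol g `^ th * vol g)%:E)%E) ->
  exists (b' : T -> R) (L : R), [/\ 0 < L, ball_lipschitz th L b',
    (forall x, 0 <= b' x) & \forall x \ae mu, b x = b' x].
Proof.
move=> lb th0 C10 dev; have mb := lb.1.
have ex (z : int * T) : exists r : R, 0 <= r /\ average mu b (pball z.1 z.2) = r%:E.
  by have [r r0 rE] := loc_integrable_average lb z.1 z.2; exists r.
have [m mP] := choice ex.
have m_ball g x y : pball g x y -> m (g, y) = m (g, x).
  move=> xy; have [_ yE] := mP (g, y); have [_ xE] := mP (g, x).
  by move: yE; rewrite /= (pball_eq p_pr xy) xE => -[].
have devm g x : (\int[mu]_(y in pball g x) `|b y - m (g, x)|%:E <= (C1 * vol g `^ th * vol g)%:E)%E.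
  by apply: dev; have [_] := mP (g, x).
have mB g x : measurable (pball g x : set T) by exact: measurable_pball.
have V0 g := vol_gt0 (R := R) (n := n) p_pr g.
pose P : R := p%:R ^+ n.
have P1 : 1 < P by rewrite /P exprn_egt1 -?lt0n // ltr1n prime_gt1.
have P0 : 0 < P := lt_trans ltr01 P1.
have volS g : vol g = P * vol (g - 1).
  by rewrite /vol -{1}[g](subrK 1) expfzDr ?gt_eqF // expr1z mulrC.
have Pt1 : 1 < P `^ th by exact: powR_gt1.
have Pt0 : 0 < P `^ th - 1 by rewrite subr_gt0.
pose C2 := C1 * (1 + P `^ th * P).
have C20 : 0 < C2 by rewrite mulr_gt0 // addr_gt0 // mulr_gt0 // powR_gt0.
(* Consecutive averages differ by at most the mean deviations of b from them. *)
have step g x : `|m (g - 1, x) - m (g, x)| <= C2 * vol (g - 1) `^ th.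
  set d := `|_ - _|; set v := vol (g - 1); have v0 : 0 < v := V0 _.
  set B := pball (g - 1) x.
  have mabsB (c : R) : measurable_fun B (fun y => `|b y - c|%:E).
    by apply: measurable_abs_EFin; exact: measurable_funB.
  have : ((d * v)%:E <= (C1 * v `^ th * v)%:E + (C1 * vol g `^ th * vol g)%:E)%E.
    rewrite EFinM -(haar_pball_vol p_pr hmu (g - 1) x) -integral_cst //.
    apply: (@le_trans _ _ (\int[mu]_(y in B) (`|b y - m ((g - 1)%R, x)|%:E + `|b y - m (g, x)|%:E))%E).
      apply: ge0_le_integral => //.
      - by move=> y _; rewrite lee_fin normr_ge0.
      - exact: emeasurable_funD.
      move=> y _; rewrite -EFinD lee_fin /d.
      have -> : m (g - 1, x) - m (g, x) = (b y - m (g, x)) - (b y - m (g - 1, x)) by ring.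
      by apply: le_trans (ler_normB _ _) _; rewrite addrC.
    rewrite ge0_integralD //; last exact: mB.
    apply: leeD; first exact: devm.
    apply: le_trans (devm g x); apply: ge0_subset_integral => //.
    - exact: mB.
    - by apply: measurable_abs_EFin; exact: measurable_funB.
    - by apply: (pball_le p_pr); rewrite gerBl.
  rewrite -EFinD lee_fin (volS g) -/v powRM ?(ltW P0) ?(ltW v0) // => H.
  rewrite -(ler_pM2r v0); apply: le_trans H _; rewrite le_eqVlt; apply/orP; left; apply/eqP.
  by rewrite /C2; ring.
(* The constant for which C3 vol(g)^th is C3 vol(g-1)^th plus the step, so that
   the intervals from l x g to u x g are nested. *)
pose C3 := C2 / (P `^ th - 1); have C30 : 0 < C3 by exact: divr_gt0.
pose l x g := m (g, x) - C3 * vol g `^ th.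
pose u x g := m (g, x) + C3 * vol g `^ th.
have vth g : vol g `^ th = P `^ th * vol (g - 1) `^ th by rewrite volS powRM // ltW.
have C3E : C3 * P `^ th = C3 + C2 by rewrite /C3; field; rewrite gt_eqF.
have gap g x : [/\ l x g <= l x (g - 1) & u x (g - 1) <= u x g].
  have := step g x; rewrite ler_norml => /andP[H1 H2].
  by rewrite /l /u vth mulrA C3E; split; rewrite mulrDl; lra.
have gapk (k : nat) g x : l x g <= l x (g - k%:Z) /\ u x (g - k%:Z) <= u x g.
  elim: k => [|k [IH1 IH2]]; first by rewrite subr0.
  have -> : g - k.+1%:Z = g - k%:Z - 1 by rewrite -addn1 PoszD opprD addrA.
  have [H1 H2] := gap (g - k%:Z) x.
  by split; [exact: le_trans IH1 H1|exact: le_trans H2 IH2].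
have lu x g : l x g <= u x g.
  have H : 0 <= C3 * vol g `^ th by rewrite mulr_ge0 ?powR_ge0 // ltW.
  by rewrite /l /u; lra.
have l_le_u x g h : l x g <= u x h.
  have [hg|/ltW gh] := leP h g.
    have [+ _] := gapk `|g - h|%N g x; rewrite gez0_abs ?subr_ge0 // opprB addrC subrK.
    by move=> /le_trans; apply.
  have [_ +] := gapk `|h - g|%N h x; rewrite gez0_abs ?subr_ge0 // opprB addrC subrK.
  exact: le_trans.
pose b' x := Num.max 0 (sup (range (l x))).
have b'_ball g x : l x g <= b' x /\ b' x <= u x g.
  have hs : has_sup (range (l x)).
    by split; [exists (l x 0), 0|exists (u x 0) => _ [h _ <-]].
  split.
    rewrite le_max; apply/orP; right; apply: sup_upper_bound => //; by exists g.
  rewrite ge_max; apply/andP; split.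
    by have [H _] := mP (g, x); rewrite addr_ge0 // mulr_ge0 ?powR_ge0 // ltW.
  by apply: ge_sup; [exists (l x 0), 0|move=> _ [h _ <-]].
have b'_avg g x y : pball g x y -> `|m (g, x) - b' y| <= C3 * vol g `^ th.
  move=> xy; have [] := b'_ball g y; rewrite /l /u (m_ball _ _ _ xy) => H1 H2.
  by rewrite ler_norml; apply/andP; split; lra.
have b'L : ball_lipschitz th (2 * C3) b'.
  move=> g x y xy; have := b'_avg g x y xy; have := b'_avg g x x (pball_center p_pr g x).
  rewrite !ler_norml => /andP[H1 H2] /andP[H3 H4].
  by rewrite -mulrA; apply/andP; split; lra.
have L0 : 0 < 2 * C3 by exact: mulr_gt0.
exists b', (2 * C3); split=> //; first by move=> x; rewrite le_max lexx.
have mb' := ball_lipschitz_measurable p_pr n_gt0 th0 L0 b'L.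
have mbb : measurable_fun setT (fun y => b y - b' y) by exact: measurable_funB.
pose C4 := C1 + C3; have C40 : 0 < C4 by exact: addr_gt0.
have small k (a : T) : (\int[mu]_(y in pball 0 a) `|b y - b' y|%:E <= (C4 * vol (- k%:Z) `^ th)%:E)%E.
  set e := C4 * _; rewrite -[leRHS](_ : \int[mu]_(y in pball 0 a) cst e%:E y = _)%E; last first.
    by rewrite integral_cst // (haar_pball_vol p_pr hmu) /vol expr0z mule1.
  have e0 : 0 <= e by rewrite mulr_ge0 ?powR_ge0 // ltW.
  apply: (ball_invariant_le_integral p_pr (g := - k%:Z)) => //.
  - exact: measurable_abs_EFin.
  - by move=> x ax; apply: (pball_sub p_pr) => //; rewrite oppr_le0.
  move=> x _; rewrite integral_cst // (haar_pball_vol p_pr hmu).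
  set v := vol _; pose c := C3 * v `^ th.
  have c0 : 0 <= c by rewrite mulr_ge0 ?powR_ge0 // ltW.
  apply: (@le_trans _ _ (\int[mu]_(y in pball (- k%:Z) x) (`|b y - m (- k%:Z, x)|%:E + cst c%:E y))%E).
    apply: ge0_le_integral => //; first exact: measurable_abs_EFin.
      by apply: emeasurable_funD => //; apply: measurable_abs_EFin; exact: measurable_funB.
    move=> y xy; rewrite -EFinD lee_fin.
    have -> : b y - b' y = (b y - m (- k%:Z, x)) + (m (- k%:Z, x) - b' y) by ring.
    by apply: le_trans (ler_normD _ _) _; rewrite lerD2l; exact: b'_avg.
  rewrite ge0_integralD //; last by apply: measurable_abs_EFin; exact: measurable_funB.
  rewrite integral_cst // (haar_pball_vol p_pr hmu) -/v.
  apply: le_trans (leeD (devm _ _) (lexx _)) _.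
  rewrite -EFinM -EFinD -EFinM lee_fin -/v /e /C4 -/v le_eqVlt; apply/orP; left; apply/eqP.
  by rewrite /c; ring.
have zero (a : T) : \forall y \ae mu, pball 0 a y -> b y = b' y.
  have I0 : (\int[mu]_(y in pball 0 a) `|(b y - b' y)%:E| = 0)%E.
    apply/eqP; rewrite eq_le; apply/andP; split; last by apply: integral_ge0.
    apply/lee_addgt0Pr => e e0; rewrite add0e.
    have [k ke] := vol_small p_pr n_gt0 th0 (divr_gt0 e0 C40).
    apply: le_trans (small k a) _; rewrite lee_fin mulrC -ler_pdivlMr //; exact: ltW.
  have mD : measurable_fun (pball 0 a) (fun y => (b y - b' y)%:E).
    by apply/measurable_EFinP; exact: measurable_funTS.
  have /(ae_eq_integral_abs mu (mB 0 a) mD) := I0.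
  by apply: filterS => y H /H [] /eqP; rewrite subr_eq0 => /eqP.
have : \forall y \ae mu, forall i, pball 0 (pcenter p n i) y -> b y = b' y.
  by apply/ae_foralln => i; exact: zero.
by apply: filterS => y Hy; have [i iy] := pcenter_dense p_pr 0 y; exact: Hy iy.
Qed.

End Campanato.

(** * Constant exponents *)

Section ConstantExponents.
Context {R : realType} {p n : nat}.
Hypothesis p_pr : prime p.
Variable mu : {measure set (Qpn p n) -> \bar R}.
Hypothesis hmu : haar_measure mu.
Local Notation T := (Qpn p n).

Lemma haar_setT_gt0 : (0 < mu setT)%E.
Proof.
apply: (@lt_le_trans _ _ (mu (pball 0 (0 : T)))); first by rewrite hmu.2 lte01.
apply: le_measure; rewrite ?inE //; exact: measurable_pball.
Qed.

Lemma ae_ball_const g (a : T) (P : Prop) : (\forall x \ae mu, pball g a x -> P) -> P.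
Proof.
move=> [N [mN N0 BN]]; apply: contrapT => nP.
have : (mu (pball g a) <= mu N)%E.
  apply: le_measure; rewrite ?inE //; first exact: measurable_pball.
  by move=> x ax; apply: BN => /= /(_ ax).
by rewrite N0 (haar_pball_vol p_pr hmu) lee_fin leNgt vol_gt0.
Qed.

Lemma ess_inf_on_cst g (a : T) (c : R) : ess_inf_on mu (pball g a) (cst c) = c%:E.
Proof.
apply/eqP; rewrite eq_le; apply/andP; split.
  by apply: ge_ereal_sup => y Hy; exact: (@ae_ball_const g a (y <= c%:E)%E Hy).
by apply: ereal_sup_ubound; exact: nearW.
Qed.

Lemma ess_sup_on_cst g (a : T) (c : R) : ess_sup_on mu (pball g a) (cst c) = c%:E.
Proof.
apply/eqP; rewrite eq_le; apply/andP; split.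
  by apply: ereal_inf_lbound; exact: nearW.
by apply: le_ereal_inf_tmp => y Hy; exact: (@ae_ball_const g a (c%:E <= y)%E Hy).
Qed.

Lemma log_holder_cst (c : R) : 1 < c -> log_holder mu (cst c).
Proof.
have muT := haar_setT_gt0; move=> c1; split.
  split=> //=.
  - by rewrite (ess_inf_cstr _ muT) lte_fin.
  - by move=> x; rewrite (ess_inf_cstr _ muT) (ess_sup_cstr _ muT) lexx.
  - by rewrite (ess_sup_cstr _ muT) ltry.
exists 1; split=> // [g x|x y].
  by rewrite ess_inf_on_cst ess_sup_on_cst -EFinB subrr mule0 lee_fin.
have p1 : 1 <= p%:R :> R by rewrite ler1n prime_gt0.
rewrite subrr normr0 div1r invr_ge0 divr_ge0 ?ln_ge0 //.
by rewrite (le_trans p1) // lerDl ler0q le_min !padic_norm_ge0.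
Qed.

(** Any constant r strictly between 1 and n/beta defines an admissible pair. *)
Lemma admissible_exists (beta : R) : (0 < n)%N -> 0 < beta < 1 ->
  exists r q : T -> R, admissible mu beta r q.
Proof.
move=> n0 /andP[b0 b1]; have nR : 1 <= n%:R :> R by rewrite ler1n.
have nR0 : 0 < n%:R :> R := lt_le_trans ltr01 nR.
pose t : R := n%:R / beta; have t1 : 1 < t.
  by rewrite ltr_pdivlMr // mul1r (lt_le_trans b1).
pose c : R := (1 + t) / 2; have [c1 ct] : 1 < c /\ c < t by rewrite /c; split; lra.
have c0 : 0 < c := lt_trans ltr01 c1.
have tE : beta / n%:R = t^-1 by rewrite invf_div.
pose d : R := (c^-1 - t^-1)^-1.
have e0 : 0 < c^-1 - t^-1 by rewrite subr_gt0 ltf_pV2 ?posrE // (lt_trans ltr01).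
have d1 : 1 < d.
  rewrite invf_gt1 //; apply: (@lt_trans _ _ c^-1); last by rewrite invf_lt1.
  by rewrite gtrBl invr_gt0 (lt_trans ltr01).
have lc := log_holder_cst c1; have ld := log_holder_cst d1.
exists (cst c), (cst d); split=> //; first exact: lc.1.
  by rewrite (ess_sup_cstr _ haar_setT_gt0) lte_fin.
by move=> x; rewrite /cst tE /d invrK.
Qed.

End ConstantExponents.

(** * Oscillation on balls *)

Section Oscillation.
Context {R : realType} {p n : nat}.
Hypothesis p_pr : prime p.
Variable mu : {measure set (Qpn p n) -> \bar R}.
Hypothesis hmu : haar_measure mu.
Local Notation T := (Qpn p n).
Local Notation vol := (@vol R p n).

Definition deviation (b : T -> R) (B : set T) (x : T) : \bar R :=
  (((b x)%:E - local_maximal mu B b x) * (\1_B x)%:E)%E.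

Lemma oscillation_sup_lty (beta D : R) (q b : T -> R) : log_holder mu q ->
  (forall g x, (var_norm mu q (deviation b (pball g x)) <=
     (D * vol g `^ (beta / n%:R))%:E *
       var_norm mu q (EFin \o (\1_(pball g x) : T -> R)))%E) ->
  (oscillation_sup mu beta q b < +oo)%E.
Proof.
move=> lq devD; have mq := log_holder_measurable lq.
have [sq [Sq [sq1 qB]]] := exponent_bounds lq.1.
have q1 x : 1 <= q x by have /andP[qx _] := qB x; exact: le_trans (ltW sq1) qx.
apply: (@le_lt_trans _ _ D%:E); last exact: ltry.
apply: ge_ereal_sup => _ [[g x] _ <-] /=.
have V0 := vol_gt0 (R := R) (n := n) p_pr g.
have [N N0 NE] := var_norm_indic_ball p_pr hmu g x mq q1.
have Vt0 : 0 < vol g `^ (beta / n%:R) by exact: powR_gt0.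
have := devD g x; rewrite NE /oscillation => dD.
rewrite (haar_pball_vol p_pr hmu) poweR_EFin inver gt_eqF //.
rewrite (_ : var_norm mu q (fun y => (\1_(pball g x) y)%:E) = N%:E) ?inver ?gt_eqF //.
rewrite lee_pdivrMl // lee_pdivrMr //; apply: le_trans dD _.
by rewrite -!EFinM lee_fin [D * _]mulrC.
Qed.

(** Inside a ball B, the commutator applied to the characteristic function of B
    is b - M_B b: a ball around a point of B either lies in B, or contains B
    and then its average of |b 1_B| is at most the average over B. *)
Lemma commutator_indic (b : T -> R) g (a x : T) : measurable_fun setT b -> pball g a x ->
  commutator mu b (\1_(pball g a) : T -> R) x = ((b x)%:E - local_maximal mu (pball g a) b x)%E.
Proof.
move=> mb ax; rewrite -(pball_eq p_pr ax); set B := pball g x.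
have mB h : measurable (pball h x : set T) by exact: measurable_pball.
have m1 : measurable_fun setT (\1_B : T -> R) by exact: measurable_indic_pball.
have V0 h := vol_gt0 (R := R) (n := n) p_pr h.
have ind01 y : 0 <= (\1_B y : R) <= 1 by rewrite indicE; case: (_ \in _); rewrite ?lexx ?ler01.
have M1 : maximal mu (\1_B : T -> R) x = 1%E.
  apply/eqP; rewrite eq_le; apply/andP; split.
    apply: ge_ereal_sup => _ [h _ <-]; rewrite (averageE p_pr hmu).
    apply: (@le_trans _ _ ((vol h)^-1%:E * (vol h)%:E)%E); last by rewrite -EFinM mulVf // gt_eqF.
    rewrite lee_wpmul2l ?lee_fin ?invr_ge0 ?(ltW (V0 h)) //.
    rewrite -[leRHS]mul1e -(haar_pball_vol p_pr hmu h x) -integral_cst //.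
    apply: ge0_le_integral => //; first exact: measurable_abs_EFin.
    by move=> y _; rewrite lee_fin ger0_norm; have /andP[] := ind01 y.
  apply: le_trans (average_le_maximal mu _ g x); rewrite (averageE p_pr hmu).
  rewrite (eq_integral (cst 1%E)); last by move=> y yB; rewrite indicE yB normr1.
  by rewrite integral_cst // (haar_pball_vol p_pr hmu) mul1e -EFinM mulVf // gt_eqF.
have in_ball h : pball h x `<=` B ->
    average mu (fun y => b y * \1_B y)%R (pball h x) = average mu b (pball h x).
  move=> hB; rewrite !(averageE p_pr hmu); congr (_ * _)%E; apply: eq_integral => y.
  by rewrite inE => /hB yB; rewrite indicE mem_set // mulr1.
have bB : (average mu b (pball g x) <= local_maximal mu B b x)%E.
  by apply: ereal_sup_ubound; exists g; [exact: subset_refl|reflexivity].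
rewrite /commutator M1 mule1; congr (_ - _)%E; apply/eqP; rewrite eq_le; apply/andP; split.
  apply: ge_ereal_sup => _ [h _ <-]; have [hB|hB] := pselect (pball h x `<=` B).
    rewrite in_ball //; apply: ereal_sup_ubound; exists h; [exact: hB|reflexivity].
  have gh : g <= h.
    by rewrite leNgt; apply/negP => /ltW hg; apply: hB; exact: (pball_le p_pr).
  have Bh : B `<=` pball h x by exact: (pball_le p_pr).
  apply: le_trans bB; rewrite !(averageE p_pr hmu); apply: lee_pmul.
  - by rewrite lee_fin invr_ge0 ltW.
  - by apply: integral_ge0 => y _; rewrite lee_fin.
  - rewrite lee_fin lef_pV2 ?posrE // -lee_fin -(haar_pball_vol p_pr hmu g x).
    rewrite -(haar_pball_vol p_pr hmu h x); apply: le_measure; rewrite ?inE //.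
  rewrite [leRHS]integral_mkcond [leLHS]integral_mkcond; apply: ge0_le_integralT => y.
    by rewrite patchE; case: ifP.
  rewrite !patchE indicE; case: ifPn => _; case: (boolP (y \in B)) => _ //=.
  - by rewrite mulr1.
  - by rewrite mulr0 normr0.
  - by change (0%E <= `|b y|%:E)%E; rewrite lee_fin.
apply: ge_ereal_sup => _ [h hB <-]; rewrite -(in_ball h hB).
exact: average_le_maximal.
Qed.

(** The commutator is tested on the characteristic function of a ball, whose norm
    in L^r is at most 2 V^(beta/n) times its norm in L^q, with V its measure. *)
Theorem bounded_oscillation (beta : R) (r q b : T -> R) : (0 < n)%N -> 0 < beta ->
  measurable_fun setT b -> log_holder mu r -> log_holder mu q ->
  (forall x, (q x)^-1 = (r x)^-1 - beta / n%:R) ->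
  bounded_op mu r q (commutator mu b) -> (oscillation_sup mu beta q b < +oo)%E.
Proof.
move=> n0 b0 mb lr lq qr [C bC].
have mr := log_holder_measurable lr; have mq := log_holder_measurable lq.
have [sr [Sr [sr1 rB]]] := exponent_bounds lr.1.
have [sq [Sq [sq1 qB]]] := exponent_bounds lq.1.
have r1 x : 1 <= r x by have /andP[rx _] := rB x; exact: le_trans (ltW sr1) rx.
have q1 x : 1 <= q x by have /andP[qx _] := qB x; exact: le_trans (ltW sq1) qx.
have r0 x : 0 < r x := lt_le_trans ltr01 (r1 x).
have th0 : 0 < beta / n%:R by rewrite divr_gt0 // ltr0n.
pose C' := Num.max 1 C; have C'0 : 0 <= C' by rewrite le_max ler01.
apply: (@oscillation_sup_lty _ (C' * 2)) => // g x.
have f_in : var_Lebesgue mu r (\1_(pball g x) : T -> R).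
  split; first exact: measurable_indic_pball.
  exists 1; split=> //; rewrite (modular_indic mu _ _ r0 ltr01).
  under eq_integral do rewrite invr1 powR1.
  by rewrite integral_cst ?(haar_pball_vol p_pr hmu) ?mul1e ?ltry //; exact: measurable_pball.
apply: (@le_trans _ _ (var_norm mu q (commutator mu b (\1_(pball g x) : T -> R)))).
  apply: le_var_norm => [y|y]; first exact: le_trans ler01 (q1 y).
  rewrite /deviation indicE; case: (boolP (y \in pball g x)) => [/set_mem xy|_] /=.
    by rewrite (commutator_indic mb xy) mule1.
  by rewrite mule0 abse0.
apply: le_trans (bC _ f_in) _.
apply: (@le_trans _ _ (C'%:E * var_norm mu r (EFin \o (\1_(pball g x) : T -> R)))%E).
  by rewrite lee_wpmul2r ?var_norm_ge0 // lee_fin le_max lexx orbT.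
rewrite -mulrA EFinM -muleA lee_wpmul2l ?lee_fin //.
exact: var_norm_indic_holder.
Qed.

(** All averages over balls around x inside B differ from b(x) by at most the
    Lipschitz bound for B, so b - M_B b is bounded by it on B. *)
Theorem lipschitz_oscillation (beta L : R) (q b b' : T -> R) : (0 < n)%N -> 0 < beta ->
  0 < L -> measurable_fun setT b -> log_holder mu q ->
  ball_lipschitz (beta / n%:R) L b' -> (forall x, 0 <= b' x) ->
  (\forall x \ae mu, b x = b' x) -> (oscillation_sup mu beta q b < +oo)%E.
Proof.
move=> n0 b0 L0 mb lq bL b'0 bb'.
have th0 : 0 < beta / n%:R by rewrite divr_gt0 // ltr0n.
have mq := log_holder_measurable lq.
have [sq [Sq [sq1 qB]]] := exponent_bounds lq.1.
have q0 x : 0 <= q x.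
  by have /andP[qx _] := qB x; rewrite (le_trans ler01) // (le_trans (ltW sq1)).
have mb' := ball_lipschitz_measurable p_pr n0 th0 L0 bL.
have V0 g := vol_gt0 (R := R) (n := n) p_pr g.
apply: (@oscillation_sup_lty _ L) => // g x.
set c := L * vol g `^ (beta / n%:R).
have c0 : 0 < c by rewrite mulr_gt0 // powR_gt0.
apply: ae_le_var_norm => //; first exact: measurable_indic_pball.
apply: filterS (bb') => y byE; rewrite /deviation indicE.
case: (boolP (y \in pball g x)) => [/set_mem xy|_] /=; last by rewrite mule0 abse0 normr0 mulr0.
rewrite mule1 normr1 mulr1 byE.
have avg h : pball h y `<=` pball g x ->
    ((b' y - c)%:E <= average mu b (pball h y) <= (b' y + c)%:E)%E.
  move=> hB; have mB := measurable_pball p_pr h y; have Vh := V0 h.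
  have dev z : pball h y z -> `|b' z - b' y| <= c.
    move=> yz; rewrite distrC; apply: bL.
    by apply: (pball_trans p_pr (pball_sym p_pr xy)); exact: hB.
  have -> : average mu b (pball h y) = ((vol h)^-1%:E * \int[mu]_(z in pball h y) (b' z)%:E)%E.
    rewrite (averageE p_pr hmu); congr (_ * _)%E; apply: ge0_ae_eq_integral => //.
    - exact: measurable_abs_EFin.
    - by apply/measurable_EFinP; exact: measurable_funTS.
    - by move=> z _; rewrite lee_fin.
    by apply: filterS bb' => z -> _; rewrite ger0_norm.
  have cstE (k : R) : (k%:E = (vol h)^-1%:E * \int[mu]_(z in pball h y) cst k%:E z)%E.
    by rewrite integral_cst // (haar_pball_vol p_pr hmu) -EFinM mulrCA mulVf ?mulr1 ?gt_eqF.
  have mbB : measurable_fun (pball h y) (fun z => (b' z)%:E).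
    by apply/measurable_EFinP; exact: measurable_funTS.
  apply/andP; split.
    have [neg|pos] := leP (b' y - c) 0.
      apply: (@le_trans _ _ 0%E); first by rewrite lee_fin.
      rewrite mule_ge0 ?lee_fin ?invr_ge0 ?(ltW Vh) //.
      by apply: integral_ge0 => z _; rewrite lee_fin.
    rewrite (cstE (b' y - c)) lee_wpmul2l ?lee_fin ?invr_ge0 ?(ltW Vh) //.
    apply: ge0_le_integral => //.
    - by move=> z _; rewrite lee_fin ltW.
    - by move=> z yz; rewrite lee_fin; have := dev z yz; rewrite ler_norml => /andP[+ _]; lra.
  rewrite (cstE (b' y + c)) lee_wpmul2l ?lee_fin ?invr_ge0 ?(ltW Vh) //.
  apply: ge0_le_integral => //.
  - by move=> z _; rewrite lee_fin.
  - by move=> z yz; rewrite lee_fin; have := dev z yz; rewrite ler_norml => /andP[_]; lra.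
have lo : ((b' y - c)%:E <= local_maximal mu (pball g x) b y)%E.
  have gB : pball g y `<=` pball g x by rewrite (pball_eq p_pr xy).
  have /andP[+ _] := avg g gB; move=> /le_trans; apply.
  by apply: ereal_sup_ubound; exists g; [exact: gB|reflexivity].
have hi : (local_maximal mu (pball g x) b y <= (b' y + c)%:E)%E.
  by apply: ge_ereal_sup => _ [h hB <-]; have /andP[] := avg h hB.
move: lo hi; case: (local_maximal _ _ _ _) => [z| |]; last by rewrite leeNy_eq.
  rewrite !lee_fin => H1 H2.
  by rewrite ler_norml; apply/andP; split; lra.
by move=> _; rewrite leye_eq.
Qed.

End Oscillation.

(** * The equivalences *)

Theorem corollary1p2 (R : realType) (p n : nat) (hp : prime p) (hn : (1 <= n)%N)
  (mu : {measure set (Qpn p n) -> \bar R}) (hmu : haar_measure mu)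
  (beta : R) (hbeta : 0 < beta < 1)
  (b : Qpn p n -> R) (hb : loc_integrable mu b) :
  [<->
    (* b is taken up to almost-everywhere equality *)
    exists b' : Qpn p n -> R,
      [/\ \forall x \ae mu, b x = b' x,
          lipschitz_space beta b' & forall x, 0 <= b' x];
    forall r q : Qpn p n -> R, admissible mu beta r q ->
      bounded_op mu r q (commutator mu b);
    exists r q : Qpn p n -> R, admissible mu beta r q /\
      bounded_op mu r q (commutator mu b);
    exists r q : Qpn p n -> R, admissible mu beta r q /\
      (oscillation_sup mu beta q b < +oo)%E;
    forall r q : Qpn p n -> R, admissible mu beta r q ->
      (oscillation_sup mu beta q b < +oo)%E].
Proof.
have /andP[b0 b1] := hbeta; have mb := hb.1.
have nR : 1 <= n%:R :> R by rewrite ler1n.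
have th01 : 0 < beta / n%:R < 1.
  rewrite divr_gt0 ?(lt_le_trans ltr01 nR) //= ltr_pdivrMr ?(lt_le_trans ltr01 nR) //.
  by rewrite mul1r (lt_le_trans b1).
have osc_lip r q : admissible mu beta r q -> (oscillation_sup mu beta q b < +oo)%E ->
    exists b' : Qpn p n -> R, [/\ \forall x \ae mu, b x = b' x,
      lipschitz_space beta b' & forall x, 0 <= b' x].
  move=> [_ lq _ _ _] osc; have [th0 _] := andP th01.
  have [C C0 dev] := oscillation_deviation hp hn hmu hb lq osc.
  have [b' [L [L0 bL b'0 bb']]] := campanato hp hn hmu hb th0 C0 dev.
  exists b'; split=> //; exact: ball_lipschitz_lipschitz bL.
tfae.
- move=> [b' [bb' lip b'0]] r q [lr lq _ _ qr].
  have [L L0 bL] := lipschitz_ball_lipschitz hp hn b0 lip.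
  exact: (commutator_bounded hp hn hmu th01 L0 mb bL b'0 bb' lr lq qr).
- move=> H; have [r [q adm]] := admissible_exists hp hmu hn hbeta.
  by exists r, q; split=> //; exact: H.
- move=> [r [q [adm bnd]]]; exists r, q; split=> //; case: adm => lr lq _ _ qr.
  exact: (bounded_oscillation hp hmu hn b0 mb lr lq qr bnd).
- move=> [r [q [adm osc]]] r' q' [_ lq' _ _ _].
  have [b' [bb' lip b'0]] := osc_lip r q adm osc.
  have [L L0 bL] := lipschitz_ball_lipschitz hp hn b0 lip.
  exact: (lipschitz_oscillation hp hmu hn b0 L0 mb lq' bL b'0 bb').
- move=> H; have [r [q adm]] := admissible_exists hp hmu hn hbeta.
  exact: (osc_lip r q adm (H r q adm)).
Qed.
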